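(* Let $1<p<\infty$. The weak limit semigroup $\mathcal{L}_T$ of a typical $T\in(\mathcal{I}_p,\mathrm{SOT})$, of a typical $T\in(\mathcal{U}_p,\mathrm{SOT})$, and of a typical $T\in(\mathcal{C}_p,\mathrm{WOT})$ does not contain any rank-one positive operator; that is, in each of these three spaces the set of $T$ such that $\mathcal{L}_T$ contains no rank-one positive operator is comeager.
   Context: $L^p[0,1]$ is the complex $L^p$-space of Lebesgue measure. An operator $T$ on it is positive if $Tf\ge0$ whenever $f\ge0$. $\mathcal{C}_p$, $\mathcal{I}_p$, $\mathcal{U}_p$ denote the sets of positive contractions, positive (linear) isometries, and positive invertible (surjective) isometries of $L^p[0,1]$. WOT and SOT are the weak and strong operator topologies. A set is comeager if it contains a dense $G_\delta$ set. $\mathcal{L}_T$ is the set of operators $S$ such that $T^{n_k}\to S$ in the weak operator topology for some strictly increasing sequence $(n_k)$ in $\mathbb{N}$. *)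

(* Defs.v *)
From HB Require Import structures.
From mathcomp Require Import all_boot all_order all_algebra ring_quotient.
From mathcomp Require Import all_classical all_reals all_analysis.
From mathcomp Require Import measurable_realfun borel_hierarchy complex.

Set Implicit Arguments.
Unset Strict Implicit.
Unset Printing Implicit Defensive.

Import Order.TTheory GRing.Theory Num.Theory.
Import numFieldNormedType.Exports.
Import Normc.

Local Open Scope classical_set_scope.
Local Open Scope ring_scope.
Local Open Scope quotient_scope.

Lemma normc_ge0 (R : rcfType) (z : R[i]) : 0 <= normc z.
Proof. by case: z => a b; exact: sqrtr_ge0. Qed.

Section complex_functions.
Context d (T : measurableType d) (R : realType).
Variables (mu : {measure set T -> \bar R}) (p : R).
Local Notation C := (R[i]^o).
Implicit Types f g : T -> C.

(* R[i] carries no sigma-algebra in the library. *)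
Definition cmeasurable f :=
  measurable_fun setT (@complex.Re R \o f : T -> R) /\
  measurable_fun setT (@complex.Im R \o f : T -> R).

Definition CLnorm f : \bar R := 'N[mu]_(p%:E)[EFin \o (@normc R \o f)]%E.

Lemma cmeasurable_normc f : cmeasurable f ->
  measurable_fun setT (@normc R \o f : T -> R).
Proof.
move=> [mr mi]; rewrite (_ : _ \o _ =
    (@powR R ^~ 2^-1)
    \o (fun x => complex.Re (f x) ^+ 2 + complex.Im (f x) ^+ 2)).
  apply: measurableT_comp; first exact: measurable_powR.
  by apply: measurable_funD; apply: measurable_funX.
apply/funext => x /=; rewrite powR12_sqrt ?addr_ge0 ?sqr_ge0//.
by case: (f x).
Qed.

Lemma cmeasurable_lin a f g : cmeasurable f -> cmeasurable g ->
  cmeasurable (a *: f + g).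
Proof.
case: a => a b [fr fi] [gr gi]; split.
- rewrite (_ : _ \o _ = (fun x => a * complex.Re (f x) - b * complex.Im (f x)
                                  + complex.Re (g x))).
    apply: measurable_funD => //.
    by apply: measurable_funB; apply: measurable_funM.
  apply/funext => x /=; rewrite [in LHS]/GRing.add/= [in LHS]/GRing.scale/=.
  by case: (f x) => u v; case: (g x).
- rewrite (_ : _ \o _ = (fun x => a * complex.Im (f x) + b * complex.Re (f x)
                                  + complex.Im (g x))).
    apply: measurable_funD => //.
    by apply: measurable_funD; apply: measurable_funM.
  apply/funext => x /=; rewrite [in LHS]/GRing.add/= [in LHS]/GRing.scale/=.
  by case: (f x) => u v; case: (g x).
Qed.

Lemma cmeasurable0 : cmeasurable 0.
Proof. by split; exact: measurable_cst. Qed.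

Lemma cmeasurableD f g : cmeasurable f -> cmeasurable g -> cmeasurable (f + g).
Proof. by move=> mf mg; rewrite -[f]scale1r; exact: cmeasurable_lin. Qed.

Lemma cmeasurableZ a f : cmeasurable f -> cmeasurable (a *: f).
Proof.
by move=> mf; rewrite -[_ *: _]addr0; apply: cmeasurable_lin => //; exact: cmeasurable0.
Qed.

Let mintegrand (h : T -> R) : measurable_fun setT h ->
  measurable_fun setT (fun x => (`|(EFin \o h) x| `^ p)%E).
Proof.
move=> mh; apply: (measurableT_comp (f := fun x => (x `^ p)%E)) => //.
  exact: measurable_poweR.
apply: (measurableT_comp (f := abse)) => //.
exact/measurable_EFinP.
Qed.

Lemma CLnorm_ae f g : cmeasurable f -> cmeasurable g ->
  {ae mu, forall x, f x = g x} -> CLnorm f = CLnorm g.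
Proof.
move=> mf mg fg; rewrite /CLnorm unlock; congr (_ `^ _)%E.
apply: ae_eq_integral => //; [exact/mintegrand/cmeasurable_normc
                             |exact/mintegrand/cmeasurable_normc|].
by apply: filterS fg => x fgx _ /=; rewrite fgx.
Qed.

Hypothesis p1 : 1 <= p.
Let p0 : 0 < p. Proof. exact: lt_le_trans p1. Qed.

Lemma CLnormD f g : cmeasurable f -> cmeasurable g ->
  (CLnorm (f + g)%R <= CLnorm f + CLnorm g)%E.
Proof.
move=> mf mg; have mf' := cmeasurable_normc mf.
have mg' := cmeasurable_normc mg.
apply: le_trans (minkowski_EFin mu mf' mg' p1).
rewrite /CLnorm unlock; apply: gt0_ler_poweR.
- by rewrite invr_ge0 ltW.
- by rewrite in_itv/= leey andbT integral_ge0// => x _; exact: poweR_ge0.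
- by rewrite in_itv/= leey andbT integral_ge0// => x _; exact: poweR_ge0.
apply: ge0_le_integral => //.
- by move=> x _; exact: poweR_ge0.
- exact/mintegrand/cmeasurable_normc/cmeasurableD.
- exact/mintegrand/measurable_funD.
move=> x _; apply: gt0_ler_poweR; first exact: ltW.
- by rewrite in_itv/= leey andbT lee_fin.
- by rewrite in_itv/= leey andbT lee_fin.
by rewrite /= lee_fin !ger0_norm ?addr_ge0 ?normc_ge0//; exact: le_normcD.
Qed.

Lemma CLnormZ a f : cmeasurable f ->
  CLnorm (a *: f) = ((normc a)%:E * CLnorm f)%E.
Proof.
move=> mf; rewrite /CLnorm unlock.
have a0 := normc_ge0 a.
rewrite (_ : (\int[mu]_x _)%E =
    ((normc a `^ p)%:E * \int[mu]_x `|(EFin \o (@normc R \o f)) x| `^ p)%E).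
  rewrite poweRM ?lee_fin ?powR_ge0//; last first.
    by apply: integral_ge0 => x _; exact: poweR_ge0.
  by rewrite poweR_EFin -powRrM mulfV ?gt_eqF// powRr1.
rewrite -ge0_integralZl_EFin ?powR_ge0//; last 2 first.
  by move=> x _; exact: poweR_ge0.
  exact/mintegrand/cmeasurable_normc.
apply: eq_integral => x _ /=.
rewrite (_ : normc _ = normc a * normc (f x)); last exact: normcM.
by rewrite normrM (ger0_norm a0) powRM.
Qed.

Lemma CLnorm0_ae f : cmeasurable f -> CLnorm f = 0%E ->
  {ae mu, forall x, f x = 0}.
Proof.
move=> mf f0.
have := Lnorm_eq0_eq0 (mu := mu) _ _ f0; case.
- exact/measurable_EFinP/cmeasurable_normc.
- by rewrite lte_fin.
move=> N [mN N0 sN]; exists N; split => // x /= fx0; apply: sN => /=.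
by apply: contra_not fx0 => /(_ I) [/eq0_normc].
Qed.

Lemma ae_CLnorm0 f : cmeasurable f -> {ae mu, forall x, f x = 0} ->
  CLnorm f = 0%E.
Proof.
move=> mf f0; rewrite (CLnorm_ae mf cmeasurable0 f0) /CLnorm.
rewrite (_ : EFin \o _ = cst 0%E); last first.
  by apply/funext => x; congr EFin; exact: normc0.
by rewrite Lnorm0// eqe gt_eqF.
Qed.

End complex_functions.

Section complex_Lp.
Context d (T : measurableType d) (R : realType).
Variables (mu : {measure set T -> \bar R}) (p : R) (p1 : 1 <= p).
Local Notation C := (R[i]^o).

(* p1 is a parameter so that the closure properties below, which depend on it,
   can be canonical. *)
Definition CLfun_pred (p1 : 1 <= p) : {pred T -> C} :=
  mem [set f | cmeasurable f /\ (CLnorm mu p f < +oo)%E].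

Lemma CLfun_submod_closed : submod_closed (CLfun_pred p1).
Proof.
split.
  rewrite inE /=; split; first exact: cmeasurable0.
  rewrite ae_CLnorm0//; first exact: cmeasurable0.
  exact: aeW.
move=> a f g; rewrite !inE/= => -[mf fy] [mg gy]; split.
  exact: cmeasurable_lin.
apply: le_lt_trans (CLnormD _ p1 _ mg) _; first exact: cmeasurableZ.
by rewrite lte_add_pinfty// CLnormZ// lte_mul_pinfty// lee_fin normc_ge0.
Qed.
HB.instance Definition _ :=
  GRing.isSubmodClosed.Build R[i] (T -> C) (CLfun_pred p1) CLfun_submod_closed.

Record CLfun := MkCLfun { CLfun_val :> T -> C; _ : CLfun_val \in CLfun_pred p1 }.

HB.instance Definition _ := [isSub for CLfun_val].
HB.instance Definition _ := [Choice of CLfun by <:].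
HB.instance Definition _ := [SubChoice_isSubLmodule of CLfun by <:].

Lemma CLfunE a (f g : CLfun) x :
  (a *: f + g : CLfun) x = a * f x + g x :> R[i].
Proof. by []. Qed.

Definition CLnull : {pred CLfun} :=
  mem [set f : CLfun | {ae mu, forall x, f x = 0}].

Lemma CLnull_submod_closed : submod_closed CLnull.
Proof.
split; first by rewrite inE /=; exact: aeW.
move=> a f g; rewrite !inE/= => f0 g0.
apply: filterS2 f0 g0 => x fx0 gx0; apply: etrans (CLfunE a f g x) _.
by rewrite fx0 gx0 mulr0 addr0.
Qed.
HB.instance Definition _ :=
  GRing.isSubmodClosed.Build R[i] CLfun CLnull CLnull_submod_closed.

(* The complex L^p space of mu. *)
Definition CLp : Type := Quotient.quot CLnull.
HB.instance Definition _ := GRing.Zmodule.on CLp.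
HB.instance Definition _ := EqQuotient.on CLp.

Definition CLp_pi (f : CLfun) : CLp := \pi f.

Lemma CLp_reprK (u : CLp) : CLp_pi (repr u) = u.
Proof. exact: reprK. Qed.

Lemma CLp_pi0 : CLp_pi 0 = 0.
Proof. exact: pi_zeror. Qed.

Lemma CLp_piD f g : CLp_pi (f + g) = CLp_pi f + CLp_pi g.
Proof. exact: pi_addr. Qed.

(* A representative of the class u. *)
Definition CLp_fun (u : CLp) : T -> C := CLfun_val (repr u).

Lemma CLp_piP (f g : CLfun) :
  CLp_pi f = CLp_pi g <-> {ae mu, forall x, f x = g x}.
Proof.
rewrite /CLp_pi; have E x : (f - g : CLfun) x = f x - g x by [].
split=> [/eqP|fg].
  rewrite -Quotient.idealrBE inE; apply: filterS => x /eqP.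
  by rewrite E subr_eq0 => /eqP.
apply/eqP; rewrite -Quotient.idealrBE inE; apply: filterS fg => x fgx.
by rewrite E fgx subrr.
Qed.

Lemma CLp_reprE (f : CLfun) : {ae mu, forall x, CLp_fun (CLp_pi f) x = f x}.
Proof. by apply/CLp_piP; rewrite CLp_reprK. Qed.

Definition CLp_scale (a : R[i]) (u : CLp) : CLp := CLp_pi (a *: repr u).

Lemma CLp_piZ a (f : CLfun) : CLp_pi (a *: f) = CLp_scale a (CLp_pi f).
Proof.
apply/CLp_piP; apply: filterS (CLp_reprE f) => x fx.
by rewrite -[LHS]/(a * f x) -fx.
Qed.

Let scaleA a b u : CLp_scale a (CLp_scale b u) = CLp_scale (a * b) u.
Proof. by rewrite -[u in LHS]CLp_reprK -2!CLp_piZ scalerA. Qed.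
Let scale1 : left_id 1 CLp_scale.
Proof. by move=> u; rewrite /CLp_scale scale1r CLp_reprK. Qed.
Let scaleDr : right_distributive CLp_scale +%R.
Proof.
move=> a u v; rewrite -[u]CLp_reprK -[v]CLp_reprK -!CLp_piZ -!CLp_piD -CLp_piZ.
by rewrite scalerDr.
Qed.
Let scaleDl u : {morph CLp_scale^~ u : a b / a + b}.
Proof. by move=> a b; rewrite /CLp_scale -CLp_piD scalerDl. Qed.

HB.instance Definition _ :=
  GRing.Zmodule_isLmodule.Build R[i] CLp scaleA scale1 scaleDr scaleDl.

Lemma CLfunP (f : CLfun) : cmeasurable f /\ (CLnorm mu p f < +oo)%E.
Proof. by have := valP f; rewrite inE. Qed.

(* The norm of a normed module over R[i] is R[i]-valued, hence the embedding of R
   into R[i]. *)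
Definition CLp_norm (u : CLp) : R[i] := (fine (CLnorm mu p (CLp_fun u)))%:C%C.

Lemma CLp_norm_pi (f : CLfun) :
  CLp_norm (CLp_pi f) = (fine (CLnorm mu p f))%:C%C.
Proof.
congr (fine _)%:C%C; apply: CLnorm_ae (CLp_reprE f); exact: (CLfunP _).1.
Qed.

Let fin_CLnorm (f : CLfun) : CLnorm mu p f \is a fin_num.
Proof. by rewrite ge0_fin_numE; [exact: (CLfunP f).2|exact: Lnorm_ge0]. Qed.

Lemma CLp_normD u v : CLp_norm (u + v) <= CLp_norm u + CLp_norm v.
Proof.
rewrite -[u]CLp_reprK -[v]CLp_reprK -CLp_piD !CLp_norm_pi -rmorphD lecR.
rewrite -fineD// fine_le// ?fin_numD ?fin_CLnorm//.
exact: (CLnormD mu p1 (CLfunP (repr u)).1 (CLfunP (repr v)).1).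
Qed.

Lemma CLp_normZ a u : CLp_norm (a *: u) = `|a| * CLp_norm u.
Proof.
rewrite -[u]CLp_reprK -[a *: _]CLp_piZ !CLp_norm_pi.
rewrite (_ : CLnorm mu p _ = ((normc a)%:E * CLnorm mu p (repr u))%E); last exact: (CLnormZ mu p1 a (CLfunP (repr u)).1).
by rewrite fineM// rmorphM.
Qed.

Lemma CLp_norm0_eq0 u : CLp_norm u = 0 -> u = 0.
Proof.
rewrite -[u]CLp_reprK CLp_norm_pi => /complexI f0.
rewrite -[RHS]CLp_pi0; apply/CLp_piP; apply: (CLnorm0_ae p1 (CLfunP _).1).
by rewrite -[LHS]fineK// f0.
Qed.

HB.instance Definition _ :=
  @Lmodule_isNormed.Build R[i] CLp CLp_norm CLp_normD CLp_normZ CLp_norm0_eq0.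

End complex_Lp.

Section operators.
Context {K : numFieldType} (E : normedModType K).

Record bop := Bop {
  bop_fun :> {linear E -> E};
  bop_continuous : continuous bop_fun }.

Record dual := Dual {
  dual_fun :> {linear E -> K^o};
  dual_continuous : continuous dual_fun }.

HB.instance Definition _ := gen_eqMixin bop.
HB.instance Definition _ := gen_choiceMixin bop.

Lemma bop_id_continuous : continuous (idfun : E -> E).
Proof. by move=> x; exact: cvg_id. Qed.

Definition bop_id : bop := @Bop idfun bop_id_continuous.

Lemma bop_comp_continuous (S T : bop) : continuous (S \o T).
Proof. by move=> x; apply: continuous_comp; exact: bop_continuous. Qed.

Definition bop_comp (S T : bop) : bop :=
  @Bop (S \o T) (@bop_comp_continuous S T).

Definition bop_pow (T : bop) (n : nat) : bop := iter n (bop_comp T) bop_id.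

(* Coarsest topology making all the maps T |-> T x continuous. *)
Definition sot : Type :=
  initial_topology (fun T : bop => (T : E -> E) : {ptws E -> E}).
HB.instance Definition _ := Topological.on sot.

(* Coarsest topology making all the maps T |-> phi (T x) continuous, for x in E
   and phi in the topological dual of E. *)
Definition wot : Type :=
  initial_topology (fun T : bop =>
    (fun xf => xf.2 (T xf.1)) : {ptws (E * dual) -> K^o}).
HB.instance Definition _ := Topological.on wot.

Definition weak_limits (T : bop) : set bop :=
  [set S | exists n : nat -> nat, {homo n : i j / (i < j)%N} /\
    (fun k => bop_pow T (n k) : wot) @ \oo --> (S : wot)].

Definition rank_one (S : bop) : Prop :=
  exists2 y : E, y != 0 & range S = [set c *: y | c in [set: K]].

Definition bop_contraction (T : bop) : Prop := forall x, `|T x| <= `|x|.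

Definition bop_isometry (T : bop) : Prop := forall x, `|T x| = `|x|.

End operators.

Definition comeager {X : topologicalType} (A : set X) : Prop :=
  exists G : set X, [/\ Gdelta G, dense G & G `<=` A].

(* As a type, [A] is the subspace of [X] with the induced topology. *)
Definition typical_in {X : topologicalType} (A P : set X) : Prop :=
  comeager [set x : A | P (set_val x)].

Section positive_operators.
Context d (T : measurableType d) (R : realType).
Context (mu : {measure set T -> \bar R}) (p : R) (p1 : 1 <= p).
Local Notation E := (CLp mu p1).

(* [0 <= z] in [R[i]] says that [z] is real and nonnegative. *)
Definition CLp_nonneg (u : E) : Prop :=
  {ae mu, forall x, 0 <= (CLp_fun u x : R[i])}.

Definition positive_op (S : bop E) : Prop :=
  forall u, CLp_nonneg u -> CLp_nonneg (S u).

Definition positive_contractions : set (bop E) :=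
  [set S | positive_op S /\ bop_contraction S].

Definition positive_isometries : set (bop E) :=
  [set S | positive_op S /\ bop_isometry S].

Definition positive_surjective_isometries : set (bop E) :=
  [set S | positive_isometries S /\ range S = [set: E]].

Definition no_rank_one_limit : set (bop E) :=
  [set S | ~ exists2 Q, weak_limits S Q & rank_one Q /\ positive_op Q].

End positive_operators.

(* A measure on R concentrated on [0, 1]: functions on R up to equality almost
   everywhere for it are functions on [0, 1] up to equality almost everywhere. *)
Definition lebesgue01 (R : realType) :
    {measure set (measurableTypeR R) -> \bar R} :=
  mrestr (@lebesgue_measure R) (measurable_itv `[0, 1]).

Arguments positive_contractions {d T R} mu {p} p1.
Arguments positive_isometries {d T R} mu {p} p1.
Arguments positive_surjective_isometries {d T R} mu {p} p1.
Arguments no_rank_one_limit {d T R} mu {p} p1.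

(* Main.v *)
Require Import Defs.
From HB Require Import structures.
From mathcomp Require Import all_boot all_order all_algebra.
From mathcomp Require Import all_classical all_reals all_analysis.
From mathcomp Require Import measurable_realfun complex zify ring lra.

Set Implicit Arguments.
Unset Strict Implicit.
Unset Printing Implicit Defensive.

Import Order.TTheory GRing.Theory Num.Theory.
Import numFieldNormedType.Exports.
Import Normc.

Local Open Scope classical_set_scope.
Local Open Scope ring_scope.

(* The rank-one limits are excluded by a condition on T: for every k some T^n 1 has
   mean less than 2^-(k+1) and norm more than 1 - 2^-(k+1). A rank-one positive weak
   limit of powers of T commutes with T, so that its range is spanned by a positive
   eigenvector g of T; then T^n 1 = T^n (1 - min g 1) + T^n (min g 1), where the second
   term is at most min g (T^n 1), hence small, while 1 - min g 1 has norm less than 1.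

   The k-th condition is open in the strong topology. It is also a neighbourhood
   condition in the weak topology at positive isometries, since a net of positive
   contractions converging weakly to a positive isometry converges strongly on positive
   elements (Radon-Riesz). It remains to find positive isometries satisfying all the
   conditions in every nonempty relatively open set.

   Strong density: split each small dyadic cell into pieces indexed by the integers,
   with masses decaying geometrically at a slow rate, and let S act while shifting the
   pieces. The new isometry is near S, and its iterates push the function 1 into
   pieces of tiny mass.

   Weak density of the positive isometries in the contractions: by conditional
   expectations, a contraction is a limit of nonnegative matrices a contracting the
   l^p norm. For a strictly contracting a there is x > 0 such that, with y = a x,
   a^T y^(p-1) <= x^(p-1) (Akcoglu's dilation argument). Then the matrix
   a i j * x j / y i is stochastic, and using it to choose at a very small scale the
   cell from which a value is copied, with multiplier y i / x j, gives weighted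
   composition operators which are isometric up to a mass defect, absorbed on a set of
   probability tau. As the scale decreases, the deviations of these operators from
   their means are almost orthogonal in L^2 and bounded, hence weakly null. *)

(** * Elements and functionals of L^p *)

(** For p = 1 the mean of a nonnegative function is its norm, so no positive isometry could make T^n
    1 small in mean and large in norm. For p > 1 let the masses of the pieces decay like [al ^ p]
    per step: moving a function from the piece k to the piece k' multiplies it by al^(|k| - |k'|),
    and its contribution to the mean is of order al^(|k| + (p - 1)|k'|). As |k| + |k'| is at least
    the number of steps, the mean decays geometrically while the norm is kept, however close al is
    to 1.

    In the weak approximation the multiplier y i / x j, used with probability a i j * x j / y i, has
    mean a i j, and the p-th powers charged to the cell j sum to x j^(1 - p) times the sum over i of
    a i j * y i^(p - 1): this is at most 1 exactly by the inequality satisfied by x. A defect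
    absorbed with probability tau needs a multiplier of order tau^(-1/p), whose mean tau^(1 - 1/p)
    vanishes with tau, again because p > 1.

    In the weak topology the norm is only lower semicontinuous and T^n does not depend continuously
    on T. This is why the comeager set is an intersection of relative interiors, and why density is
    needed for isometries rather than for contractions alone. *)

Section powR_order.
Context (R : realType).
Implicit Types x y r : R.

Lemma powR_le r x y : 0 <= r -> 0 <= x -> x <= y -> x `^ r <= y `^ r.
Proof.
by move=> r0 x0 xy; rewrite ge0_ler_powR// nnegrE// (le_trans x0).
Qed.

Lemma powR_lt r x y : 0 < r -> 0 <= x -> x < y -> x `^ r < y `^ r.
Proof.
by move=> r0 x0 xy; rewrite gt0_ltr_powR// nnegrE// (le_trans x0)// ltW.
Qed.

Lemma powR_leE r x y : 0 < r -> 0 <= x -> 0 <= y -> (x `^ r <= y `^ r) = (x <= y).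
Proof.
move=> r0 x0 y0; apply/idP/idP => [|xy]; last by rewrite powR_le// ltW.
by apply: contraTT; rewrite -!ltNge; exact: powR_lt.
Qed.

Lemma powR_invK r x : r != 0 -> 0 <= x -> (x `^ r^-1) `^ r = x.
Proof. by move=> r0 x0; rewrite -powRrM mulVf// powRr1. Qed.

Lemma powRK_inv r x : r != 0 -> 0 <= x -> (x `^ r) `^ r^-1 = x.
Proof. by move=> r0 x0; rewrite -powRrM mulfV// powRr1. Qed.

End powR_order.

(* Sealed copy of [CLp_fun]: unification would otherwise compare elements of the
   quotient by unfolding them. *)
HB.lock Definition ev d (T : measurableType d) (R : realType)
  (mu : {measure set T -> \bar R}) (p : R) (p1 : 1 <= p) (u : CLp mu p1) :
  T -> R[i] := CLp_fun u.

(** The p-th power of the norm, kept as an extended real: norm comparisons become comparisons of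
    integrals, without roots or finiteness side conditions. *)
HB.lock Definition Npow d (T : measurableType d) (R : realType)
  (mu : {measure set T -> \bar R}) (p : R) (p1 : 1 <= p) (u : CLp mu p1) : \bar R :=
  (\int[mu]_x ((normc (ev u x)) `^ p)%:E)%E.

Section elements.
Context d (T : measurableType d) (R : realType).
Variables (mu : {measure set T -> \bar R}) (p : R) (p1 : 1 <= p).
Local Notation C := (R[i]).
Local Notation E := (CLp mu p1).
Implicit Types (f g : T -> C) (u v : E).

Let p0 : 0 < p. Proof. exact: lt_le_trans p1. Qed.

Lemma aeS (P Q : T -> Prop) : (forall x, P x -> Q x) ->
  {ae mu, forall x, P x} -> {ae mu, forall x, Q x}.
Proof. by move=> PQ; apply: filterS. Qed.

Lemma aeI (P Q : T -> Prop) : {ae mu, forall x, P x} ->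
  {ae mu, forall x, Q x} -> {ae mu, forall x, P x /\ Q x}.
Proof. by move=> hP hQ; apply: filterI. Qed.

Lemma ev_measurable u : cmeasurable (ev u : T -> R[i]^o).
Proof. rewrite ev.unlock; exact: (CLfunP (repr u)).1. Qed.

Lemma evD u v :
  {ae mu, forall x, ev (u + v) x = (ev u x : C) + ev v x}.
Proof.
rewrite ev.unlock; have := CLp_reprE (repr u + repr v).
by rewrite CLp_piD !CLp_reprK; apply: filterS => x ->.
Qed.

Lemma evZ (a : C) u :
  {ae mu, forall x, ev (a *: u) x = a * (ev u x : C)}.
Proof.
rewrite ev.unlock; have := CLp_reprE (a *: repr u).
by rewrite CLp_piZ CLp_reprK; apply: filterS => x ->.
Qed.

Lemma evB u v :
  {ae mu, forall x, ev (u - v) x = (ev u x : C) - ev v x}.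
Proof.
have := evZ (-1) v; have := evD u (-1 *: v).
by rewrite scaleN1r; apply: filterS2 => x -> ->; rewrite mulN1r.
Qed.

Lemma CLp_ext u v : {ae mu, forall x, ev u x = ev v x} -> u = v.
Proof. by rewrite ev.unlock => /CLp_piP; rewrite !CLp_reprK. Qed.

Lemma CLnormE f : CLnorm mu p f =
  ((\int[mu]_x ((normc (f x)) `^ p)%:E) `^ p^-1)%E.
Proof.
rewrite /CLnorm unlock; congr (_ `^ _)%E; apply: eq_integral => x _ /=.
by rewrite ger0_norm ?normc_ge0.
Qed.

Lemma NpowE u : Npow u = (\int[mu]_x ((normc (ev u x)) `^ p)%:E)%E.
Proof. by rewrite Npow.unlock. Qed.

Lemma Npow_ge0 u : (0 <= Npow u)%E.
Proof. by rewrite NpowE; apply: integral_ge0 => x _; rewrite lee_fin powR_ge0. Qed.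

Lemma poweR_inv_lty (x : \bar R) : (0 <= x)%E -> ((x `^ p^-1)%E < +oo)%E = (x < +oo)%E.
Proof.
move=> x0; case: x x0 => [r||] //= r0; first by rewrite !ltry.
by rewrite gt_eqF ?invr_gt0.
Qed.

Lemma Npow_lty u : (Npow u < +oo)%E.
Proof.
have := Npow_ge0 u; rewrite NpowE ev.unlock => h.
by have := (CLfunP (repr u)).2; rewrite CLnormE poweR_inv_lty.
Qed.

Lemma Npow_fin u : Npow u \is a fin_num.
Proof. by rewrite ge0_fin_numE ?Npow_ge0 ?Npow_lty. Qed.

Lemma CLp_normE u : `|u| = ((fine (Npow u)) `^ p^-1)%:C%C.
Proof.
rewrite -[LHS]/(CLp_norm u) /CLp_norm CLnormE.
have -> : CLp_fun u = ev u by rewrite ev.unlock.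
rewrite -NpowE.
by rewrite -[Npow u in LHS]fineK ?Npow_fin// poweR_EFin.
Qed.

Lemma fine_Npow_ge0 u : 0 <= fine (Npow u).
Proof. by rewrite fine_ge0 ?Npow_ge0. Qed.

Lemma CLp_norm_leE u (e : R) : 0 <= e ->
  (`|u| <= e%:C%C) = (Npow u <= (e `^ p)%:E)%E.
Proof.
move=> e0; rewrite CLp_normE lecR -[Npow u in RHS]fineK ?Npow_fin// lee_fin.
rewrite -(@powR_leE _ p) ?powR_ge0//.
by rewrite powR_invK// ?gt_eqF// fine_Npow_ge0.
Qed.

Lemma CLp_norm_ltE u (e : R) : 0 <= e ->
  (`|u| < e%:C%C) = (Npow u < (e `^ p)%:E)%E.
Proof.
move=> e0; rewrite CLp_normE ltcR -[Npow u in RHS]fineK ?Npow_fin// lte_fin.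
rewrite !real_ltNge ?num_real// -(@powR_leE _ p) ?powR_ge0//.
by rewrite powR_invK// ?gt_eqF// fine_Npow_ge0.
Qed.

Lemma CLp_norm_le u v : (`|u| <= `|v|) = (Npow u <= Npow v)%E.
Proof.
by rewrite [`|v|]CLp_normE CLp_norm_leE ?powR_ge0// powR_invK ?fine_Npow_ge0// ?gt_eqF// fineK ?Npow_fin.
Qed.

Lemma CLp_norm_eq u v : Npow u = Npow v -> `|u| = `|v|.
Proof. by move=> uv; rewrite !CLp_normE uv. Qed.

Lemma measurable_normc_powR f : cmeasurable (f : T -> R[i]^o) ->
  measurable_fun setT (fun x => ((normc (f x)) `^ p)%:E).
Proof.
move=> mf; apply/measurable_EFinP; apply: (measurableT_comp (f := fun x => x `^ p)).
  exact: measurable_powR.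
exact: cmeasurable_normc.
Qed.

Record inLp f : Prop := InLp {
  inLp_meas : cmeasurable (f : T -> R[i]^o);
  inLp_fin : (\int[mu]_x ((normc (f x)) `^ p)%:E < +oo)%E }.

Lemma inLpP f : inLp f -> (f : T -> R[i]^o) \in CLfun_pred mu p1.
Proof.
move=> [mf fy]; rewrite inE; split => //; rewrite CLnormE poweR_inv_lty//.
by apply: integral_ge0 => x _; rewrite lee_fin powR_ge0.
Qed.

Lemma inLp_fun u : inLp (ev u).
Proof. by split; [exact: ev_measurable|rewrite -NpowE; exact: Npow_lty]. Qed.

End elements.

(* The class of f (junk value 0 when f is not p-integrable). *)
HB.lock Definition mkLp d (T : measurableType d) (R : realType)
  (mu : {measure set T -> \bar R}) (p : R) (p1 : 1 <= p) (f : T -> R[i]) :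
  CLp mu p1 :=
  if pselect (inLp mu p f) is left h then CLp_pi (MkCLfun (inLpP p1 h)) else 0.

Section mkLp.
Context d (T : measurableType d) (R : realType).
Variables (mu : {measure set T -> \bar R}) (p : R) (p1 : 1 <= p).
Local Notation C := (R[i]).
Local Notation E := (CLp mu p1).
Local Notation mkLp := (mkLp mu p1).
Local Notation inLp := (inLp mu p).
Implicit Types (f g : T -> C) (u v : E).

Lemma ev_mkLp f : inLp f -> {ae mu, forall x, ev (mkLp f) x = f x}.
Proof.
move=> h; rewrite mkLp.unlock ev.unlock; case: pselect => // h'.
exact: (CLp_reprE (MkCLfun (inLpP p1 h'))).
Qed.

Lemma mkLp_eq f g : inLp f -> inLp g -> {ae mu, forall x, f x = g x} ->
  mkLp f = mkLp g.
Proof.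
move=> hf hg fg; apply: CLp_ext.
by apply: aeS (aeI (aeI (ev_mkLp hf) (ev_mkLp hg)) fg) => x [[-> ->] ->].
Qed.

Lemma mkLpK u : mkLp (ev u) = u.
Proof. by apply: CLp_ext; exact: ev_mkLp (inLp_fun u). Qed.

Lemma Npow_mkLp f : inLp f -> Npow (mkLp f) = (\int[mu]_x ((normc (f x)) `^ p)%:E)%E.
Proof.
move=> hf; rewrite NpowE; apply: ae_eq_integral => //.
- exact/measurable_normc_powR/ev_measurable.
- by apply: measurable_normc_powR; exact: inLp_meas hf.
- by apply: filterS (ev_mkLp hf) => x -> _.
Qed.

Lemma inLp_lin (a : C) f g : inLp f -> inLp g -> inLp (fun x => a * f x + g x).
Proof.
move=> hf hg.
have [mh hy] := CLfunP (a *: MkCLfun (inLpP p1 hf) + MkCLfun (inLpP p1 hg)).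
by split; [exact: mh|rewrite CLnormE (poweR_inv_lty p1)// in hy; apply: integral_ge0 => x _; rewrite lee_fin powR_ge0].
Qed.

Lemma mkLp_lin (a : C) f g : inLp f -> inLp g ->
  mkLp (fun x => a * f x + g x) = a *: mkLp f + mkLp g.
Proof.
move=> hf hg; apply: CLp_ext.
have h := aeI (evD (a *: mkLp f) (mkLp g)) (evZ a (mkLp f)).
have h' := aeI (ev_mkLp hf) (ev_mkLp hg).
apply: aeS (aeI (ev_mkLp (inLp_lin a hf hg)) (aeI h h')).
by move=> x [-> [[-> ->] [-> ->]]].
Qed.

End mkLp.

Section real_elements.
Context d (T : measurableType d) (R : realType).
Variables (mu : {measure set T -> \bar R}) (p : R) (p1 : 1 <= p).
Local Notation C := (R[i]).
Local Notation E := (CLp mu p1).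
Implicit Types (h g : T -> R) (u v : E).

Let p0 : 0 < p. Proof. exact: lt_le_trans p1. Qed.

Lemma normc_real (x : R) : normc (x%:C%C) = `|x|.
Proof. by rewrite /= expr0n addr0 sqrtr_sqr. Qed.

Lemma normr_normc (z : R[i]) : `|z| = (normc z)%:C%C.
Proof. by case: z. Qed.

Record rLp h : Prop := RLp {
  rLp_meas : measurable_fun setT h;
  rLp_fin : (\int[mu]_x (`|h x| `^ p)%:E < +oo)%E }.

Definition rl h : E := mkLp mu p1 (fun x => (h x)%:C%C).

Lemma rLp_inLp h : rLp h -> inLp mu p (fun x => (h x)%:C%C).
Proof.
move=> [mh hy]; split; first by split => //; exact: measurable_cst.
by under eq_integral do rewrite normc_real.
Qed.

Lemma ev_rl h : rLp h -> {ae mu, forall x, ev (rl h) x = (h x)%:C%C}.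
Proof. by move=> hh; apply: ev_mkLp; exact: rLp_inLp. Qed.

Lemma Npow_rl h : rLp h -> Npow (rl h) = (\int[mu]_x (`|h x| `^ p)%:E)%E.
Proof.
move=> hh; rewrite Npow_mkLp; last exact: rLp_inLp.
by under eq_integral do rewrite normc_real.
Qed.

Lemma measurable_normr_powR h : measurable_fun setT h ->
  measurable_fun setT (fun x => (`|h x| `^ p)%:E).
Proof.
move=> mh; apply/measurable_EFinP.
apply: (measurableT_comp (f := fun x => x `^ p)); first exact: measurable_powR.
exact: measurableT_comp.
Qed.

Lemma rLp_absle h g : measurable_fun setT h -> (forall x, `|h x| <= `|g x|) ->
  rLp g -> rLp h.
Proof.
move=> mh hg [mg gy]; split; first exact: mh.
apply: le_lt_trans gy.
apply: ge0_le_integral => //.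
- exact: measurable_normr_powR.
- exact: measurable_normr_powR.
by move=> x _; rewrite lee_fin powR_le ?(ltW p0).
Qed.

Lemma rLp_le h g : measurable_fun setT h -> (forall x, `|h x| <= g x) ->
  rLp g -> rLp h.
Proof.
by move=> mh hg; apply: rLp_absle => // x; rewrite (le_trans (hg x))// ler_norm.
Qed.

Lemma rLp_lin (a : R) h g : rLp h -> rLp g -> rLp (fun x => a * h x + g x).
Proof.
move=> hh hg; have [mf fy] := inLp_lin p1 a%:C%C (rLp_inLp hh) (rLp_inLp hg).
split; first by apply: measurable_funD; [apply: measurable_funM => //; exact: rLp_meas hh|exact: rLp_meas hg].
apply: le_lt_trans fy; apply: ge0_le_integral => //.
- apply: measurable_normr_powR.
  by apply: measurable_funD; [apply: measurable_funM => //; exact: rLp_meas hh|exact: rLp_meas hg].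
- exact: measurable_normc_powR.
by move=> x _; rewrite -rmorphM -rmorphD normc_real.
Qed.

Lemma rl_lin (a : R) h g : rLp h -> rLp g ->
  rl (fun x => a * h x + g x) = a%:C%C *: rl h + rl g.
Proof.
move=> hh hg; rewrite -(mkLp_lin _ _ (rLp_inLp hh) (rLp_inLp hg)).
by congr mkLp; apply/funext => x; rewrite rmorphD rmorphM.
Qed.

Lemma rLpB h g : rLp h -> rLp g -> rLp (fun x => h x - g x).
Proof.
move=> hh hg; have := rLp_lin (-1) hg hh; congr rLp.
by apply/funext => x; rewrite mulN1r addrC.
Qed.

Lemma rlB h g : rLp h -> rLp g -> rl (fun x => h x - g x) = rl h - rl g.
Proof.
move=> hh hg; rewrite [RHS]addrC -scaleN1r.
rewrite (_ : -1 = (-1 : R)%:C%C); last by rewrite rmorphN1.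
rewrite -rl_lin//; congr rl.
by apply/funext => x; rewrite mulN1r addrC.
Qed.

Lemma CLp_nonnegE u : CLp_nonneg u <-> {ae mu, forall x, 0 <= ev u x}.
Proof. by rewrite ev.unlock. Qed.

Lemma rl_nonneg h : rLp h -> {ae mu, forall x, 0 <= h x} -> CLp_nonneg (rl h).
Proof.
move=> hh h0; apply/CLp_nonnegE; apply: aeS (aeI h0 (ev_rl hh)) => x [h0x ->].
by rewrite ler0c.
Qed.

Lemma measurable_Re_ev u : measurable_fun setT (fun x => complex.Re (ev u x)).
Proof. exact: (ev_measurable u).1. Qed.

Lemma measurable_Im_ev u : measurable_fun setT (fun x => complex.Im (ev u x)).
Proof. exact: (ev_measurable u).2. Qed.

Lemma Re_le_normc (z : R[i]) : `|complex.Re z| <= normc z.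
Proof. by have := normc_ge_Re z; rewrite normr_normc lecR. Qed.

Lemma Im_le_normc (z : R[i]) : `|complex.Im z| <= normc z.
Proof.
by case: z => a b /=; rewrite -sqrtr_sqr ler_wsqrtr// lerDr sqr_ge0.
Qed.

Lemma rLp_normc u : rLp (fun x => normc (ev u x)).
Proof.
split; first exact/cmeasurable_normc/ev_measurable.
under eq_integral do rewrite ger0_norm ?normc_ge0//.
by rewrite -NpowE; exact: Npow_lty.
Qed.

Lemma rLp_Re u : rLp (fun x => complex.Re (ev u x)).
Proof.
by apply: rLp_le (rLp_normc u) => [|x]; [exact: measurable_Re_ev|exact: Re_le_normc].
Qed.

Lemma rLp_Im u : rLp (fun x => complex.Im (ev u x)).
Proof.
by apply: rLp_le (rLp_normc u) => [|x]; [exact: measurable_Im_ev|exact: Im_le_normc].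
Qed.

Lemma rl_Re_Im u : u = rl (fun x => complex.Re (ev u x)) +
  'i%C *: rl (fun x => complex.Im (ev u x)).
Proof.
apply: CLp_ext.
have h := aeI (ev_rl (rLp_Re u)) (ev_rl (rLp_Im u)).
have h' := aeI (evD (rl (fun x => complex.Re (ev u x))) ('i%C *: rl (fun x => complex.Im (ev u x))))
  (evZ 'i%C (rl (fun x => complex.Im (ev u x)))).
by apply: aeS (aeI h h') => x [[-> ->] [-> ->]]; exact: complexE.
Qed.

Lemma nonneg_rl u : CLp_nonneg u ->
  exists h, [/\ rLp h, forall x, 0 <= h x & u = rl h].
Proof.
move=> /CLp_nonnegE u0; pose h x := Num.max (complex.Re (ev u x)) 0.
have mh : measurable_fun setT h by apply: measurable_maxr => //; exact: measurable_Re_ev.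
have hh : rLp h.
  apply: rLp_le (rLp_normc u) => // x.
  rewrite /h ger0_norm; last by rewrite le_max lexx orbT.
  by rewrite ge_max normc_ge0 andbT (le_trans (ler_norm _))// Re_le_normc.
exists h; split => //; first by move=> x; rewrite /h le_max lexx orbT.
apply: CLp_ext; apply: aeS (aeI u0 (ev_rl hh)) => x [ux ->].
rewrite /h; move: ux; case: (ev u x) => a b; rewrite lecE/= => /andP[/eqP -> a0].
by rewrite max_l.
Qed.

Lemma Npow_le_ae u v : {ae mu, forall x, normc (ev u x) <= normc (ev v x)} ->
  `|u| <= `|v|.
Proof.
move=> uv; rewrite CLp_norm_le !NpowE; apply: ae_ge0_le_integral => //.
- by move=> x _; rewrite lee_fin powR_ge0.
- exact/measurable_normc_powR/ev_measurable.
- by move=> x _; rewrite lee_fin powR_ge0.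
- exact/measurable_normc_powR/ev_measurable.
apply: aeS uv => x uvx _; rewrite lee_fin powR_le ?(ltW p0)//; exact: normc_ge0.
Qed.

Lemma rl_norm_le h g : rLp h -> rLp g -> {ae mu, forall x, `|h x| <= `|g x|} ->
  `|rl h| <= `|rl g|.
Proof.
move=> hh hg hgx; apply: Npow_le_ae.
by apply: aeS (aeI (aeI (ev_rl hh) (ev_rl hg)) hgx) => x [[-> ->]]; rewrite !normc_real.
Qed.

Lemma rl_ext h g : rLp h -> rLp g -> {ae mu, forall x, h x = g x} -> rl h = rl g.
Proof.
move=> hh hg hgx; apply: mkLp_eq; [exact: rLp_inLp|exact: rLp_inLp|].
by apply: aeS hgx => x ->.
Qed.

Lemma nonneg_le h g : rLp h -> rLp g -> CLp_nonneg (rl h - rl g) ->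
  {ae mu, forall x, g x <= h x}.
Proof.
move=> hh hg; rewrite -rlB// => /CLp_nonnegE u0.
apply: aeS (aeI u0 (ev_rl (rLpB hh hg))) => x [+ hx].
by rewrite hx ler0c subr_ge0.
Qed.

Lemma rLp_bounded h (M : R) : (mu setT < +oo)%E -> measurable_fun setT h ->
  (forall x, `|h x| <= M) -> rLp h.
Proof.
move=> muy mh hM; apply: (@rLp_le _ (fun=> M)) => //; split => //.
rewrite integral_cst//=; exact: lte_mul_pinfty.
Qed.

End real_elements.

Section bounded_operators.
Context (K : numFieldType) (V W : normedModType K).

Lemma linear_lipschitz_continuous (f : {linear V -> W}) (M : K) :
  (forall x, `|x| <= 1 -> `|f x| <= M) -> continuous f.
Proof.
move=> hM; apply: bounded_linear_continuous; apply/ex_bound; exists M.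
apply/nbhs_norm0P; exists 1 => //= x /= x1; exact/hM/ltW.
Qed.

Lemma continuous_linear_bound (f : {linear V -> W}) : continuous f ->
  exists2 M : K, 0 < M & forall x, `|f x| <= M * `|x|.
Proof.
move=> /linear_bounded_continuous/linear_boundedP/pinfty_ex_gt0 [M M0 hM].
by exists M.
Qed.

End bounded_operators.

Lemma le_fine (R : realType) (x y : \bar R) :
  (0 <= x)%E -> (x <= y)%E -> (y < +oo)%E -> fine x <= fine y.
Proof.
move=> x0 xy yy; have y0 := le_trans x0 xy.
have fx : x \is a fin_num by rewrite ge0_fin_numE// (le_lt_trans xy).
have fy : y \is a fin_num by rewrite ge0_fin_numE.
exact: (fine_le fx fy xy).
Qed.

(** The clamp of [a] to [-1, 1] is a bounded stand-in for its sign, continuous in [a]; [pair_sep]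
    uses it as a test weight. *)
Lemma mul_clamp_ge0 (R : realType) (a : R) : 0 <= a * Num.max (-1) (Num.min a 1).
Proof.
rewrite /Num.max /Num.min; have [a1|a1] := ltP a 1.
  have [a2|a2] := ltP (-1) a; first by rewrite -expr2 sqr_ge0.
  by rewrite mulrN1; lra.
by rewrite (_ : -1 < 1)%R ?mulr1; lra.
Qed.

Lemma mul_clamp_eq0 (R : realType) (a : R) :
  a * Num.max (-1) (Num.min a 1) = 0 -> a = 0.
Proof.
move=> /eqP; rewrite mulf_eq0 => /orP[/eqP//|/eqP].
by rewrite /Num.max /Num.min; do 2 case: ifPn => /=; rewrite -?leNgt => ? ? ?; lra.
Qed.

Section pairing.
Context d (T : measurableType d) (R : realType).
Variables (mu : {measure set T -> \bar R}) (p : R) (p1 : 1 <= p).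
Hypothesis p_gt1 : 1 < p.
Local Notation C := (R[i]).
Local Notation E := (CLp mu p1).
Local Notation rLp := (rLp mu p).
Implicit Types (h w : T -> R) (u v : E).

Let p0 : 0 < p. Proof. exact: lt_le_trans p1. Qed.
Local Notation q := (p / (p - 1)).
Let pm0 : 0 < p - 1. Proof. by rewrite subr_gt0. Qed.
Let q0 : 0 < q. Proof. by rewrite divr_gt0. Qed.
Let pq : p^-1 + q^-1 = 1.
Proof. by rewrite invf_div; field; rewrite gt_eqF. Qed.
Let q_ge1 : 1 <= q. Proof. by rewrite ler_pdivlMr// mul1r gerBl. Qed.

Record weight w : Prop := Weight {
  weight_meas : measurable_fun setT w;
  weight_fin : (\int[mu]_x (`|w x| `^ q)%:E < +oo)%E }.

(** Young's inequality with both factors 1/p and 1/q bounded by 1. The loss is harmless: the bound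
    only serves integrability and the continuity of functionals. *)
Lemma young_le (a b : R) : `|a * b| <= `|a| `^ p + `|b| `^ q.
Proof.
rewrite normrM; apply: le_trans (conjugate_powR _ _ p0 q0 pq) _ => //.
apply: lerD; rewrite ler_pdivrMr// ler_peMr ?powR_ge0//.
Qed.

Lemma measurable_weight_powR w : measurable_fun setT w ->
  measurable_fun setT (fun x => (`|w x| `^ q)%:E).
Proof.
move=> mh; apply/measurable_EFinP.
apply: (measurableT_comp (f := fun x => x `^ q)); first exact: measurable_powR.
exact: measurableT_comp.
Qed.

Lemma young_integral h w : rLp h -> weight w ->
  (\int[mu]_x `|h x * w x|%:E <=
   \int[mu]_x (`|h x| `^ p)%:E + \int[mu]_x (`|w x| `^ q)%:E)%E.
Proof.
move=> [mh _] [mw _]; rewrite -ge0_integralD//; last 2 first.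
- exact: measurable_normr_powR.
- exact: measurable_weight_powR.
apply: ge0_le_integral => //.
- apply/measurable_EFinP; apply: measurableT_comp => //.
  exact: measurable_funM.
- by apply: emeasurable_funD; [exact: measurable_normr_powR|exact: measurable_weight_powR].
by move=> x _; rewrite -EFinD lee_fin young_le.
Qed.

Lemma integrable_weight h w : rLp h -> weight w ->
  mu.-integrable setT (EFin \o (fun x => h x * w x)).
Proof.
move=> hh hw; apply/integrableP; split.
  by apply/measurable_EFinP; apply: measurable_funM; [exact: (rLp_meas hh)|exact: (weight_meas hw)].
apply: le_lt_trans (young_integral hh hw) _.
by apply: lte_add_pinfty; [exact: (rLp_fin hh)|exact: (weight_fin hw)].
Qed.

Definition rpair w h : R := (\int[mu]_x (h x * w x))%R.

Lemma rpair_lin w a h g : weight w -> rLp h -> rLp g ->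
  rpair w (fun x => a * h x + g x) = a * rpair w h + rpair w g.
Proof.
move=> hw hh hg; have ih := integrable_weight hh hw.
have ig := integrable_weight hg hw.
rewrite /rpair -RintegralZl// -RintegralD//.
  by apply: eq_Rintegral => x _; rewrite mulrDl mulrA.
exact: (integrableZl measurableT a ih).
Qed.

Lemma rpair_ae w h g : weight w -> rLp h -> rLp g ->
  {ae mu, forall x, h x = g x} -> rpair w h = rpair w g.
Proof.
move=> hw hh hg hgE; congr fine; apply: ae_eq_integral => //.
- exact: measurable_int (integrable_weight hh hw).
- exact: measurable_int (integrable_weight hg hw).
by apply: aeS hgE => x /= -> _.
Qed.

Lemma rpair_young w h : weight w -> rLp h ->
  `|rpair w h| <= fine (\int[mu]_x (`|h x| `^ p)%:E)%E
                  + fine (\int[mu]_x (`|w x| `^ q)%:E)%E.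
Proof.
move=> hw hh; apply: le_trans (le_normr_Rintegral _ (integrable_weight hh hw)) _ => //.
have fh : (\int[mu]_x (`|h x| `^ p)%:E)%E \is a fin_num.
  by rewrite ge0_fin_numE ?(rLp_fin hh)// integral_ge0// => x _; rewrite lee_fin powR_ge0.
have fw : (\int[mu]_x (`|w x| `^ q)%:E)%E \is a fin_num.
  by rewrite ge0_fin_numE ?(weight_fin hw)// integral_ge0// => x _; rewrite lee_fin powR_ge0.
have hy := young_integral hh hw.
rewrite -(fineD fh fw); apply: le_fine hy _; first exact: integral_ge0.
by apply: lte_add_pinfty; [exact: (rLp_fin hh)|exact: (weight_fin hw)].
Qed.

Definition pair w u : R[i]^o :=
  (rpair w (fun x => complex.Re (ev u x)) +i* rpair w (fun x => complex.Im (ev u x)))%C.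

Lemma pair_linear w (hw : weight w) : linear (pair w).
Proof.
move=> [a b] u v.
have hRu := rLp_Re u. have hIu := rLp_Im u.
have hRv := rLp_Re v. have hIv := rLp_Im v.
have e1 : rpair w (fun x => complex.Re (ev ((a +i* b)%C *: u + v) x)) =
    rpair w (fun x => a * complex.Re (ev u x) +
       (- b * complex.Im (ev u x) + complex.Re (ev v x))).
  apply: rpair_ae; [exact: hw|exact: rLp_Re|exact: (rLp_lin p1 a hRu (rLp_lin p1 (- b) hIu hRv))|].
  apply: aeS (aeI (evD ((a +i* b)%C *: u) v) (evZ (a +i* b)%C u)) => x [-> ->].
  by case: (ev u x) => ? ?; case: (ev v x) => ? ? /=; rewrite mulNr addrA.
have e2 : rpair w (fun x => complex.Im (ev ((a +i* b)%C *: u + v) x)) =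
    rpair w (fun x => a * complex.Im (ev u x) +
       (b * complex.Re (ev u x) + complex.Im (ev v x))).
  apply: rpair_ae; [exact: hw|exact: rLp_Im|exact: (rLp_lin p1 a hIu (rLp_lin p1 b hRu hIv))|].
  apply: aeS (aeI (evD ((a +i* b)%C *: u) v) (evZ (a +i* b)%C u)) => x [-> ->].
  by case: (ev u x) => ? ?; case: (ev v x) => ? ? /=; rewrite addrA.
rewrite /pair e1 e2.
rewrite (rpair_lin a hw hRu (rLp_lin p1 (- b) hIu hRv)) (rpair_lin _ hw hIu hRv).
rewrite (rpair_lin a hw hIu (rLp_lin p1 b hRu hIv)) (rpair_lin _ hw hRu hIv).
apply/eqP; rewrite eq_complex /=; apply/andP; split; apply/eqP; rewrite ?mulNr ?addrA//.
Qed.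

Lemma pair_bound w u (hw : weight w) : `|u| <= 1 ->
  `|pair w u| <= (2 * (1 + fine (\int[mu]_x (`|w x| `^ q)%:E)%E))%:C%C.
Proof.
move=> u1; have {}u1 : (Npow u <= 1)%E.
  by have := @CLp_norm_leE _ _ _ mu p p1 u 1 ler01; rewrite powR1 rmorph1 => <-.
have young h : rLp h -> (forall x, `|h x| <= normc (ev u x)) ->
    `|rpair w h| <= 1 + fine (\int[mu]_x (`|w x| `^ q)%:E)%E.
  move=> hh hu; apply: le_trans (rpair_young hw hh) _; rewrite lerD2r.
  rewrite -[leRHS]/(fine 1%E); apply: le_fine; last exact: ltry.
    by apply: integral_ge0 => x _; rewrite lee_fin powR_ge0.
  apply: le_trans u1; rewrite NpowE; apply: ge0_le_integral => //.
  - exact: (measurable_normr_powR p (rLp_meas hh)).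
  - exact/measurable_normc_powR/ev_measurable.
  by move=> x _; rewrite lee_fin powR_le ?(ltW p0).
have a1 := young _ (rLp_Re u) (fun x => Re_le_normc (ev u x)).
have a2 := young _ (rLp_Im u) (fun x => Im_le_normc (ev u x)).
rewrite normr_normc lecR /pair mulr_natl mulr2n.
apply: le_trans (lerD a1 a2).
rewrite -(normc_real (rpair w _)) (_ : normc _ = normc ((rpair w (fun x => complex.Re (ev u x)))%:C%C
  + 'i%C * (rpair w (fun x => complex.Im (ev u x)))%:C%C)); last first.
  by rewrite {1}[X in normc X]complexE.
apply: le_trans (le_normcD _ _) _; rewrite lerD2l normcM normc_real.
by rewrite [normc 'i%C]/= expr0n add0r expr1n sqrtr1 mul1r.
Qed.

Definition pair_dual w (hw : weight w) : dual E :=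
  let f : {linear E -> R[i]^o} :=
    HB.pack (pair w) (GRing.isLinear.Build _ _ _ _ _ (pair_linear hw)) in
  Dual (dual_fun := f) (linear_lipschitz_continuous (f := f) (fun x => pair_bound hw)).

Lemma pair_dualE w (hw : weight w) u : pair_dual hw u = pair w u.
Proof. by []. Qed.

Lemma pair_rl w h : weight w -> rLp h -> pair w (rl mu p1 h) = (rpair w h)%:C%C.
Proof.
move=> hw hh; rewrite /pair; congr Complex.
  apply: rpair_ae => //; first exact: rLp_Re.
  by apply: aeS (ev_rl p1 hh) => x ->.
rewrite (@rpair_ae _ _ (fun=> 0))//.
- by rewrite /rpair; under eq_Rintegral do rewrite mul0r; rewrite Rintegral_cst// mul0r.
- exact: rLp_Im.
- split; first exact: measurable_cst.
  under eq_integral do rewrite normr0 powR0 ?gt_eqF//.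
  by rewrite integral0.
by apply: aeS (ev_rl p1 hh) => x ->.
Qed.

Lemma weight_bounded w (M : R) : (mu setT < +oo)%E -> measurable_fun setT w ->
  (forall x, `|w x| <= M) -> weight w.
Proof. by move=> muy mw wM; have [] := rLp_bounded q_ge1 muy mw wM. Qed.

(** The real and imaginary parts h of u - v are tested against their own clamps w, which are bounded
    and hence weights since the measure is finite. The product h * w is nonnegative with integral 0,
    so h vanishes almost everywhere. *)
Lemma pair_sep u v : (mu setT < +oo)%E ->
  (forall f : dual E, f u = f v) -> u = v.
Proof.
move=> muy uv; apply/eqP; rewrite -subr_eq0; apply/eqP.
set z := u - v; have z0 w : weight w -> pair w z = 0.
  by move=> hw; rewrite -(pair_dualE hw) linearB uv subrr.
have key h : rLp h -> (forall w, weight w -> rpair w h = 0) ->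
    {ae mu, forall x, h x = 0}.
  move=> hh h0.
  pose w x := Num.max (-1) (Num.min (h x) 1).
  have mw : measurable_fun setT w.
    by apply: measurable_maxr => //; apply: measurable_minr => //; exact: rLp_meas hh.
  have hw : weight w.
    apply: (@weight_bounded _ 1) => // x; rewrite /w ler_norml le_max lexx/=.
    by rewrite ge_max ge_min lexx orbT andbT; lra.
  have hw0 x : 0 <= h x * w x.
    exact: mul_clamp_ge0.
  have := h0 w hw; rewrite /rpair /Rintegral => hint.
  have /integrableP[mhw hy] := integrable_weight hh hw.
  have : (\int[mu]_x `|(h x * w x)%:E|)%E = 0%E.
    rewrite -[LHS]fineK; last by rewrite ge0_fin_numE ?integral_ge0.
    congr EFin; rewrite -[RHS]hint; congr fine; apply: eq_integral => x _ /=.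
    by rewrite ger0_norm.
  move=> /(ae_eq_integral_abs _ measurableT mhw).1.
  by apply: aeS => x /(_ I) [] /mul_clamp_eq0.
have hR := key _ (rLp_Re z) (fun w hw => f_equal (@complex.Re R) (z0 w hw)).
have hI := key _ (rLp_Im z) (fun w hw => f_equal (@complex.Im R) (z0 w hw)).
apply: CLp_ext; rewrite -(CLp_pi0 mu p1).
apply: aeS (aeI (aeI hR hI) (evZ 0 z)) => x [[]].
rewrite scale0r CLp_pi0 mul0r => + + ->.
by case: (ev z x) => a b /= -> ->.
Qed.

End pairing.

(** * Convergence in the strong and weak operator topologies *)

Section initial_convergence.

Lemma initial_cvgP (X : choiceType) (Y : topologicalType) (f : X -> Y)
    (F : set_system X) (x : X) : Filter F ->
  F --> (x : initial_topology f) <-> f @ F --> f x.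
Proof.
move=> FF; split=> [Fx A /(@initial_continuous _ _ f x)|fF A]; first exact: Fx.
rewrite /= nbhsE => -[B [[D oD <-] Dx] DA].
by apply: filterS DA _; apply: fF; exact: open_nbhs_nbhs.
Qed.

Lemma ptws_initial_cvgP (X : choiceType) (U : Type) (V : topologicalType)
    (f : X -> {ptws U -> V}) (F : set_system X) (x : X) : Filter F ->
  F --> (x : initial_topology f) <-> forall u, (fun y => f y u) @ F --> f x u.
Proof.
move=> FF; rewrite initial_cvgP; split=> [fF u|fF].
  have /cvg_sup/(_ u) := fF.
  by move=> /initial_cvgP.
by apply/cvg_sup => u; apply/initial_cvgP; exact: fF.
Qed.

Context {K : numFieldType} (E : normedModType K).

Lemma sot_cvgP (F : set_system (bop E)) (S : bop E) : Filter F ->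
  F --> (S : sot E) <-> forall x, (fun T : bop E => T x) @ F --> S x.
Proof. by move=> FF; exact: ptws_initial_cvgP. Qed.

Lemma wot_cvgP (F : set_system (bop E)) (S : bop E) : Filter F ->
  F --> (S : wot E) <->
  forall x (f : dual E), (fun T : bop E => f (T x)) @ F --> (f (S x) : K^o).
Proof.
move=> FF; rewrite ptws_initial_cvgP; split=> [h x f|h [x f]]; last exact: h.
exact: (h (x, f)).
Qed.

Lemma bop_powE (T : bop E) n x : bop_pow T n x = iter n T x.
Proof. by elim: n => //= n ih; rewrite -ih. Qed.

(** Since f \o T is again a functional, T (T^n x) = T^n (T x) passes to the weak limit on both
    sides; [sep] then removes the functional. *)
Lemma weak_limit_comm (T Q : bop E) : (forall x y : E, (forall f : dual E, f x = f y) -> x = y) ->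
  weak_limits T Q -> forall x, T (Q x) = Q (T x).
Proof.
move=> sep [n [_ /wot_cvgP nQ]] x; apply: sep => f.
pose fT : dual E := @Dual _ _ (f \o T : {linear _ -> _})
  (fun y => continuous_comp (@bop_continuous _ _ T y) (@dual_continuous _ _ f (T y))).
have h1 : (fun k => f (T (bop_pow T (n k) x)) : K^o) @ \oo --> (f (T (Q x)) : K^o).
  exact: nQ x fT.
have h2 : (fun k => f (bop_pow T (n k) (T x)) : K^o) @ \oo --> (f (Q (T x)) : K^o).
  exact: nQ (T x) f.
have e : (fun k => f (T (bop_pow T (n k) x)) : K^o) = (fun k => f (bop_pow T (n k) (T x))).
  by apply/funext => k; rewrite !bop_powE -iterS iterSr.
rewrite e in h1.
exact: (cvg_unique (@norm_hausdorff _ K^o) h1 h2).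
Qed.

End initial_convergence.

(** * Absence of positive eigenvectors *)

Section truncation.
Context d (T : measurableType d) (R : realType).
Variables (mu : {measure set T -> \bar R}) (p : R) (p1 : 1 <= p).

Lemma nneseries_lty_cvg0 (t : (\bar R)^nat) : (forall k, 0 <= t k)%E ->
  (\sum_(0 <= k <oo) t k < +oo)%E -> t @ \oo --> 0%E.
Proof.
move=> t0 ty; have := @nneseries_tail_cvg R t xpredT ty (fun k _ => t0 k).
apply: squeeze_cvge; last exact: cvg_cst.
apply: nearW => k; rewrite t0/=.
apply: le_trans (@nneseries_lim_ge R t xpredT k k.+1 _); last by move=> n _ _; exact: t0.
by rewrite big_nat1.
Qed.

(** The bounds on the integrals are summable, so the sum of the f k is integrable and f k tends to 0
    almost everywhere. Dominated convergence applies with the dominating function h ^ p, because of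
    the truncation by h. *)
Lemma minr_powR_integral_cvg0 (h : T -> R) (f : nat -> T -> R) :
  rLp mu p h -> (forall x, 0 <= h x) ->
  (forall k, measurable_fun setT (f k)) -> (forall k x, 0 <= f k x) ->
  (forall k, \int[mu]_x (f k x)%:E <= (1 / (2 ^ (k + 1))%:R)%:E)%E ->
  (\int[mu]_x (Num.min (h x) (f k x) `^ p)%:E)%E @[k --> \oo] --> 0%E.
Proof.
move=> hh h0 mf f0 fk; have p0 : 0 < p by exact: lt_le_trans p1.
have mEf k : measurable_fun setT (fun x => (f k x)%:E) by exact/measurable_EFinP.
have sumy : (\int[mu]_x (\sum_(0 <= k <oo) (f k x)%:E) < +oo)%E.
  rewrite integral_nneseries//; last by move=> k x _; rewrite lee_fin.
  apply: le_lt_trans (_ : (\sum_(0 <= k <oo) (1 / (2 ^ (k + 1))%:R)%:E < +oo)%E).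
    apply: lee_nneseries => [k _ _|k _]; last exact: fk.
    by apply: integral_ge0 => x _; rewrite lee_fin.
  have := @cvg_geometric_eseries_half R 1 0; move=> /cvg_lim; rewrite /eseries => -> //.
  exact: ltry.
have fcvg : {ae mu, forall x, (fun k => (f k x)%:E) @ \oo --> 0%E}.
  have ms : measurable_fun setT (fun x => (\sum_(0 <= k <oo) (f k x)%:E)%E).
    by apply: ge0_emeasurable_sum => // k x _ _; rewrite lee_fin.
  have s0 x : (0 <= \sum_(0 <= k <oo) (f k x)%:E)%E.
    by apply: nneseries_ge0 => k _ _; rewrite lee_fin.
  have si : mu.-integrable setT (fun x => (\sum_(0 <= k <oo) (f k x)%:E)%E).
    apply/integrableP; split => //.
    by under eq_integral do rewrite gee0_abs//.
  apply: aeS (integrable_ae measurableT si) => x /(_ I) sx.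
  apply: nneseries_lty_cvg0; first by move=> k; rewrite lee_fin.
  by rewrite -ge0_fin_numE.
have mm k : measurable_fun setT (fun x => Num.min (h x) (f k x)).
  by apply: measurable_minr => //; exact: rLp_meas hh.
have m0 k x : 0 <= Num.min (h x) (f k x) by rewrite le_min h0 f0.
have hi : mu.-integrable setT (fun x => (`|h x| `^ p)%:E).
  apply/integrableP; split; first exact/measurable_normr_powR/(rLp_meas hh).
  under eq_integral do rewrite gee0_abs ?lee_fin ?powR_ge0//.
  exact: rLp_fin hh.
have [] := @dominated_convergence _ _ _ mu setT measurableT
  (fun k x => (Num.min (h x) (f k x) `^ p)%:E) (fun=> 0%E) (fun x => (`|h x| `^ p)%:E).
- move=> k; have := measurable_normr_powR p (mm k).
  by apply: eq_measurable_fun => x _; rewrite ger0_norm.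
- exact: measurable_cst.
- apply: aeS fcvg => x fx _.
  have {}fx : f k x @[k --> \oo] --> 0 by move/fine_cvgP : fx => [_].
  apply/fine_cvgP; split; first exact: nearW.
  apply/cvgrPdist_le => /= e e0.
  have ep : 0 < e `^ p^-1 by rewrite powR_gt0.
  have eE : (e `^ p^-1) `^ p = e by rewrite powR_invK// ?gt_eqF// ltW.
  near=> k; rewrite sub0r normrN ger0_norm ?powR_ge0//= -eE.
  apply: powR_le => //; first exact: ltW.
  rewrite ge_min; apply/orP; right.
  rewrite -[f k x]ger0_norm// -normrN -sub0r; near: k.
  by move/cvgrPdist_le : fx => /(_ _ ep).
- exact: hi.
- apply: aeW => x k _; rewrite gee0_abs ?lee_fin ?powR_ge0//.
  by apply: powR_le; rewrite ?(ltW p0)// ger0_norm// ge_min lexx.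
by move=> _ _; rewrite integral0.
Unshelve. all: by end_near. Qed.

End truncation.

Lemma real_complexD (R : realType) (a b : R) : a%:C%C + b%:C%C = (a + b)%:C%C.
Proof. by rewrite rmorphD. Qed.

Lemma half_gap_absurd (R : realType) (a b e : R) :
  a < 1 -> e < (1 - a) / 2 / 2 -> 1 - e < b + a -> b < (1 - a) / 2 / 2 -> False.
Proof. by lra. Qed.

Lemma cvge0_lt (R : realType) (u : (\bar R)^nat) (e : R) : 0 < e ->
  u @ \oo --> 0%E -> \forall k \near \oo, (u k < e%:E)%E.
Proof.
move=> e0 /fine_cvgP[ufin /cvgrPdist_lt/(_ _ e0) ucvg].
near=> k; rewrite -[X in (X < _)%E]fineK; last by near: k.
rewrite lte_fin (le_lt_trans (ler_norm _))// -normrN -sub0r.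
by near: k.
Unshelve. all: by end_near. Qed.

Lemma half_pow_small (R : realType) (e : R) : 0 < e ->
  \forall k \near \oo, 1 / (2 ^ (k + 1))%:R < e.
Proof.
move=> e0; have h : `|2^-1 : R| < 1.
  by rewrite ger0_norm ?invr_ge0// invf_lt1// ltr1n.
have /cvgrPdist_lt/(_ _ e0) := @cvg_geometric R 2^-1 2^-1 h.
apply: filterS => k; rewrite sub0r normrN /= ger0_norm; last first.
  by rewrite mulr_ge0// exprn_ge0.
by rewrite -exprS exprVn addn1 natrX mul1r.
Qed.

Section criterion.
Context d (T : measurableType d) (R : realType).
Variables (mu : {measure set T -> \bar R}) (p : R) (p1 : 1 <= p).
Hypothesis p_gt1 : 1 < p.
Hypothesis mu1 : mu setT = 1%E.
Local Notation C := (R[i]).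
Local Notation E := (CLp mu p1).
Local Notation rl := (rl mu p1).
Local Notation rLp := (rLp mu p).
Implicit Types (h g : T -> R) (u v : E) (S Q : bop E).

Let p0 : 0 < p. Proof. exact: lt_le_trans p1. Qed.
Let mu_lty : (mu setT < +oo)%E. Proof. by rewrite mu1 ltry. Qed.

Lemma rLp_cst (a : R) : rLp (fun=> a).
Proof. exact: (@rLp_bounded _ _ _ mu p p1 _ `|a|). Qed.

Lemma weight1 : weight mu p (fun=> 1).
Proof. by apply: (@weight_bounded _ _ _ mu p p_gt1 _ 1) => // x; rewrite normr1. Qed.

Definition oneLp : E := rl (fun=> 1).

Definition mean u : R[i] := pair (fun=> 1) u.

(* T^n 1 has small integral but almost full norm, i.e. it is concentrated on a small
   set. *)
Definition concentrates (k : nat) S := exists n,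
  `|mean (iter n S oneLp)| < (1 / (2 ^ (k + 1))%:R)%:C%C /\
  (1 - 1 / (2 ^ (k + 1))%:R)%:C%C < `|iter n S oneLp|.

Lemma iterB S n u v : iter n S (u - v) = iter n S u - iter n S v.
Proof. by elim: n => //= n ->; rewrite linearB. Qed.

Lemma iter_positive S n u : positive_op S -> CLp_nonneg u -> CLp_nonneg (iter n S u).
Proof. by move=> S0 u0; elim: n => //= n ih; exact: S0. Qed.

Lemma iter_contraction S n u : bop_contraction S -> `|iter n S u| <= `|u|.
Proof. by move=> S1; elim: n => //= n ih; exact: le_trans (S1 _) ih. Qed.

Lemma iter_isometry S n u : bop_isometry S -> `|iter n S u| = `|u|.
Proof. by move=> S1; elim: n => //= n ih; rewrite S1. Qed.

Lemma norm_one : `|oneLp| = 1.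
Proof.
rewrite CLp_normE Npow_rl; last exact: rLp_cst.
under eq_integral do rewrite normr1 powR1.
by rewrite integral_cst// mul1e mu1 powR1 rmorph1.
Qed.

(** A norm equal to 1 would force (1 - min h 1)^p, which lies between 0 and 1, to equal 1 almost
    everywhere, that is, h = 0. *)
Lemma norm_one_sub_min h : rLp h -> (forall x, 0 <= h x) -> rl h != 0 ->
  `|rl (fun x => 1 - Num.min (h x) 1)| < 1.
Proof.
move=> hh h0 hn0; set f := fun x => 1 - Num.min (h x) 1.
have mf : measurable_fun setT f.
  by apply: measurable_funB => //; apply: measurable_minr => //; exact: rLp_meas hh.
have f01 x : 0 <= f x <= 1 by rewrite /f subr_ge0 ge_min lexx orbT gerBl le_min h0 ler01.
have f0 x : 0 <= f x by have /andP[] := f01 x.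
have f1 x : f x <= 1 by have /andP[] := f01 x.
have hf : rLp f by apply: (@rLp_bounded _ _ _ mu p p1 _ 1) => // x; rewrite ger0_norm.
have fp x : `|f x| `^ p <= 1.
  have e1 : (1 : R) `^ p = 1 by rewrite powR1.
  by rewrite -[leRHS]e1; apply: powR_le; rewrite ?(ltW p0)// ger0_norm.
have mfp := measurable_normr_powR p mf.
rewrite (_ : 1 = 1%:C%C)// CLp_norm_ltE// powR1 Npow_rl// lt_neqAle; apply/andP; split; last first.
  apply: le_trans (_ : (\int[mu]_x 1 <= 1)%E).
    by apply: ge0_le_integral => // x _; rewrite lee_fin.
  by rewrite integral_cst// mul1e mu1.
apply/eqP => f_1; move/eqP : hn0; apply.
have mg : measurable_fun setT (fun x => (1 - `|f x| `^ p)%:E).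
  by apply/measurable_EFinP; apply: measurable_funB => //; exact/measurable_EFinP.
have g0 : (\int[mu]_x (1 - `|f x| `^ p)%:E = 0)%E.
  have : (\int[mu]_x ((1 - `|f x| `^ p)%:E + (`|f x| `^ p)%:E) = 1)%E.
    under eq_integral do rewrite -EFinD subrK.
    by rewrite integral_cst// mul1e mu1.
  rewrite ge0_integralD//; last by move=> x _; rewrite lee_fin subr_ge0.
  rewrite f_1 => e; have : (\int[mu]_x (1 - `|f x| `^ p)%:E \is a fin_num)%E.
    rewrite ge0_fin_numE; last by apply: integral_ge0 => x _; rewrite lee_fin subr_ge0.
    apply: le_lt_trans (ltry 1); rewrite -e leeDl//.
  by move: e; case: (integral _ _ _) => // r [] e _; congr EFin; lra.
have : (\int[mu]_x `|(1 - `|f x| `^ p)%:E| = 0)%E.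
  by under eq_integral do rewrite gee0_abs ?lee_fin ?subr_ge0//.
move=> /(ae_eq_integral_abs _ measurableT mg).1 gae.
rewrite -[RHS](CLp_pi0 mu p1); apply: CLp_ext.
apply: aeS (aeI (aeI gae (ev_rl p1 hh)) (evZ 0 (rl h))) => x [[/(_ I) [] e ->]].
rewrite scale0r CLp_pi0 mul0r => ->.
have fx1 : f x = 1.
  apply: (powR_injective p0); rewrite ?nnegrE// powR1.
  by move: e; rewrite ger0_norm// => /eqP; rewrite subr_eq0 => /eqP.
have : Num.min (h x) 1 = 0 by move: fx1; rewrite /f => /eqP; rewrite subr_eq addrC -subr_eq subrr => /eqP.
by rewrite /Num.min; case: ifP => [_ -> //|_ /eqP]; rewrite oner_eq0.
Qed.

Lemma mean_rl h : rLp h -> (forall x, 0 <= h x) ->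
  `|mean (rl h)| = (fine (\int[mu]_x (h x)%:E)%E)%:C%C /\ (\int[mu]_x (h x)%:E < +oo)%E.
Proof.
move=> hh h0; rewrite /mean (pair_rl p1 p_gt1 weight1 hh) /rpair.
rewrite (@eq_Rintegral _ _ _ mu setT h); last by move=> x _; rewrite mulr1.
rewrite normr_normc normc_real ger0_norm ?Rintegral_ge0//; split => //.
have /integrableP[_] := integrable_weight p1 p_gt1 hh weight1.
apply: le_lt_trans; apply: ge0_le_integral => //.
- by move=> x _; rewrite lee_fin.
- exact/measurable_EFinP/(rLp_meas hh).
- apply: measurableT_comp => //; apply/measurable_EFinP.
  by apply: measurable_funM => //; exact: rLp_meas hh.
by move=> x _ /=; rewrite mulr1 lee_fin ler_norm.
Qed.

(* If [S h = l h], iterating gives [S^n (min h 1) <= min h (S^n 1)], which is small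
   in norm, so that [S^n 1] has norm nearly at most [norm (1 - min h 1) < 1]. *)
Lemma concentrates_no_eigenvector S (g : E) (l : C) : positive_op S -> bop_contraction S ->
  (forall k, concentrates k S) -> CLp_nonneg g -> S g = l *: g -> `|l| <= 1 -> g = 0.
Proof.
move=> S0 S1 Sk /nonneg_rl [h [hh h0 ->]] Sg l1.
apply/eqP; apply: contrapT => /negP hn0.
have mh := rLp_meas hh.
pose m x := Num.min (h x) 1.
have mm : measurable_fun setT m by apply: measurable_minr.
have m0 x : 0 <= m x by rewrite le_min h0 ler01.
have hm : rLp m.
  by apply: (@rLp_bounded _ _ _ mu p p1 _ 1) => // x; rewrite ger0_norm// ge_min lexx orbT.
have h1 := rLp_cst 1.
have one_m0 : CLp_nonneg (oneLp - rl m).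
  rewrite -rlB//; apply: rl_nonneg; first exact: rLpB.
  by apply: aeW => x; rewrite subr_ge0 ge_min lexx orbT.
have h_m0 : CLp_nonneg (rl h - rl m).
  rewrite -rlB//; apply: rl_nonneg; first exact: rLpB.
  by apply: aeW => x; rewrite subr_ge0 ge_min lexx.
have eig n : iter n S (rl h) = l ^+ n *: rl h.
  elim: n => [|n ih]; first by rewrite expr0 scale1r.
  by rewrite iterS ih linearZ/= Sg scalerA exprSr.
have [n hn] := choice Sk.
have one0 : CLp_nonneg oneLp by apply: rl_nonneg => //; exact: aeW.
have rlm0 : CLp_nonneg (rl m) by apply: rl_nonneg => //; exact: aeW.
have [f hf] := choice (fun k => nonneg_rl (iter_positive (n k) S0 one0)).
have [w hw] := choice (fun k => nonneg_rl (iter_positive (n k) S0 rlm0)).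
have rf k : rLp (f k) by have [] := hf k.
have f0 k x : 0 <= f k x by have [_ + _] := hf k; exact.
have fE k : iter (n k) S oneLp = rl (f k) by have [] := hf k.
have rw k : rLp (w k) by have [] := hw k.
have w0 k x : 0 <= w k x by have [_ + _] := hw k; exact.
have wE k : iter (n k) S (rl m) = rl (w k) by have [] := hw k.
have wf k : {ae mu, forall x, w k x <= f k x}.
  apply: (@nonneg_le _ _ _ mu p p1 (f k) (w k)) => //.
  by rewrite -fE -wE -iterB; exact: iter_positive.
(* The eigenvalue [l] is not known to be real. However, 0 <= w k <= l^n * h in the order of [R[i]]
   makes the right-hand side real and nonnegative, hence equal to its modulus, which is at most
   h. *)
have wh k : {ae mu, forall x, w k x <= h x}.
  have : CLp_nonneg (l ^+ n k *: rl h - rl (w k)).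
    by rewrite -eig -wE -iterB; exact: iter_positive.
  move=> /CLp_nonnegE w1.
  have w2 := aeI (evB (l ^+ n k *: rl h) (rl (w k))) (evZ (l ^+ n k) (rl h)).
  have w3 := aeI (ev_rl p1 hh) (ev_rl p1 (rw k)).
  apply: aeS (aeI w1 (aeI w2 w3)) => x [wx [[e1 e2] [e3 e4]]].
  move: wx; rewrite e1 e2 e3 e4 subr_ge0 -lecR => wl; apply: (le_trans wl).
  have wx0 : 0 <= (w k x)%:C%C :> C by rewrite ler0c.
  rewrite -[leLHS]ger0_norm; last exact: le_trans wl.
  rewrite normrM normrX [X in _ * X]ger0_norm ?ler0c//.
  by rewrite ler_piMl ?ler0c// exprn_ile1.
pose mn k x := Num.min (h x) (f k x).
have mn0 k x : 0 <= mn k x by rewrite le_min h0 f0.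
have rmn k : rLp (mn k).
  apply: (rLp_le p1 _ _ hh) => [|x].
    by apply: measurable_minr => //; exact: rLp_meas (rf k).
  by rewrite ger0_norm// ge_min lexx.
have wmn k : `|rl (w k)| <= `|rl (mn k)|.
  apply: rl_norm_le => //; apply: aeS (aeI (wf k) (wh k)) => x [? ?].
  by rewrite !ger0_norm// le_min; apply/andP.
pose c := `|rl (fun x => 1 - m x)|.
have c1 : c < 1 by exact: norm_one_sub_min.
have bound k : (1 - 1 / (2 ^ (k + 1))%:R)%:C%C < `|rl (mn k)| + c.
  have [_] := hn k; move=> /lt_le_trans; apply.
  apply: le_trans (_ : `|rl (w k)| + `|iter (n k) S (oneLp - rl m)| <= _).
    by rewrite -wE; apply: le_trans (ler_normD _ _); rewrite iterB addrC subrK.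
  apply: lerD; first exact: wmn.
  by apply: le_trans (iter_contraction _ _ S1) _; rewrite -rlB.
have fint k : (\int[mu]_x (f k x)%:E <= (1 / (2 ^ (k + 1))%:R)%:E)%E.
  have [+ _] := hn k; rewrite fE; have [-> fy] := mean_rl (rf k) (f0 k).
  rewrite ltcR => /ltW; rewrite -lee_fin fineK// ge0_fin_numE//.
  by apply: integral_ge0 => x _; rewrite lee_fin.
have := minr_powR_integral_cvg0 p1 hh h0 (fun k => rLp_meas (rf k)) f0 fint.
have [a ca] : exists a : R, c = a%:C%C by rewrite /c CLp_normE; eexists.
have a1 : a < 1 by rewrite -ltcR -ca.
pose r := (1 - a) / 2; have r0 : 0 < r by rewrite divr_gt0// subr_gt0.
move=> mcvg.
have r2 : 0 < (r / 2) `^ p by rewrite powR_gt0// divr_gt0.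
near \oo => k.
have b1 : `|rl (mn k)| < (r / 2)%:C%C.
  rewrite CLp_norm_ltE; last by rewrite divr_ge0// ltW.
  rewrite Npow_rl//.
  under eq_integral do rewrite ger0_norm//.
  by near: k; exact: cvge0_lt.
have b2 : 1 / (2 ^ (k + 1))%:R < r / 2.
  by near: k; apply: half_pow_small; rewrite divr_gt0.
have [b bE] : exists b : R, `|rl (mn k)| = b%:C%C by rewrite CLp_normE; eexists.
move: (bound k) b1; rewrite bE ca real_complexD !ltcR => h2 h3.
exact: (half_gap_absurd a1 b2 h2 h3).
Unshelve. all: by end_near. Qed.

End criterion.

(** * Typicality from a dense set of good points *)

Section comeager_criterion.
Context (X : topologicalType) (A P D : set X) (W : nat -> set X).

(** The sets [W k] need not be relatively open: their relative interiors are used, and these contain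
    [D] because each [W k] is a relative neighbourhood of every point of [D]. Density of [D] makes
    the intersection dense, without Baire's theorem. *)
Lemma typical_in_of_dense :
  (forall x, A x -> (forall k, W k x) -> P x) ->
  (forall x, D x -> A x) ->
  (forall x k, D x -> \forall y \near within A (nbhs x), W k y) ->
  (forall O : set X, open O -> O `&` A !=set0 -> O `&` D !=set0) ->
  typical_in A P.
Proof.
move=> WP DA DW Ddense.
pose G k := interior [set x : A | W k (set_val x)].
exists (\bigcap_k G k); split.
- by exists G => // k; exact: open_interior.
- move=> O [z Oz] [V oV VE].
  have [|x [Vx Dx]] := Ddense V oV.
    exists (set_val z); split; last exact: set_valP.
    by rewrite -[_ (set_val z)]/((set_val @^-1` V) z) VE.
  have Ax : x \in A by rewrite inE; exact: DA.
  pose x' : A := SigSub Ax.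
  exists x'; split; first by rewrite -VE.
  move=> k _; have := DW x k Dx; rewrite /within/= nbhsE => -[U [oU Ux] UW].
  rewrite /G /interior/= nbhsE; exists (set_val @^-1` U).
    by split => //; exists U.
  by move=> [y yA] /= Uy; apply: UW => //; exact: set_mem.
move=> x xG; apply: WP; first exact: set_valP.
by move=> k; have /interior_subset := xG k I.
Qed.

End comeager_criterion.

Lemma normr_max0 (R : realType) (a : R) : `|Num.max a 0| <= `|a|.
Proof. by rewrite /Num.max; case: ifP => // _; rewrite normr0. Qed.

Lemma max0_sub (R : realType) (a : R) : Num.max a 0 - Num.max (- a) 0 = a.
Proof.
rewrite /Num.max oppr_lt0; case: (ltrgt0P a) => [a0|a0|->] /=.
- by rewrite subr0.
- by rewrite opprK add0r.
- by rewrite oppr0 subr0.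
Qed.

Section norm_convergence.
Context (K : numFieldType) (V : normedModType K) (X : Type).
Context (F : set_system X) {FF : Filter F}.

Lemma cvg_norm_lt (f : X -> V) (l : V) (e : K) : f @ F --> l -> `|l| < e ->
  \forall x \near F, `|f x| < e.
Proof.
move=> /cvgrPdist_lt fl le; have el : 0 < e - `|l| by rewrite subr_gt0.
apply: filterS (fl _ el) => x; rewrite ltrBrDr distrC; apply: le_lt_trans.
by rewrite -{1}(subrK l (f x)) ler_normD.
Qed.

Lemma cvg_norm_gt (f : X -> V) (l : V) (e : K) : f @ F --> l -> e < `|l| ->
  \forall x \near F, e < `|f x|.
Proof.
move=> /cvgrPdist_lt fl le; have el : 0 < `|l| - e by rewrite subr_gt0.
apply: filterS (fl _ el) => x; rewrite ltrBrDr -ltrBrDl => /lt_le_trans; apply.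
by rewrite lerBlDr -{1}(subrK (f x) l) addrC ler_normD.
Qed.

End norm_convergence.

Section rank_one.
Context d (T : measurableType d) (R : realType).
Variables (mu : {measure set T -> \bar R}) (p : R) (p1 : 1 <= p).
Hypothesis p_gt1 : 1 < p.
Hypothesis mu1 : mu setT = 1%E.
Local Notation C := (R[i]).
Local Notation E := (CLp mu p1).
Local Notation rl := (rl mu p1).
Local Notation rLp := (rLp mu p).
Local Notation oneLp := (oneLp mu p1).
Implicit Types (h g : T -> R) (u v : E) (S Q : bop E).

Let mu_lty : (mu setT < +oo)%E. Proof. by rewrite mu1 ltry. Qed.

(** Real and imaginary parts, then positive and negative parts, write every element as a combination
    of four nonnegative ones. *)
Lemma nonneg_span (f : {linear E -> E}) : (forall u, CLp_nonneg u -> f u = 0) ->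
  forall u, f u = 0.
Proof.
move=> f0; have real h : rLp h -> f (rl h) = 0.
  move=> hh; have mh := rLp_meas hh.
  pose hp x := Num.max (h x) 0; pose hm x := Num.max (- h x) 0.
  have rhp : rLp hp.
    apply: (rLp_absle p1 _ _ hh) => [|x]; first exact: measurable_maxr.
    exact: normr_max0.
  have rhm : rLp hm.
    apply: (rLp_absle p1 _ _ hh) => [|x].
      by apply: measurable_maxr => //; exact: measurableT_comp.
    by rewrite -(normrN (h x)); exact: normr_max0.
  have -> : rl h = rl hp - rl hm.
    rewrite -rlB//; congr rl; apply/funext => x; exact/esym/max0_sub.
  rewrite linearB/= !f0 ?subr0//; apply: rl_nonneg => //; apply: aeW => x.
    by rewrite le_max lexx orbT.
  by rewrite le_max lexx orbT.
move=> u; rewrite (rl_Re_Im u) linearD linearZ/=.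
by rewrite (real _ (rLp_Re u)) (real _ (rLp_Im u)) scaler0 addr0.
Qed.

(** By [nonneg_span] some f >= 0 has Q f nonzero. Both Q f and S (Q f) = Q (S f) are multiples of y,
    so Q f is a nonnegative eigenvector, with an eigenvalue of modulus at most 1 since S is a
    contraction. *)
Lemma rank_one_limit_absurd S Q : positive_op S -> bop_contraction S ->
  (forall k, concentrates k S) -> weak_limits S Q -> rank_one Q ->
  positive_op Q -> False.
Proof.
move=> S0 S1 Sk SQ [y y0 Qy] Q0.
have comm := weak_limit_comm (fun x z => pair_sep p_gt1 mu_lty (u := x) (v := z)) SQ.
have inQ x : exists c, Q x = c *: y.
  have : range Q (Q x) by exists x.
  by rewrite Qy => -[c _ <-]; exists c.
have [f [f0 Qf0]] : exists f, CLp_nonneg f /\ Q f != 0.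
  apply/not_existsP => nf; move/eqP : y0; apply.
  have : [set c *: y | c in [set: C]] y by exists 1 => //; rewrite scale1r.
  rewrite -Qy => -[x _ <-]; apply: nonneg_span => u u0.
  by apply/eqP/negP => /negP Qu; apply: (nf u).
have [c cE] := inQ f; have [c' c'E] := inQ (S f).
have c0 : c != 0 by apply: contraNneq Qf0 => c0; rewrite cE c0 scale0r.
have SQf : S (Q f) = (c' / c) *: Q f.
  by rewrite comm c'E cE scalerA divfK.
apply/(elimN eqP Qf0).
apply: (concentrates_no_eigenvector p_gt1 mu1 S0 S1 Sk (Q0 _ f0) SQf).
by have := S1 (Q f); rewrite SQf normrZ ger_pMl// normr_gt0.
Qed.

(** Convergence on nonnegative elements suffices because the iterates of 1 under S are nonnegative;
    the contraction property of Q carries the error through each further iteration. The filter is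
    arbitrary, so that the lemma serves both operator topologies. *)
Lemma concentrates_near (F : set_system (bop E)) S k : Filter F ->
  (forall u, CLp_nonneg u -> (fun Q => Q u) @ F --> S u) ->
  (\forall Q \near F, bop_contraction Q) -> positive_op S ->
  concentrates k S -> \forall Q \near F, concentrates k Q.
Proof.
move=> FF Fu F1 S0 [n [hmean hnorm]].
have one0 : CLp_nonneg oneLp.
  by apply: rl_nonneg; [exact: rLp_cst|exact: aeW].
have Sn m : (fun Q => iter m Q oneLp) @ F --> iter m S oneLp.
  elim: m => [|m ih]; first exact: cvg_cst.
  apply/cvgrPdist_lt => e e0; have e2 : 0 < e / 2 by rewrite divr_gt0.
  have h1 := Fu _ (iter_positive m S0 one0).
  near=> Q; rewrite /= (_ : _ - _ = (S (iter m S oneLp) - Q (iter m S oneLp)) +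
    Q (iter m S oneLp - iter m Q oneLp)); last by rewrite linearB/= addrA subrK.
  apply: le_lt_trans (ler_normD _ _) _; rewrite (splitr e); apply: ltrD.
    by near: Q; move/cvgrPdist_lt : h1; exact.
  have Q1 : bop_contraction Q by near: Q.
  apply: le_lt_trans (Q1 _) _.
  by near: Q; move/cvgrPdist_lt : ih; exact.
have hm : (fun Q => mean (iter n Q oneLp)) @ F --> (mean (iter n S oneLp) : C^o).
  have := @dual_continuous _ _ (pair_dual p1 p_gt1 (weight1 p_gt1 mu1)) (iter n S oneLp).
  by move=> cm; apply: (cvg_comp _ _ (Sn n) cm).
near=> Q; exists n; split; near: Q.
  exact: (@cvg_norm_lt R[i] R[i]^o _ F FF _ _ _ hm hmean).
exact: cvg_norm_gt (Sn n) hnorm.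
Unshelve. all: by end_near. Qed.

End rank_one.

(** * Weak convergence to isometries *)

(** The gap at a between t^p and its tangent at b. When integrated over functions f and g, it is a
    difference of p-th powers of norms minus a linear functional of f - g, and weak convergence
    controls the latter. *)
Definition bregman (R : realType) (p a b : R) : R := a `^ p - b `^ p - p * b `^ (p - 1) * (a - b).

Lemma powR_pred_mul (R : realType) (p b : R) : 1 < p -> 0 <= b -> b `^ (p - 1) * b = b `^ p.
Proof.
move=> p_gt1.
have p0 : 0 < p by exact: lt_trans p_gt1.
have pm0 : 0 < p - 1 by rewrite subr_gt0.
rewrite le_eqVlt => /orP[/eqP<-|b0]; first by rewrite mulr0 powR0// gt_eqF.
by rewrite -{2}(powRr1 (ltW b0)) -powRD ?subrK// gt_eqF// implybT.
Qed.

(** This is Young's inequality for a and b^(p - 1). *)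
Lemma bregman_ge0 (R : realType) (p a b : R) : 1 < p -> 0 <= a -> 0 <= b -> 0 <= bregman p a b.
Proof.
move=> p_gt1 a0 b0.
have p0 : 0 < p by exact: lt_trans p_gt1.
have pm0 : 0 < p - 1 by rewrite subr_gt0.
have q0 : 0 < p / (p - 1) by rewrite divr_gt0.
have pq : p^-1 + (p / (p - 1))^-1 = 1 by rewrite invf_div; field; rewrite gt_eqF.
have := conjugate_powR a0 (powR_ge0 b (p - 1)) p0 q0 pq.
rewrite -powRrM (_ : (p - 1) * (p / (p - 1)) = p); last by field; rewrite gt_eqF.
rewrite invf_div => young.
have {young} : p * (a * b `^ (p - 1)) <= p * (a `^ p / p + b `^ p * ((p - 1) / p)).
  by rewrite ler_pM2l.
rewrite (_ : p * (a `^ p / p + b `^ p * ((p - 1) / p)) = a `^ p + (p - 1) * b `^ p); last first.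
  by field; rewrite gt_eqF.
have := powR_pred_mul p_gt1 b0; rewrite /bregman => <-; set X := a `^ p; set Y := b `^ _; clear; lra.
Qed.

(** The sum of the inequalities 0 <= [bregman p t m] and 0 <= [bregman p m 1]. With m between 1 and
    t, it bounds the divergence from 1 below by a quantity linear in t. *)
Lemma bregman_tangent (R : realType) (p t m : R) : 1 < p -> 0 <= t -> 0 <= m -> p * (m `^ (p - 1) - 1) * (t - m) <= bregman p t 1.
Proof.
move=> p_gt1 t0 m0; have h1 := bregman_ge0 p_gt1 t0 m0.
have h2 := bregman_ge0 p_gt1 m0 ler01.
by move: h1 h2; rewrite /bregman !powR1; set X := t `^ p; set Y := m `^ p; set Z := m `^ _; clear; lra.
Qed.

(** Four ranges of t: within s = eta^(1/p) of 1 the term [eta] suffices; below 1 - s and between 1 +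
    s and L the divergence is at least a positive constant while the left side is bounded; beyond L
    the power t^p dominates. The three summands of the constant serve the last three ranges. *)
Lemma bregman1_coercive (R : realType) (p eta : R) : 1 < p -> 0 < eta <= 1 -> exists2 C : R, 0 <= C &
  forall t, 0 <= t -> `|t - 1| `^ p <= eta + C * bregman p t 1.
Proof.
move=> p_gt1 /andP[eta0 eta1].
have p0 : 0 < p by exact: lt_trans p_gt1.
have pm0 : 0 < p - 1 by rewrite subr_gt0.
have [s [s0 sp]] : exists s : R, 0 < s /\ s `^ p = eta.
  by exists (eta `^ p^-1); rewrite powR_gt0// powR_invK ?gt_eqF// ltW.
have s1 : s <= 1.
  have : s `^ p <= 1 `^ p by rewrite sp powR1.
  by rewrite powR_leE// ltW.
(* [c1] and [c2] are the values of [bregman_tangent] at distance s from 1, with the auxiliary point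
   m at distance s / 2. *)
have [c1 c1E] : exists c1, c1 = p * ((1 + s / 2) `^ (p - 1) - 1) * (s / 2) by eexists.
have [c2 c2E] : exists c2, c2 = p * (1 - (1 - s / 2) `^ (p - 1)) * (s / 2) by eexists.
have c10 : 0 < c1.
  rewrite c1E mulr_gt0 ?divr_gt0// mulr_gt0// subr_gt0.
  have h : (1 : R) `^ (p - 1) = 1 by rewrite powR1.
  by rewrite -[ltLHS]h powR_lt// ltrDl divr_gt0.
have c20 : 0 < c2.
  rewrite c2E mulr_gt0 ?divr_gt0// mulr_gt0// subr_gt0.
  have h : (1 : R) `^ (p - 1) = 1 by rewrite powR1.
  by rewrite -[ltRHS]h powR_lt//; move: s0 s1; clear; lra.
(* Beyond this L one has p * t <= t^p / 2, so that t^p is at most twice the divergence. *)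
have [L [L0 Lp]] : exists L : R, 0 <= L /\ L `^ (p - 1) = 2 * p.
  exists ((2 * p) `^ (p - 1)^-1); rewrite powR_ge0 powR_invK ?gt_eqF//.
  by rewrite mulr_ge0// ltW.
exists (L `^ p / c1 + c2^-1 + 2).
  by rewrite addr_ge0// addr_ge0 ?invr_ge0 ?(ltW c20)// divr_ge0 ?powR_ge0// ltW.
move=> t t0; have ft0 := bregman_ge0 p_gt1 t0 ler01.
have A0 : 0 <= L `^ p / c1 by rewrite divr_ge0 ?powR_ge0// ltW.
have B0 : 0 <= c2^-1 by rewrite invr_ge0 ltW.
have A1 := mulr_ge0 A0 ft0. have B1 := mulr_ge0 B0 ft0.
rewrite 2!mulrDl.
have [ts|ts] := leP `|t - 1| s.
  have h : `|t - 1| `^ p <= eta by rewrite -sp powR_le// ltW.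
  apply: le_trans h _; rewrite lerDl; apply: addr_ge0; first exact: addr_ge0.
  exact: mulr_ge0.
have [t1|t1] := leP t 1.
  have ts' : t < 1 - s by move: ts; rewrite ler0_norm ?subr_le0//; clear; lra.
  have h1 : `|t - 1| `^ p <= 1.
    have h : (1 : R) `^ p = 1 by rewrite powR1.
    by rewrite -[leRHS]h powR_le ?(ltW p0)// ler_norml; move: t0 t1; clear; lra.
  have m0 : 0 <= 1 - s / 2 by move: s1; clear; lra.
  have := bregman_tangent p_gt1 t0 m0; set X := (1 - s / 2) `^ _ => h2.
  have X1 : 0 <= 1 - X.
    by move: c20; rewrite c2E -/X pmulr_lgt0 ?divr_gt0// pmulr_rgt0// => /ltW.
  have h3 : c2 <= bregman p t 1.
    apply: le_trans h2; rewrite c2E -/X.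
    rewrite (_ : p * (X - 1) * (t - (1 - s / 2)) = p * (1 - X) * (1 - s / 2 - t)); last by ring.
    by rewrite ler_wpM2l ?mulr_ge0 ?(ltW p0)//; move: ts'; clear; lra.
  have h4 : 1 <= c2^-1 * bregman p t 1 by rewrite ler_pdivlMl// mulr1.
  by move: h1 h4 eta0 A1 ft0; set u := _ * bregman p t 1; set v := _ * bregman p t 1; clear; lra.
have {}ts : 1 + s < t by move: ts; rewrite gtr0_norm ?subr_gt0//; clear; lra.
have tp : `|t - 1| `^ p <= t `^ p.
  by rewrite powR_le ?(ltW p0)// gtr0_norm ?subr_gt0//; clear; lra.
have [tL|tL] := leP t L.
  have h1 : t `^ p <= L `^ p by rewrite powR_le ?(ltW p0).
  have m0 : 0 <= 1 + s / 2 by move: s0; clear; lra.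
  have := bregman_tangent p_gt1 t0 m0; set X := (1 + s / 2) `^ _ => h2.
  have X1 : 0 <= X - 1.
    by move: c10; rewrite c1E -/X pmulr_lgt0 ?divr_gt0// pmulr_rgt0// => /ltW.
  have h3 : c1 <= bregman p t 1.
    apply: le_trans h2; rewrite c1E -/X.
    by rewrite ler_wpM2l ?mulr_ge0 ?(ltW p0)//; move: ts; clear; lra.
  have h4 : L `^ p <= L `^ p / c1 * bregman p t 1.
    by rewrite mulrAC ler_pdivlMr// ler_wpM2l// powR_ge0.
  by move: tp h1 h4 eta0 B1 ft0; set u := _ * bregman p t 1; set v := _ * bregman p t 1; clear; lra.
have : 2 * p * t <= t `^ p.
  by rewrite -(powR_pred_mul p_gt1 t0) ler_wpM2r// -Lp powR_le// ltW.
move: tp eta0 A1 B1 (ltW p_gt1); set u := _ * bregman p t 1; set v := _ * bregman p t 1.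
rewrite /bregman !powR1; set X := t `^ p; set Y := `|_| `^ _; clear; lra.
Qed.

(** Both sides are homogeneous of degree p in (a, b), which reduces the claim to b = 1. The
    additional 1 in the constant covers b = 0, where the divergence is a^p. *)
Lemma bregman_coercive (R : realType) (p eta : R) : 1 < p -> 0 < eta <= 1 -> exists2 C : R, 0 <= C &
  forall a b, 0 <= a -> 0 <= b -> `|a - b| `^ p <= eta * b `^ p + C * bregman p a b.
Proof.
move=> p_gt1 eta01; have [C C0 hC] := bregman1_coercive p_gt1 eta01.
have p0 : 0 < p by exact: lt_trans p_gt1.
have pm0 : 0 < p - 1 by rewrite subr_gt0.

exists (C + 1); first by rewrite addr_ge0.
move=> a b a0; rewrite le_eqVlt => /orP[/eqP <-|b0].
  rewrite /bregman subr0 !powR0 ?gt_eqF// !(mulr0, mul0r) add0r !subr0.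
  by rewrite ger0_norm// mulrDl mul1r lerDr mulr_ge0// powR_ge0.
have t0 : 0 <= a / b by rewrite divr_ge0// ltW.
have E1 : `|a - b| `^ p = b `^ p * `|a / b - 1| `^ p.
  rewrite -powRM ?(ltW b0)//; congr (_ `^ _).
  rewrite -[X in X * _](gtr0_norm b0) -normrM; congr `|_|.
  by field; rewrite gt_eqF.
have E2 : bregman p a b = b `^ p * bregman p (a / b) 1.
  rewrite /bregman !powR1 -{1}(divfK (lt0r_neq0 b0) a) powRM ?(ltW b0)//.
  rewrite -(powR_pred_mul p_gt1 (ltW b0)); set X := (a / b) `^ p; set Y := b `^ _.
  by field; rewrite gt_eqF.
rewrite E1 E2 (mulrC eta) mulrCA -mulrDr ler_wpM2l ?powR_ge0//.
apply: le_trans (hC _ t0) _; rewrite lerD2l mulrDl mul1r lerDl.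
exact: bregman_ge0.
Qed.

Lemma half_split_lt (R : realType) (n e g k : R) : 0 <= n -> g < e / 2 ->
  n * (k + 1) < e / 2 -> g + k * n < e.
Proof. by lra. Qed.

Section radon_riesz.
Context d (T : measurableType d) (R : realType).
Variables (mu : {measure set T -> \bar R}) (p : R) (p1 : 1 <= p).
Hypothesis p_gt1 : 1 < p.
Local Notation C := (R[i]).
Local Notation E := (CLp mu p1).
Local Notation rl := (rl mu p1).
Local Notation rLp := (rLp mu p).
Implicit Types (h g : T -> R) (u v : E) (S Q : bop E).

Let p0 : 0 < p. Proof. exact: lt_le_trans p1. Qed.

Lemma weight_powR g : rLp g -> (forall x, 0 <= g x) ->
  weight mu p (fun x => g x `^ (p - 1)).
Proof.
move=> [mg gy] g0; split.
  by apply: (measurableT_comp (f := fun x => x `^ (p - 1))) => //; exact: measurable_powR.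
apply: le_lt_trans gy; rewrite le_eqVlt; apply/orP; left; apply/eqP.
apply: eq_integral => x _; rewrite !ger0_norm ?powR_ge0// -powRrM.
by congr ((_ `^ _)%:E); field; rewrite gt_eqF// subr_gt0.
Qed.

Lemma integrable_powR h : rLp h -> (forall x, 0 <= h x) ->
  mu.-integrable setT (EFin \o (fun x => h x `^ p)).
Proof.
move=> hh h0; apply/integrableP; split.
  apply/measurable_EFinP; apply: (measurableT_comp (f := fun x => x `^ p)).
    exact: measurable_powR.
  exact: rLp_meas hh.
apply: le_lt_trans (rLp_fin hh); rewrite le_eqVlt; apply/orP; left; apply/eqP.
by apply: eq_integral => x _ /=; rewrite !ger0_norm ?powR_ge0.
Qed.

Lemma fine_Npow_rl h : rLp h -> (forall x, 0 <= h x) ->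
  fine (Npow (rl h)) = (\int[mu]_x (h x `^ p))%R.
Proof.
move=> hh h0; rewrite (Npow_rl p1 hh); congr fine; apply: eq_integral => x _.
by rewrite ger0_norm.
Qed.

(** In the integrated divergence the difference of the p-th powers of the norms is nonpositive by
    hypothesis and is dropped; only the pairing of f - g with g^(p - 1) remains. *)
Lemma bregman_integral_bound f g (eta K : R) : rLp f -> rLp g ->
  (forall x, 0 <= f x) -> (forall x, 0 <= g x) -> 0 <= K ->
  (forall a b, 0 <= a -> 0 <= b -> `|a - b| `^ p <= eta * b `^ p + K * bregman p a b) ->
  `|rl f| <= `|rl g| ->
  fine (Npow (rl f - rl g)) <= eta * fine (Npow (rl g)) +
    K * (p * `|rpair mu (fun x => g x `^ (p - 1)) f - rpair mu (fun x => g x `^ (p - 1)) g|).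
Proof.
move=> hf hg f0 g0 K0 hK fg; set w := fun x => g x `^ (p - 1).
have hw : weight mu p w by exact: weight_powR.
have hfg : rLp (fun x => f x - g x) by exact: rLpB.
have if_ := integrable_powR hf f0. have ig := integrable_powR hg g0.
have iwf := integrable_weight p1 p_gt1 hf hw. have iwg := integrable_weight p1 p_gt1 hg hw.
pose I h : R := (\int[mu]_x h x)%R.
pose Int h := mu.-integrable setT (EFin \o h).
have IntD h1 h2 : Int h1 -> Int h2 -> Int (fun x => h1 x + h2 x).
  by move=> i1 i2; exact: (integrableD measurableT i1 i2).
have IntZ a h1 : Int h1 -> Int (fun x => a * h1 x).
  by move=> i1; exact: (integrableZl measurableT a i1).
have ID h1 h2 : Int h1 -> Int h2 -> I (fun x => h1 x + h2 x) = I h1 + I h2.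
  by move=> i1 i2; exact: (RintegralD measurableT i1 i2).
have IZ a h1 : Int h1 -> I (fun x => a * h1 x) = a * I h1.
  by move=> i1; exact: (RintegralZl a measurableT i1).
pose F x := f x `^ p. pose G x := g x `^ p.
pose FW x := f x * w x. pose GW x := g x * w x.
have fgN : fine (Npow (rl f - rl g)) = I (fun x => `|f x - g x| `^ p).
  by rewrite -(rlB p1 hf hg) (Npow_rl p1 hfg).
have ifg : Int (fun x => `|f x - g x| `^ p).
  apply/integrableP; split; first exact: measurable_normr_powR (rLp_meas hfg).
  apply: le_lt_trans (rLp_fin hfg); rewrite le_eqVlt; apply/orP; left; apply/eqP.
  by apply: eq_integral => x _ /=; rewrite ger0_norm// powR_ge0.
pose rhs x := (eta - K) * G x + (K * F x + ((K * p) * GW x + (- (K * p)) * FW x)).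
have i1 := IntZ (eta - K) _ ig. have i2 := IntZ K _ if_.
have i3 := IntZ (K * p) _ iwg. have i4 := IntZ (- (K * p)) _ iwf.
have i34 := IntD _ _ i3 i4. have i234 := IntD _ _ i2 i34.
have irhs : Int rhs by exact: IntD i1 i234.
have le1 : I (fun x => `|f x - g x| `^ p) <= I rhs.
  apply: le_Rintegral => // x _; apply: le_trans (hK _ _ (f0 x) (g0 x)) _.
  rewrite /bregman /rhs /F /G /FW /GW /w; set X := f x `^ p; set Y := g x `^ p.
  by set Z := g x `^ _; rewrite le_eqVlt; apply/orP; left; apply/eqP; ring.
have rhsE : I rhs = (eta - K) * I G + (K * I F + ((K * p) * I GW + - (K * p) * I FW)).
  rewrite /rhs (ID _ _ i1 i234) (ID _ _ i2 i34) (ID _ _ i3 i4).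
  by rewrite (IZ _ _ ig) (IZ _ _ if_) (IZ _ _ iwg) (IZ _ _ iwf).
rewrite fgN (fine_Npow_rl hg g0) -/(I G); apply: (le_trans le1); rewrite rhsE.
have FG : I F <= I G.
  rewrite -[I F](fine_Npow_rl hf f0) -[I G](fine_Npow_rl hg g0).
  move: fg; rewrite CLp_norm_le => fg.
  by apply: le_fine fg (Npow_lty _); exact: Npow_ge0.
rewrite -[rpair mu w f]/(I FW) -[rpair mu w g]/(I GW).
have h2 : I GW - I FW <= `|I FW - I GW| by rewrite -normrN opprB ler_norm.
have h3 : K * p * (I GW - I FW) <= K * p * `|I FW - I GW|.
  by rewrite ler_wpM2l// mulr_ge0// ltW.
have h4 : K * I F <= K * I G by rewrite ler_wpM2l.
move: h3 h4; move: (I F) (I G) (I FW) (I GW) `|_| => a b c e n; clear; lra.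
Qed.

(** The weight is g^(p - 1), the norming functional of v up to a scalar. A single functional thus
    detects norm convergence to v among the nonnegative elements of no larger norm. *)
Lemma radon_riesz v (e : R) : CLp_nonneg v -> 0 < e ->
  exists2 w, weight mu p w & exists2 del : R, 0 < del &
  forall u, CLp_nonneg u -> `|u| <= `|v| ->
    `|pair w u - pair w v| < del%:C%C -> `|u - v| < e%:C%C.
Proof.
move=> /nonneg_rl [g [hg g0 ->]] e0; set w := fun x => g x `^ (p - 1).
have hw : weight mu p w by exact: weight_powR.
exists w => //.
set G := fine (Npow (rl g)).
have G0 : 0 <= G by exact: fine_Npow_ge0.
have ep : 0 < e `^ p by rewrite powR_gt0.
(* [eta] is chosen against the norm of v; it determines [K], which determines [del]. Adding 1 to [G]
   allows for v = 0, and the minimum with 1 meets the hypothesis of [bregman_coercive]. *)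
have [eta [eta01 etaG]] : exists eta : R, 0 < eta <= 1 /\ eta * G < e `^ p / 2.
  exists (Num.min 1 (e `^ p / 2 / (G + 1))).
  rewrite lt_min ge_min lexx ltr01 !divr_gt0 ?ltr_wpDl//=; split => //.
  have : Num.min 1 (e `^ p / 2 / (G + 1)) <= e `^ p / 2 / (G + 1) by rewrite ge_min lexx orbT.
  rewrite ler_pdivlMr ?ltr_wpDl// mulrDr mulr1; apply: lt_le_trans.
  by rewrite ltrDl lt_min ltr01 !divr_gt0 ?ltr_wpDl.
have [K K0 hK] := bregman_coercive p_gt1 eta01.
have Kp0 : 0 < K * p + 1 by rewrite ltr_wpDl// mulr_ge0// ltW.
exists (e `^ p / 2 / (K * p + 1)); first by rewrite !divr_gt0.
move=> _ /nonneg_rl [f [hf f0 ->]] fg; rewrite !(pair_rl p1 p_gt1 hw)// -rmorphB.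
rewrite normr_normc normc_real ltcR => wfg.
rewrite CLp_norm_ltE ?(ltW e0)// -[Npow _]fineK ?Npow_fin// lte_fin.
apply: le_lt_trans (bregman_integral_bound hf hg f0 g0 K0 hK fg) _.
rewrite -/w -/G mulrA; move: wfg; rewrite ltr_pdivlMr//.
exact: (half_split_lt (normr_ge0 _) etaG).
Qed.

(** The norm condition of [radon_riesz] is automatic: Q u has norm at most that of u, which is that
    of S u. Positivity confines the conclusion to nonnegative u. *)
Lemma wot_cvg_isometry S (F : set_system (bop E)) : Filter F -> F --> (S : wot E) ->
  positive_op S -> bop_isometry S ->
  (\forall Q \near F, positive_op Q /\ bop_contraction Q) ->
  forall u, CLp_nonneg u -> (fun Q => Q u) @ F --> S u.
Proof.
move=> FF /wot_cvgP FS S0 S1 F1 u u0; apply/cvgrPdist_lt => e e0.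
have [r rE] : exists r : R, e = r%:C%C.
  by exists (complex.Re e); rewrite RRe_real// gtr0_real.
move: e0; rewrite rE -(rmorph0 (real_complex R)) ltcR => r0.
have [w hw [del del0 hdel]] := radon_riesz (S0 _ u0) r0.
have := FS u (pair_dual p1 p_gt1 hw).
move/cvgrPdist_lt => /(_ del%:C%C); rewrite -(rmorph0 (real_complex R)) ltcR => /(_ del0) near1.
apply: filterS2 F1 near1 => Q [Q0 Q1] Qd; rewrite distrC; apply: hdel.
- exact: Q0.
- by rewrite S1.
- by rewrite distrC.
Qed.

End radon_riesz.

(** * Reduction of typicality to density *)

Section reduction_to_density.
Context d (T : measurableType d) (R : realType).
Variables (mu : {measure set T -> \bar R}) (p : R) (p1 : 1 <= p).
Hypothesis p_gt1 : 1 < p.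
Hypothesis mu1 : mu setT = 1%E.
Local Notation E := (CLp mu p1).

Lemma typical_sot (A : set (bop E)) : A `<=` positive_isometries mu p1 ->
  (forall O : set (sot E), open O -> O `&` A !=set0 ->
    O `&` [set S | A S /\ forall k, concentrates k S] !=set0) ->
  typical_in (X := sot E) A (no_rank_one_limit mu p1).
Proof.
move=> AI Adense; apply: (@typical_in_of_dense (sot E) A _ [set S | A S /\ forall k, concentrates k S]
  (fun k => [set S | concentrates k S])) => //.
- move=> S /AI[S0 S1] Sk [Q SQ [Q1 Q0]].
  apply: (rank_one_limit_absurd p_gt1 mu1 S0 _ Sk SQ Q1 Q0).
  by move=> x; rewrite S1.
- by move=> S [].
- move=> S k [AS Sk]; have [S0 S1] := AI _ AS.
  have SF : within A (nbhs (S : sot E)) --> (S : sot E) by exact: cvg_within.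
  apply: (concentrates_near p_gt1 mu1 _ _ _ S0 (Sk k)).
    by move=> u _; move: SF => /sot_cvgP; exact.
  have hA : \forall Q \near within A (nbhs (S : sot E)), A Q by exact: withinT.
  by apply: filterS hA => Q /AI[_ Q1] x; rewrite Q1.
Qed.

Lemma typical_wot :
  (forall O : set (wot E), open O -> O `&` positive_contractions mu p1 !=set0 ->
    O `&` [set S | positive_isometries mu p1 S /\ forall k, concentrates k S] !=set0) ->
  typical_in (X := wot E) (positive_contractions mu p1) (no_rank_one_limit mu p1).
Proof.
move=> Adense; apply: (@typical_in_of_dense (wot E) _ _
  [set S | positive_isometries mu p1 S /\ forall k, concentrates k S]
  (fun k => [set S | concentrates k S])) => //.
- move=> S [S0 S1] Sk [Q SQ [Q1 Q0]].
  exact: (rank_one_limit_absurd p_gt1 mu1 S0 S1 Sk SQ Q1 Q0).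
- by move=> S [[S0 S1] _]; split => // x; rewrite S1.
- move=> S k [[S0 S1] Sk].
  have near1 : \forall Q \near within (positive_contractions mu p1) (nbhs (S : wot E)),
      positive_op Q /\ bop_contraction Q by exact: withinT.
  apply: (concentrates_near p_gt1 mu1 _ _ _ S0 (Sk k)).
    have SF : within (positive_contractions mu p1) (nbhs (S : wot E)) --> (S : wot E).
      exact: cvg_within.
    by apply: (wot_cvg_isometry p_gt1 _ SF S0 S1 near1).
  by apply: filterS near1 => Q [].
Qed.

End reduction_to_density.

(** * Piecewise affine maps of the unit interval *)

Section splitting.
Context (R : realType).
Implicit Types (c : nat -> R) (t x y : R) (k n : nat).
Local Notation T := (measurableTypeR R).

Definition prob_seq c := (forall k, 0 <= c k) /\ series c @ \oo --> (1 : R).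

(* The unit interval [0,1[ is the disjoint union of the intervals
   [series c k, series c k.+1[ of lengths [c k]. *)
Definition piece_map c k x : R := series c k + c k * x.

Definition piece_idx c t : nat :=
  xget 0%N [set k | series c k <= t < series c k.+1].

Definition piece_pos c t : R := (t - series c (piece_idx c t)) / c (piece_idx c t).

Lemma series_S c k : series c k.+1 = series c k + c k.
Proof. by rewrite /series/= big_nat_recr. Qed.

Lemma series_le c m n : (forall k, 0 <= c k) -> (m <= n)%N -> series c m <= series c n.
Proof.
move=> c0 mn; have := @nondecreasing_series R c xpredT 0.
by move=> /(_ (fun k _ _ => c0 k)) /(_ m n mn).
Qed.

Section fixed_sequence.
Variable (c : nat -> R).
Hypothesis c_prob : prob_seq c.

Let c0 k : 0 <= c k. Proof. exact: c_prob.1. Qed.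

Lemma series_le1 k : series c k <= 1.
Proof.
have /cvg_lim <- // := c_prob.2.
apply: nondecreasing_cvgn_le; last by apply/cvg_ex; exists 1; exact: c_prob.2.
by move=> m n; exact: series_le.
Qed.

Lemma series_ge0 k : 0 <= series c k.
Proof. by rewrite /series/= sumr_ge0. Qed.

Lemma piece_idx_uniq t m n : series c m <= t < series c m.+1 ->
  series c n <= t < series c n.+1 -> m = n.
Proof.
wlog mn : m n / (m <= n)%N.
  move=> h hm hn; case: (leqP m n) => mn; first exact: h.
  by apply/esym; apply: h => //; exact: ltnW.
move=> /andP[_ m2] /andP[n1 _]; apply/eqP; rewrite eqn_leq mn/= leqNgt.
by apply/negP => /(series_le c0) /(le_trans _) => /(_ _ (lexx _)); rewrite leNgt (le_lt_trans n1).
Qed.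

Lemma piece_idxE t k : series c k <= t < series c k.+1 -> piece_idx c t = k.
Proof.
move=> tk; rewrite /piece_idx; case: xgetP => [m -> /= tm|/(_ k)//].
exact: piece_idx_uniq tm tk.
Qed.

Lemma piece_idxP t : 0 <= t < 1 ->
  series c (piece_idx c t) <= t < series c (piece_idx c t).+1.
Proof.
move=> /andP[t0 t1]; rewrite /piece_idx; case: xgetP => [m -> //|h]; exfalso.
have [n tn] : exists n, t < series c n.
  have /cvgrPdist_lt/(_ (1 - t)) := c_prob.2.
  rewrite subr_gt0 => /(_ t1)[n _ /(_ n (leqnn n))/=] hn; exists n.
  move: hn; rewrite ger0_norm ?subr_ge0 ?series_le1//.
  by rewrite ltrD2l ltrN2.
have := @ex_minnP (fun n => t < series c n) (ex_intro _ n tn).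
case=> -[|m] tm mmin; first by move: tm; rewrite /series/= big_geq// ltNge t0.
apply: (h m); rewrite /= tm andbT leNgt; apply/negP => /mmin.
by rewrite ltnn.
Qed.

Lemma piece_pos_gt0 t : 0 <= t < 1 -> 0 < c (piece_idx c t).
Proof.
move=> /piece_idxP /andP[h1 h2]; have := le_lt_trans h1 h2.
by rewrite series_S ltrDl.
Qed.

Lemma piece_posP t : 0 <= t < 1 -> 0 <= piece_pos c t < 1.
Proof.
move=> t01; have ck := piece_pos_gt0 t01; have /andP[h1 h2] := piece_idxP t01.
rewrite /piece_pos divr_ge0 ?subr_ge0 ?(ltW ck)//=.
by rewrite ltr_pdivrMr// mul1r ltrBlDl -series_S.
Qed.

Lemma piece_posK t : 0 <= t < 1 -> piece_map c (piece_idx c t) (piece_pos c t) = t.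
Proof.
move=> t01; have ck := piece_pos_gt0 t01; rewrite /piece_map /piece_pos.
by rewrite mulrC divfK ?gt_eqF// addrC subrK.
Qed.

Lemma piece_map_in k x : 0 < c k -> 0 <= x < 1 ->
  series c k <= piece_map c k x < series c k.+1.
Proof.
move=> ck /andP[x0 x1]; rewrite /piece_map lerDl mulr_ge0// series_S ltrD2l.
by rewrite gtr_pMr.
Qed.

Lemma piece_map01 k x : 0 < c k -> 0 <= x < 1 -> 0 <= piece_map c k x < 1.
Proof.
move=> ck x01; have /andP[h1 h2] := piece_map_in ck x01.
by rewrite (le_trans _ h1) ?series_ge0//= (lt_le_trans h2)// series_le1.
Qed.

Lemma piece_map_idx k x : 0 < c k -> 0 <= x < 1 -> piece_idx c (piece_map c k x) = k.
Proof. by move=> ck x01; apply: piece_idxE; exact: piece_map_in. Qed.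

Lemma piece_map_pos k x : 0 < c k -> 0 <= x < 1 -> piece_pos c (piece_map c k x) = x.
Proof.
move=> ck x01; rewrite /piece_pos piece_map_idx// /piece_map.
by rewrite addrAC subrr add0r mulrC mulKf// gt_eqF.
Qed.

Lemma measurable_piece_map k : measurable_fun setT (piece_map c k : T -> T).
Proof. by apply: measurable_funD => //; exact: measurable_funM. Qed.

Lemma measurable_piece_idx k : measurable [set t : T | piece_idx c t = k].
Proof.
have mP n : measurable [set t : T | series c n <= t < series c n.+1].
  have -> : [set t : T | series c n <= t < series c n.+1] = `[series c n, series c n.+1[%classic.
    by apply/seteqP; split => t /=; rewrite in_itv.
  exact: measurable_itv.
(* The default value of [piece_idx] is 0, so the index 0 also collects all points outside the
   intervals. *)
have [->|k0] := eqVneq k 0%N.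
  have -> : [set t : T | piece_idx c t = 0%N] =
      [set t : T | series c 0 <= t < series c 1] `|`
      ~` \bigcup_n [set t : T | series c n <= t < series c n.+1].
    apply/seteqP; split => t /=.
      rewrite /piece_idx; case: xgetP => [m -> /= tm m0|tn _]; first by left; move: tm; rewrite m0.
      by right; case => n _ /= /tn.
    case=> [/piece_idxE//|tn]; rewrite /piece_idx; case: xgetP => [m -> tm|//].
    by exfalso; exact: (tn (ex_intro2 _ _ _ I tm)).
  by apply: measurableU => //; apply: measurableC; exact: bigcupT_measurable.
rewrite [X in measurable X](_ : _ = [set t : T | series c k <= t < series c k.+1]) //.
apply/seteqP; split => t /=; last exact: piece_idxE.
rewrite /piece_idx; case: xgetP => [m -> /= tm <-//|_ k0']; move: k0; rewrite -k0'.
by rewrite eqxx.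
Qed.

Lemma measurable_piece_pos : measurable_fun setT (piece_pos c : T -> T).
Proof.
move=> _ B mB; rewrite setTI.
rewrite [X in measurable X](_ : _ = \bigcup_k ([set t : T | piece_idx c t = k] `&`
   (fun t : T => (t - series c k) / c k) @^-1` B)).
  apply: bigcupT_measurable => k; apply: measurableI; first exact: measurable_piece_idx.
  rewrite -[X in measurable X]setTI; apply: (_ : measurable_fun setT _) => //.
  by apply: measurable_funM => //; exact: measurable_funB.
apply/seteqP; split => [t /= Bt|t [k _ [/= <-]]//].
by exists (piece_idx c t).
Qed.

End fixed_sequence.
End splitting.

Section splitting_integral.
Context (R : realType).
Implicit Types (c : nat -> R) (t x y : R) (k n : nat).
Local Notation mu := (lebesgue01 R).
Local Notation T := (measurableTypeR R).
Local Notation lam := (@lebesgue_measure R).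

Lemma measurable_affine (a b : R) : measurable_fun setT ((fun x => a + b * x) : T -> T).
Proof. by apply: measurable_funD => //; exact: measurable_funM. Qed.

(** The rescaled pushforward has the right value on half-open intervals, and these values
    characterise Lebesgue measure. *)
Lemma lebesgue_measure_affine (a b : R) (A : set T) : 0 < b -> measurable A ->
  lam A = (b%:E * lam ((fun x => (a + b * x)%R) @^-1` A))%E.
Proof.
move=> b0 mA.
pose pf : {measure set T -> \bar R} := pushforward lam ((fun x => a + b * x) : T -> T).
pose nu : {measure set T -> \bar R} := mscale (NngNum (ltW b0)) (pf (measurable_affine a b)).
rewrite (@lebesgue_measure_unique R nu) //.
move=> _ [[x y]] _ <-.
rewrite -[RHS]/(b%:E * lam ((fun z => (a + b * z)%R) @^-1` `]x, y]%classic))%E.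
have -> : (fun z => a + b * z) @^-1` `]x, y] = `](x - a) / b, (y - a) / b]%classic.
  apply/seteqP; split => z /=; rewrite !in_itv/= => /andP[h1 h2].
    by rewrite ltr_pdivrMr// ler_pdivlMr// ltrBlDl lerBrDl mulrC h1 h2.
  by move: h1 h2; rewrite ltr_pdivrMr// ler_pdivlMr// ltrBlDl lerBrDl mulrC => -> ->.
rewrite !lebesgue_measure_itv/= !lte_fin ltr_pM2r ?invr_gt0// ltrD2r.
case: ifPn => _; last by rewrite mule0.
rewrite -!EFinB -EFinM; congr EFin; field; rewrite gt_eqF//.
Qed.

(** The point 1 is null; without it, the interval is exactly covered by the half-open pieces. *)
Lemma lebesgue01E (A : set T) : measurable A -> mu A = lam (A `&` `[0, 1[).
Proof.
move=> mA; rewrite /lebesgue01/= /mrestr.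
have h : A `&` `[0, 1]%classic = (A `&` `[0, 1[%classic) `|` (A `&` [set 1 : T]).
  by rewrite -setIUr; congr (_ `&` _); rewrite setUitv1 ?bnd_simp.
rewrite h measureU0//.
- by apply: measurableI => //; exact: measurable_itv.
- by apply: measurableI => //; exact: measurable_set1.
- apply/eqP; rewrite eq_le measure_ge0 andbT.
  rewrite -[leRHS](lebesgue_measure_set1 (1 : R)).
  apply: le_measure; rewrite ?inE//; first by apply: measurableI => //; exact: measurable_set1.
Qed.

Lemma lebesgue01_setT : mu setT = 1%E.
Proof.
rewrite lebesgue01E// setTI lebesgue_measure_itv/= lte_fin ltr01.
by rewrite -EFinB subr0.
Qed.

Lemma lebesgue01_ae : {ae mu, forall x, 0 <= x < 1}.
Proof.
exists (~` `[0, 1[%classic); split.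
- by apply: measurableC; exact: measurable_itv.
- rewrite lebesgue01E; first by rewrite setICl measure0.
  by apply: measurableC; exact: measurable_itv.
by move=> x /= h; rewrite in_itv.
Qed.

Variable (c : nat -> R).
Hypothesis c_prob : prob_seq c.
Let c0 k : 0 <= c k. Proof. exact: c_prob.1. Qed.

Lemma splitting_measure (A : set T) : measurable A ->
  mu A = (\sum_(0 <= k <oo) (c k)%:E * mu ((piece_map c k : T -> T) @^-1` A))%E.
Proof.
move=> mA; rewrite lebesgue01E//.
pose P k : set T := `[series c k, series c k.+1[%classic.
have mP k : measurable (P k) by exact: measurable_itv.
have -> : A `&` `[0, 1[%classic = \bigcup_k (A `&` P k).
  apply/seteqP; split => [x [Ax]|x [k _ [Ax]]]; rewrite /P/= !in_itv/=.
    move=> x01; exists (piece_idx c x) => //; split => //=.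
    by rewrite in_itv/=; exact: piece_idxP.
  move=> /andP[h1 h2]; split => //; rewrite (le_trans _ h1)?series_ge0//=.
  by rewrite (lt_le_trans h2)// series_le1.
have mAP k : measurable (A `&` P k) by exact: measurableI.
rewrite measure_semi_bigcup//; last 2 first.
- apply/trivIsetP => m n _ _ mn; apply/seteqP; split => // x [[_ xm] [_ xn]].
  move/eqP : mn; apply; apply: (@piece_idx_uniq _ _ c_prob x).
    by move: xm; rewrite /P/= in_itv.
  by move: xn; rewrite /P/= in_itv.
- exact: bigcupT_measurable.
apply: eq_eseriesr => k _.
have mpm := measurable_piece_map c k.
have mpA : measurable ((piece_map c k : T -> T) @^-1` A).
  by rewrite -[X in measurable X]setTI; exact: mpm.
have [ck|ck] := eqVneq (c k) 0.
  by rewrite ck mul0e /P series_S ck addr0 set_itvco0// setI0 measure0.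
have ck0 : 0 < c k by rewrite lt_neqAle eq_sym ck c0.
apply: (etrans (lebesgue_measure_affine (series c k) ck0 (mAP k))).
congr (_ * _)%E; rewrite lebesgue01E//; congr (lam _).
rewrite preimage_setI; congr (_ `&` _).
apply/seteqP; split => x; rewrite /P/= !in_itv/= series_S lerDl ltrD2l.
  by rewrite pmulr_rge0// gtr_pMr.
by rewrite pmulr_rge0// gtr_pMr.
Qed.

(** By [splitting_measure], [mu] is the sum of its pushforwards under the [piece_map c k], scaled by
    [c k]; the integral follows by linearity in the measure. *)
Lemma splitting_integral (h : T -> \bar R) : measurable_fun setT h ->
  (forall x, 0 <= h x)%E ->
  (\int[mu]_x h x = \sum_(0 <= k <oo) (c k)%:E * \int[mu]_x h (piece_map c k x))%E.
Proof.
move=> mh h0.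
pose pf k : {measure set T -> \bar R} := pushforward mu (piece_map c k : T -> T).
pose m k : {measure set T -> \bar R} :=
  mscale (NngNum (c0 k)) (pf (measurable_piece_map c) k).
rewrite (@eq_measure_integral _ _ _ _ (mseries m 0)); last first.
  by move=> A mA _; rewrite splitting_measure.
rewrite ge0_integral_measure_series//; apply: eq_eseriesr => k _.
rewrite ge0_integral_mscale//=; congr (_ * _)%E.
by rewrite ge0_integral_pushforward//; exact: measurable_piece_map.
Qed.

End splitting_integral.

Lemma measurable_assemble d1 d2 (T : measurableType d1) (T' : measurableType d2)
    (idx : T -> nat) (f : nat -> T -> T') :
  (forall k, measurable [set y | idx y = k]) ->
  (forall k, measurable_fun setT (f k)) ->
  measurable_fun setT (fun y => f (idx y) y).
Proof.
move=> midx mf _ B mB; rewrite setTI.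
rewrite [X in measurable X](_ : _ = \bigcup_k ([set y | idx y = k] `&` f k @^-1` B)).
  apply: bigcupT_measurable => k; apply: measurableI; first exact: midx.
  by rewrite -[X in measurable X]setTI; exact: mf.
apply/seteqP; split => [t /= Bt|t [k _ [/= <-]]//].
by exists (idx t).
Qed.

(** * Towers over an isometry *)

Section assemble.
Context d (T : measurableType d) (R : realType).
Variables (mu : {measure set T -> \bar R}) (p : R) (p1 : 1 <= p).
Local Notation C := (R[i]).
Local Notation E := (CLp mu p1).
Variables (c : nat -> R) (idx : T -> nat) (pos : T -> T) (map : nat -> T -> T).

(* The maps [map k] identify T with the pieces [idx y = k] of T, of relative mass
   [c k]; [pos] is the common inverse of these identifications. *)
Record pieces : Prop := Pieces {
  pieces_gt0 : forall k, 0 < c k;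
  pieces_idx : forall k, measurable [set y | idx y = k];
  pieces_pos : measurable_fun setT pos;
  pieces_map : forall k, measurable_fun setT (map k);
  pieces_integral : forall h : T -> \bar R, measurable_fun setT h ->
    (forall x, 0 <= h x)%E ->
    (\int[mu]_x h x = \sum_(0 <= k <oo) (c k)%:E * \int[mu]_x h (map k x))%E;
  pieces_mapK : forall k, {ae mu, forall x, idx (map k x) = k /\ pos (map k x) = x};
  pieces_posK : {ae mu, forall y, map (idx y) (pos y) = y} }.

Hypothesis P : pieces.
Let c0 k : 0 < c k. Proof. exact: pieces_gt0 P k. Qed.

Implicit Types (u v : E).

Lemma pieces_sum_ge0 (h : T -> \bar R) k : (forall x, 0 <= h x)%E ->
  (0 <= (c k)%:E * \int[mu]_x h (map k x))%E.
Proof.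
by move=> h0; rewrite mule_ge0 ?lee_fin ?(ltW (c0 k))// integral_ge0.
Qed.

Lemma integral_map_le (h : T -> \bar R) k : measurable_fun setT h ->
  (forall x, 0 <= h x)%E ->
  ((c k)%:E * \int[mu]_x h (map k x) <= \int[mu]_x h x)%E.
Proof.
move=> mh h0; rewrite (pieces_integral P mh h0).
apply: le_trans (@nneseries_lim_ge R _ xpredT 0 k.+1 _); last first.
  by move=> n _ _; exact: pieces_sum_ge0.
rewrite big_nat_recr//= leeDr// sume_ge0// => i _; exact: pieces_sum_ge0.
Qed.

Lemma measurable_indic_EFin (N : set T) : measurable N ->
  measurable_fun setT (fun x => (\1_N x : R)%:E).
Proof. by move=> mN; apply/measurable_EFinP; exact: measurable_indic. Qed.

(** Pulling back along [map k] enlarges measures at most by the factor 1 / c k, so that null sets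
    stay null. Hence pieces of classes are well defined. *)
Lemma ae_map (Q : T -> Prop) k : {ae mu, forall y, Q y} ->
  {ae mu, forall x, Q (map k x)}.
Proof.
move=> [N [mN N0 QN]].
have mMN : measurable (map k @^-1` N).
  by rewrite -[X in measurable X]setTI; exact: pieces_map P k measurableT _ mN.
exists (map k @^-1` N); split => //; last by move=> x /= Qx; exact: QN.
have := integral_map_le k (measurable_indic_EFin mN)
  (fun x => ltac:(by rewrite lee_fin)).
have -> : (\int[mu]_x (\1_N x)%:E = 0)%E by rewrite integral_indic// setIT.
have -> : (\int[mu]_x (\1_N (map k x))%:E = mu (map k @^-1` N))%E.
  by rewrite -(setIT (map k @^-1` N)) -integral_indic.
move=> h; apply/eqP; rewrite eq_le measure_ge0 andbT.
by move: h; rewrite pmule_rle0 ?lte_fin.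
Qed.

Lemma ae_pieces (Q : T -> Prop) : (forall k, {ae mu, forall x, Q (map k x)}) ->
  {ae mu, forall y, Q y}.
Proof.
move=> /choice [N hN].
have mN k : measurable (N k) by have [] := hN k.
have N0 k : mu (N k) = 0%E by have [] := hN k.
have QN k x : ~ Q (map k x) -> N k x by have [_ _] := hN k; exact.
pose M := [set y | N (idx y) (pos y)].
have mM : measurable M.
  have -> : M = \bigcup_k ([set y | idx y = k] `&` pos @^-1` (N k)).
    apply/seteqP; split => [y My|y [k _ [/= <-]]//].
    by exists (idx y).
  apply: bigcupT_measurable => k; apply: measurableI; first exact: pieces_idx P k.
  by rewrite -[X in measurable X]setTI; exact: pieces_pos P measurableT _ (mN k).
have M0 : mu M = 0%E.
  rewrite -(setIT M) -integral_indic// (pieces_integral P (measurable_indic_EFin mM)).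
    apply: eseries0 => k _ _; rewrite (_ : (\int[mu]_x _)%E = 0%E) ?mule0//.
    rewrite -(N0 k) -(setIT (N k)) -integral_indic//; apply: ae_eq_integral => //.
    - exact: (measurableT_comp (measurable_indic_EFin mM) (pieces_map P k)).
    - exact: measurable_indic_EFin.
    - apply: aeS (pieces_mapK P k) => x [e1 e2] _; congr EFin.
      by rewrite !indicE; congr ((_ : bool)%:R); rewrite /M; apply/asboolP/asboolP => /=; rewrite e1 e2.
  by move=> x; rewrite lee_fin.
have aeM : {ae mu, forall y, ~ M y}.
  by exists M; split => // y /= /contrapT.
apply: aeS (aeI aeM (pieces_posK P)) => y [nM yE]; apply: contrapT => nQ.
by apply: nM; apply: QN; rewrite yE.
Qed.

Definition piece k (u : E) : E := mkLp mu p1 (fun x => ev u (map k x)).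
Definition assemble (w : nat -> E) : E := mkLp mu p1 (fun y => ev (w (idx y)) (pos y)).

Lemma cmeasurable_comp (f : T -> C) (g : T -> T) : cmeasurable (f : T -> R[i]^o) ->
  measurable_fun setT g -> cmeasurable ((f \o g) : T -> R[i]^o).
Proof. by move=> [mr mi] mg; split; [exact: (measurableT_comp mr mg)|exact: (measurableT_comp mi mg)]. Qed.

Lemma inLp_piece k u : inLp mu p (fun x => ev u (map k x)).
Proof.
split; first exact: (cmeasurable_comp (ev_measurable u) (pieces_map P k)).
have := integral_map_le k (measurable_normc_powR p (ev_measurable u))
  (fun x => ltac:(by rewrite lee_fin powR_ge0)).
rewrite -NpowE => /le_lt_trans/(_ (Npow_lty u)).
by case: (integral _ _ _) => [r _||//]; rewrite ?ltry// gt0_muley ?lte_fin.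
Qed.

Lemma ev_piece k u : {ae mu, forall x, ev (piece k u) x = ev u (map k x)}.
Proof. by apply: ev_mkLp; exact: inLp_piece. Qed.

Lemma Npow_pieces u : Npow u = (\sum_(0 <= k <oo) (c k)%:E * Npow (piece k u))%E.
Proof.
have h0 x : (0 <= ((normc (ev u x)) `^ p)%:E)%E by rewrite lee_fin powR_ge0.
rewrite NpowE.
apply: (etrans (pieces_integral P (measurable_normc_powR p (ev_measurable u)) h0)).
apply: eq_eseriesr => k _; apply: (congr1 (mule (c k)%:E)).
exact/esym/Npow_mkLp/inLp_piece.
Qed.

Definition summable_pieces (w : nat -> E) :=
  (\sum_(0 <= k <oo) (c k)%:E * Npow (w k) < +oo)%E.

Lemma cmeasurable_assemble (w : nat -> E) :
  cmeasurable ((fun y => ev (w (idx y)) (pos y)) : T -> R[i]^o).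
Proof.
split.
  apply: (measurable_assemble (f := fun k y => complex.Re (ev (w k) (pos y)))) => k.
    exact: pieces_idx P k.
  exact: (measurableT_comp (measurable_Re_ev (w k)) (pieces_pos P)).
apply: (measurable_assemble (f := fun k y => complex.Im (ev (w k) (pos y)))) => k.
  exact: pieces_idx P k.
exact: (measurableT_comp (measurable_Im_ev (w k)) (pieces_pos P)).
Qed.

Lemma assemble_integral (w : nat -> E) :
  (\int[mu]_y ((normc (ev (w (idx y)) (pos y))) `^ p)%:E =
   \sum_(0 <= k <oo) (c k)%:E * Npow (w k))%E.
Proof.
have mg := measurable_normc_powR p (cmeasurable_assemble w).
have h0 y : (0 <= ((normc (ev (w (idx y)) (pos y))) `^ p)%:E)%E.
  by rewrite lee_fin powR_ge0.
apply: (etrans (pieces_integral P mg h0)).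
apply: eq_eseriesr => k _; apply: (congr1 (mule (c k)%:E)); rewrite NpowE; apply: ae_eq_integral => //.
- exact: (measurableT_comp mg (pieces_map P k)).
- exact: (measurable_normc_powR p (ev_measurable (w k))).
- by apply: aeS (pieces_mapK P k) => x [-> ->].
Qed.

Lemma inLp_assemble (w : nat -> E) : summable_pieces w ->
  inLp mu p (fun y => ev (w (idx y)) (pos y)).
Proof. by move=> sw; split; [exact: cmeasurable_assemble|rewrite assemble_integral]. Qed.

Lemma Npow_assemble (w : nat -> E) : summable_pieces w ->
  Npow (assemble w) = (\sum_(0 <= k <oo) (c k)%:E * Npow (w k))%E.
Proof. by move=> sw; rewrite Npow_mkLp ?assemble_integral//; exact: inLp_assemble. Qed.

Lemma assembleK (w : nat -> E) k : summable_pieces w -> piece k (assemble w) = w k.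
Proof.
move=> sw; apply: CLp_ext.
apply: aeS (aeI (ev_piece k (assemble w)) (aeI (ae_map k (ev_mkLp p1 (inLp_assemble sw)))
  (pieces_mapK P k))).
by move=> x [-> [-> [-> ->]]].
Qed.

Lemma piece_lin k (a : C) u u' : piece k (a *: u + u') = a *: piece k u + piece k u'.
Proof.
rewrite /piece -(mkLp_lin p1 a (inLp_piece k u) (inLp_piece k u')).
apply: mkLp_eq; [exact: inLp_piece| |].
  exact: (inLp_lin p1 a (inLp_piece k u) (inLp_piece k u')).
apply: (ae_map k (Q := fun x => ev (a *: u + u') x = a * ev u x + ev u' x)).
by apply: aeS (aeI (evD (a *: u) u') (evZ a u)) => x [-> ->].
Qed.

(** Identities between elements can be checked piece by piece; linearity and surjectivity of the
    tower are proved in this way. *)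
Lemma piece_inj u u' : (forall k, piece k u = piece k u') -> u = u'.
Proof.
move=> uu'; apply: CLp_ext; apply: ae_pieces => k.
have h := ev_piece k u; rewrite uu' in h.
by apply: aeS (aeI h (ev_piece k u')) => x [-> <-].
Qed.

Lemma piece_nonneg k u : CLp_nonneg u -> CLp_nonneg (piece k u).
Proof.
move=> /CLp_nonnegE u0; apply/CLp_nonnegE.
by apply: aeS (aeI (ev_piece k u) (ae_map k u0)) => x [->].
Qed.

Lemma assemble_nonneg (w : nat -> E) : summable_pieces w ->
  (forall k, CLp_nonneg (w k)) -> CLp_nonneg (assemble w).
Proof.
move=> sw w0; apply/CLp_nonnegE; apply: ae_pieces => k.
have h := ev_piece k (assemble w); rewrite (assembleK k sw) in h.
by apply: aeS (aeI h ((CLp_nonnegE _).1 (w0 k))) => x [<-].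
Qed.

End assemble.

Section operator_of_isometry.
Context d (T : measurableType d) (R : realType).
Variables (mu : {measure set T -> \bar R}) (p : R) (p1 : 1 <= p).
Local Notation C := (R[i]).
Local Notation E := (CLp mu p1).
Implicit Types (u v : E).

Lemma Npow_scale (a : R) u : 0 <= a ->
  Npow (a%:C%C *: u) = ((a `^ p)%:E * Npow u)%E.
Proof.
move=> a0; rewrite !NpowE -ge0_integralZl_EFin ?powR_ge0//; last 2 first.
- by move=> x _; rewrite lee_fin powR_ge0.
- exact: measurable_normc_powR (ev_measurable u).
apply: ae_eq_integral => //.
- exact: measurable_normc_powR (ev_measurable _).
- by apply: measurable_funeM; exact: measurable_normc_powR (ev_measurable u).
apply: aeS (evZ a%:C%C u) => x -> _.
by rewrite normcM normc_real ger0_norm// powRM ?normc_ge0// EFinM.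
Qed.

Lemma eq_norm_Npow u v : `|u| = `|v| -> Npow u = Npow v.
Proof.
move=> uv; have h1 := CLp_norm_le u v; have h2 := CLp_norm_le v u.
move: h1 h2; rewrite uv lexx => h1 h2.
by apply: le_anti; rewrite -h1 -h2.
Qed.

Lemma isometry_bound (f : E -> E) : (forall u, `|f u| = `|u|) ->
  forall u, `|u| <= 1 -> `|f u| <= 1.
Proof. by move=> iso u; rewrite iso. Qed.

Definition bop_of_isometry (f : E -> E) (lin : linear f) (iso : forall u, `|f u| = `|u|) : bop E :=
  let g : {linear E -> E} := HB.pack f (GRing.isLinear.Build _ _ _ _ _ lin) in
  @Bop _ _ g (linear_lipschitz_continuous (f := g) (M := 1)
    (isometry_bound iso)).

Lemma bop_of_isometryE f lin iso u : @bop_of_isometry f lin iso u = f u.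
Proof. by []. Qed.

End operator_of_isometry.

Lemma nneseries_reindex (R : realType) (s s' : nat -> nat) (u : (\bar R)^nat) :
  cancel s s' -> cancel s' s -> (forall k, 0 <= u k)%E ->
  (\sum_(0 <= k <oo) u (s k) = \sum_(0 <= k <oo) u k)%E.
Proof.
move=> sK s'K u0; rewrite !nneseries_esumT// [RHS](@reindex_esum _ _ _ setT setT s)//.
split => //; first by move=> x y _ _ /(can_inj sK).
by move=> y _; exists (s' y).
Qed.

Section tower.
Context d (T : measurableType d) (R : realType).
Variables (mu : {measure set T -> \bar R}) (p : R) (p1 : 1 <= p).
Local Notation C := (R[i]).
Local Notation E := (CLp mu p1).
Variables (c : nat -> R) (idx : T -> nat) (pos : T -> T) (map : nat -> T -> T).
Hypothesis P : pieces mu c idx pos map.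
Variables (s s' : nat -> nat).
Hypotheses (sK : cancel s s') (s'K : cancel s' s).
Variable S : bop E.
Hypothesis S_iso : bop_isometry S.
Implicit Types (u v : E).
Local Notation piece := (piece map).
Local Notation assemble := (@assemble _ _ _ mu p p1 idx pos).
Local Notation summable_pieces := (summable_pieces c).

Let p0 : 0 < p. Proof. exact: lt_le_trans p1. Qed.
Let c0 k : 0 < c k. Proof. exact: pieces_gt0 P k. Qed.

Definition tower_coef k : R := (c (s' k) / c k) `^ p^-1.

Lemma tower_coef_gt0 k : 0 < tower_coef k.
Proof. by rewrite powR_gt0// divr_gt0. Qed.

Lemma tower_coef_powR k : c k * tower_coef k `^ p = c (s' k).
Proof.
rewrite powR_invK ?gt_eqF//; last by rewrite divr_ge0// ltW.
by rewrite mulrC divfK// gt_eqF.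
Qed.

Definition tower_pieces u k : E := (tower_coef k)%:C%C *: S (piece (s' k) u).

(* S acts on all the pieces, which are shifted along [s]; the coefficients compensate
   for the change of mass. *)
Definition tower_fun u : E := assemble (tower_pieces u).

Lemma tower_sum u :
  (\sum_(0 <= k <oo) (c k)%:E * Npow (tower_pieces u k) = Npow u)%E.
Proof.
rewrite [RHS](Npow_pieces P u).
rewrite -[RHS](@nneseries_reindex _ _ _ (fun k => (c k)%:E * Npow (piece k u))%E s'K sK); last first.
  by move=> k; rewrite mule_ge0 ?Npow_ge0// lee_fin ltW.
apply: eq_eseriesr => k _; rewrite Npow_scale ?(ltW (tower_coef_gt0 k))//.
by rewrite muleA -EFinM tower_coef_powR (eq_norm_Npow (S_iso _)).
Qed.

Lemma summable_tower u : summable_pieces (tower_pieces u).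
Proof. by rewrite /summable_pieces tower_sum; exact: Npow_lty. Qed.

Lemma piece_tower k u : piece k (tower_fun u) = tower_pieces u k.
Proof. exact: (assembleK P k (summable_tower u)). Qed.

Lemma tower_linear : linear tower_fun.
Proof.
move=> a u v; apply: (piece_inj P) => k; rewrite (piece_lin P) !piece_tower.
rewrite /tower_pieces (piece_lin P) linearP scalerDr; congr (_ + _).
by rewrite !scalerA mulrC.
Qed.

Lemma tower_isometry u : `|tower_fun u| = `|u|.
Proof.
by apply: CLp_norm_eq; rewrite (Npow_assemble P (summable_tower u)) tower_sum.
Qed.

Definition tower : bop E := bop_of_isometry tower_linear tower_isometry.

Lemma towerE u : tower u = tower_fun u. Proof. by []. Qed.

Lemma tower_positive : positive_op S -> positive_op tower.
Proof.
move=> S0 u u0; rewrite towerE; apply: (assemble_nonneg P (summable_tower u)) => k.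
have := S0 _ (piece_nonneg P (s' k) u0) => /CLp_nonnegE h.
apply/CLp_nonnegE; apply: aeS (aeI (evZ (tower_coef k)%:C%C (S (piece (s' k) u))) h).
by move=> x [-> h0]; rewrite mulr_ge0// ler0c ltW// tower_coef_gt0.
Qed.

(** The preimage is assembled from the S-preimages of the shifted and rescaled pieces of v. As S is
    isometric, its pieces have the same total mass as those of v, hence are summable. *)
Lemma tower_surjective : range S = [set: E] -> range tower = [set: E].
Proof.
move=> Sr; apply/seteqP; split => // v _.
have /choice [inv invE] u : exists x, S x = u.
  have : range S u by rewrite Sr.
  by move=> [x _ <-]; exists x.
have invN u : Npow (inv u) = Npow u by apply: eq_norm_Npow; rewrite -(S_iso (inv u)) invE.
pose w k := inv (((tower_coef (s k))^-1)%:C%C *: piece (s k) v).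
have sw : summable_pieces w.
  apply: le_lt_trans (Npow_lty v); rewrite (Npow_pieces P v).
  rewrite -[leRHS](@nneseries_reindex _ _ _ (fun k => (c k)%:E * Npow (piece k v))%E sK s'K); last first.
    by move=> k; rewrite mule_ge0 ?Npow_ge0// lee_fin ltW.
  rewrite le_eqVlt; apply/orP; left; apply/eqP; apply: eq_eseriesr => k _.
  rewrite invN Npow_scale ?invr_ge0 ?(ltW (tower_coef_gt0 _))// muleA -EFinM.
  congr (_%:E * _)%E; have := tower_coef_powR (s k); rewrite sK => <-.
  rewrite -mulrA -powRM ?invr_ge0 ?(ltW (tower_coef_gt0 _))//.
  by rewrite mulfV ?gt_eqF ?tower_coef_gt0// powR1 mulr1.
exists (assemble w) => //; rewrite towerE; apply: (piece_inj P) => k.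
rewrite piece_tower /tower_pieces (assembleK P _ sw) /w invE s'K scalerA.
by rewrite -rmorphM mulfV ?gt_eqF ?tower_coef_gt0// rmorph1 scale1r.
Qed.

(** The coefficients telescope along the orbit of k, and only the ratio of the first mass to the
    last one remains. *)
Lemma piece_iter_tower n k u : exists a : R, [/\ 0 < a, a `^ p = c k / c (iter n s k) &
  piece (iter n s k) (iter n tower u) = a%:C%C *: iter n S (piece k u)].
Proof.
elim: n => [|n [a [a0 ap ih]]].
  by exists 1; rewrite powR1 divff ?gt_eqF// rmorph1 scale1r.
exists (tower_coef (iter n.+1 s k) * a); split.
- by rewrite mulr_gt0// tower_coef_gt0.
- rewrite powRM ?(ltW a0) ?(ltW (tower_coef_gt0 _))// ap.
  rewrite /tower_coef powR_invK ?gt_eqF//; last by rewrite divr_ge0// ltW.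
  rewrite iterS sK; field; rewrite ?gt_eqF//.
rewrite [iter n.+1 tower u]iterS towerE piece_tower /tower_pieces.
by rewrite iterS sK ih linearZ/= scalerA rmorphM.
Qed.

End tower.

Lemma nneseries_finite (R : realType) (n : nat) (u : (\bar R)^nat) :
  (forall k, 0 <= u k)%E -> (forall k, (n <= k)%N -> u k = 0%E) ->
  (\sum_(0 <= k <oo) u k = \sum_(0 <= k < n) u k)%E.
Proof.
move=> u0 un; rewrite (@nneseries_split _ u 0 n); last by move=> k _; exact: u0.
by rewrite add0n [X in (_ + X)%E]eseries0 ?adde0// => k nk _; exact: un.
Qed.

(** * Dyadic cells and their subdivision *)

Section cells.
Context (R : realType).
Implicit Types (c : nat -> R) (t x y : R) (k n : nat).
Local Notation mu := (lebesgue01 R).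
Local Notation T := (measurableTypeR R).

Definition unif (N : nat) k : R := if (k < N)%N then N%:R^-1 else 0.

Lemma series_unif N k : (k <= N)%N -> series (unif N) k = k%:R / N%:R.
Proof.
elim: k => [|k ih] kN; first by rewrite /series/= big_geq// mul0r.
by rewrite series_S ih 1?ltnW// /unif kN -[in RHS]natr1 mulrDl mul1r.
Qed.

Lemma series_finite c n k : (forall i, (n <= i)%N -> c i = 0) -> (n <= k)%N ->
  series c k = series c n.
Proof.
move=> cn; elim: k => [|k ih]; first by rewrite leqn0 => /eqP ->.
rewrite leq_eqVlt => /orP[/eqP -> //|nk].
by rewrite series_S ih// cn// addr0.
Qed.

Lemma prob_seq_finite c n : (forall i, 0 <= c i) -> (forall i, (n <= i)%N -> c i = 0) ->
  series c n = 1 -> prob_seq c.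
Proof.
move=> c0 cn c1; split => //; apply: cvg_near_cst.
by exists n => // k /= nk; rewrite (series_finite cn nk).
Qed.

Lemma unif_ge0 N k : 0 <= unif N k.
Proof. by rewrite /unif; case: ifP => // _; rewrite invr_ge0. Qed.

Lemma unif_out N k : (N <= k)%N -> unif N k = 0.
Proof. by rewrite /unif ltnNge => ->. Qed.

Lemma unif_prob N : (0 < N)%N -> prob_seq (unif N).
Proof.
move=> N0; apply: (@prob_seq_finite _ N); [exact: unif_ge0|exact: unif_out|].
by rewrite series_unif// divff// pnatr_eq0 -lt0n.
Qed.

Lemma unif_gt0 N k : (k < N)%N -> 0 < unif N k.
Proof. by move=> kN; rewrite /unif kN invr_gt0 ltr0n (leq_trans _ kN). Qed.

Lemma splitting_integral_finite c n (h : T -> \bar R) : prob_seq c ->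
  (forall i, (n <= i)%N -> c i = 0) -> measurable_fun setT h ->
  (forall x, 0 <= h x)%E ->
  (\int[mu]_x h x = \sum_(0 <= k < n) (c k)%:E * \int[mu]_x h (piece_map c k x))%E.
Proof.
move=> cp cn mh h0; rewrite (splitting_integral cp mh h0) (@nneseries_finite _ n)//.
  by move=> k; rewrite mule_ge0 ?integral_ge0// lee_fin cp.1.
by move=> k nk; rewrite cn// mul0e.
Qed.

Definition cell N y : nat := piece_idx (unif N) y.

Lemma cell_lt N y : (0 < N)%N -> 0 <= y < 1 -> (cell N y < N)%N.
Proof.
move=> N0 y01; have := piece_pos_gt0 (unif_prob N0) y01.
by rewrite /unif -/(cell N y); case: ifP => //; rewrite ltxx.
Qed.

Lemma cellP N y i : (i < N)%N -> i%:R / N%:R <= y < i.+1%:R / N%:R -> cell N y = i.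
Proof.
move=> iN h; apply: (piece_idxE (unif_prob (leq_trans _ iN))) => //.
by rewrite !series_unif// ltnW.
Qed.

Lemma cell_bounds N y : (0 < N)%N -> 0 <= y < 1 ->
  (cell N y)%:R / N%:R <= y < (cell N y).+1%:R / N%:R.
Proof.
move=> N0 y01; have yN := cell_lt N0 y01.
have := piece_idxP (unif_prob N0) y01.
by rewrite -/(cell N y) !series_unif// ltnW.
Qed.

Lemma measurable_cell N k : (0 < N)%N -> measurable [set y : T | cell N y = k].
Proof. by move=> N0; exact: measurable_piece_idx (unif_prob N0) k. Qed.

Section cell_pieces.
Variables (N : nat) (c : nat -> R).
Hypotheses (N0 : (0 < N)%N) (c_prob : prob_seq c) (c_gt0 : forall k, 0 < c k).
Local Notation U := (unif N).
Let Up : prob_seq U. Proof. exact: unif_prob. Qed.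

(** Every cell is subdivided in the proportions c, and the k-th piece gathers the k-th part of all
    cells. Thus [cell_piece_map k] never leaves a cell, and functions constant on cells coincide
    with each of their pieces. *)
Definition cell_piece_idx (y : T) : nat := piece_idx c (piece_pos U y).
Definition cell_piece_pos (y : T) : T :=
  piece_map U (cell N y) (piece_pos c (piece_pos U y)).
Definition cell_piece_map k (x : T) : T :=
  piece_map U (cell N x) (piece_map c k (piece_pos U x)).

Lemma measurable_cell_piece_map k : measurable_fun setT (cell_piece_map k).
Proof.
apply: (measurable_assemble (f := fun i x => piece_map U i (piece_map c k (piece_pos U x)))).
  by move=> i; exact: measurable_cell.
move=> i; apply: (measurableT_comp (measurable_piece_map U i)).
apply: (measurableT_comp (measurable_piece_map c k)).
exact: measurable_piece_pos Up.
Qed.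

Lemma measurable_cell_piece_pos : measurable_fun setT cell_piece_pos.
Proof.
apply: (measurable_assemble (f := fun i x => piece_map U i (piece_pos c (piece_pos U x)))).
  by move=> i; exact: measurable_cell.
move=> i; apply: (measurableT_comp (measurable_piece_map U i)).
apply: (measurableT_comp (measurable_piece_pos c_prob)).
exact: measurable_piece_pos Up.
Qed.

Lemma cell_gt0 y : 0 <= y < 1 -> 0 < U (cell N y).
Proof. by move=> y01; apply: unif_gt0; exact: cell_lt. Qed.

Lemma cell_piece_map_cell k x : 0 <= x < 1 -> cell N (cell_piece_map k x) = cell N x.
Proof.
move=> x01; apply: (piece_map_idx Up (cell_gt0 x01)).
by apply: (piece_map01 c_prob) => //; exact: (piece_posP Up).
Qed.

Lemma cell_pieces : pieces mu c cell_piece_idx cell_piece_pos cell_piece_map.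
Proof.
split.
- exact: c_gt0.
- move=> k; rewrite -[X in measurable X]setTI.
  rewrite (_ : [set y | cell_piece_idx y = k] = (piece_pos U : T -> T) @^-1` [set t : T | piece_idx c t = k])//.
  exact: (measurable_piece_pos Up measurableT (measurable_piece_idx c_prob k)).
- exact: measurable_cell_piece_pos.
- exact: measurable_cell_piece_map.
(* The integral splits over cells and then over the parts of a cell; exchanging the finite sum with
   the series gathers the k-th parts. *)
- move=> h mh h0.
  have e k : (\int[mu]_x h (cell_piece_map k x) = \sum_(0 <= i < N)
     (U i)%:E * \int[mu]_x h (piece_map U i (piece_map c k x)))%E.
    rewrite (splitting_integral_finite Up (@unif_out N)); last 2 first.
    - exact: (measurableT_comp mh (measurable_cell_piece_map k)).
    - by move=> x; exact: h0.
    apply: eq_big_nat => i /andP[_ iN]; apply: (congr1 (mule (U i)%:E)).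
    apply: ae_eq_integral => //.
    - apply: (measurableT_comp mh).
      exact: (measurableT_comp (measurable_cell_piece_map k) (measurable_piece_map U i)).
    - apply: (measurableT_comp mh).
      exact: (measurableT_comp (measurable_piece_map U i) (measurable_piece_map c k)).
    apply: aeS (lebesgue01_ae R) => x x01 _.
    by rewrite /cell_piece_map /cell (piece_map_idx Up (unif_gt0 iN) x01)
      (piece_map_pos Up (unif_gt0 iN) x01).
  rewrite (splitting_integral_finite Up (@unif_out N) mh h0).
  transitivity (\sum_(0 <= i < N) \sum_(0 <= k <oo) (U i)%:E * ((c k)%:E *
      \int[mu]_x h (piece_map U i (piece_map c k x))))%E.
    apply: eq_bigr => i _.
    rewrite nneseriesZl; last first.
      by move=> k _; rewrite mule_ge0 ?integral_ge0// lee_fin ltW.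
    apply: (congr1 (mule (U i)%:E)); apply: (splitting_integral c_prob) => //.
    exact: (measurableT_comp mh (measurable_piece_map U i)).
  rewrite -nneseries_sum_nat; last first.
    move=> i k; rewrite mule_ge0 ?lee_fin ?unif_ge0// mule_ge0 ?integral_ge0//.
    by rewrite lee_fin ltW.
  apply: eq_eseriesr => k _; rewrite e ge0_sume_distrr.
    by apply: eq_bigr => i _; rewrite muleCA.
  by move=> i _; rewrite mule_ge0 ?integral_ge0// lee_fin unif_ge0.
- move=> k; apply: aeS (lebesgue01_ae R) => x x01.
  have h1 := piece_posP Up x01. have h2 := piece_map01 c_prob (c_gt0 k) h1.
  rewrite /cell_piece_idx /cell_piece_pos /cell_piece_map.
  rewrite /cell (piece_map_pos Up (cell_gt0 x01) h2) (piece_map_idx c_prob (c_gt0 k) h1).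
  rewrite (piece_map_idx Up (cell_gt0 x01) h2) (piece_map_pos c_prob (c_gt0 k) h1).
  by rewrite (piece_posK Up x01).
- apply: aeS (lebesgue01_ae R) => y y01.
  have h1 := piece_posP Up y01. have h2 := piece_posP c_prob h1.
  rewrite /cell_piece_idx /cell_piece_pos /cell_piece_map.
  rewrite /cell (piece_map_idx Up (cell_gt0 y01) h2) (piece_map_pos Up (cell_gt0 y01) h2).
  by rewrite (piece_posK c_prob h1) (piece_posK Up y01).
Qed.

End cell_pieces.
End cells.

(** * The shift of the integers and geometric weights *)

Section shift.

(* The integers are encoded by naturals, [2m] standing for [m] and [2m+1] for
   [-(m+1)], so that [uphalf] is the absolute value; [zshift] is the successor. *)
Definition zshift k := match k with
  | 0 => 2 | 1 => 0 | k'.+2 => if odd k' then k' else k'.+4 end.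

Definition zunshift k := match k with
  | 0 => 1 | 1 => 3 | k'.+2 => if odd k' then k'.+4 else k' end.

Lemma zshiftK : cancel zshift zunshift.
Proof.
case=> [|[|k]] //; rewrite /zshift; case: ifP => ok.
  by case: k ok => [|[|k]] //; rewrite /zunshift /= negbK => ->.
by rewrite /zunshift /= ok.
Qed.

Lemma zunshiftK : cancel zunshift zshift.
Proof.
case=> [|[|k]] //; rewrite /zunshift; case: ifP => ok; first by rewrite /zshift /= ok.
by case: k ok => [|[|k]] //; rewrite /zshift /= negbK => ->.
Qed.

Definition zval k : int := if odd k then - (uphalf k)%:Z else (uphalf k)%:Z.

Lemma zval_zshift k : zval (zshift k) = zval k + 1.
Proof.
case: k => [|[|k]] //; rewrite /zshift; case: ifP => ok.
  by rewrite /zval /= negbK ok; lia.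
by rewrite /zval /= !negbK ok; lia.
Qed.

End shift.

Lemma zval_iter n k : zval (iter n zshift k) = zval k + n%:Z.
Proof.
elim: n => [|n ih]; first by rewrite addr0.
by rewrite iterS zval_zshift ih; lia.
Qed.

(** The triangle inequality for the integers coded by k and by its n-th shift, which differ by n. *)
Lemma uphalf_iter_zshift n k : (n <= uphalf k + uphalf (iter n zshift k))%N.
Proof. by have := zval_iter n k; rewrite /zval; case: ifP; case: ifP; lia. Qed.

Section weights.
Context (R : realType).
Implicit Types (r : R) (n k : nat).

(** The two-sided geometric law, proportional to r^|m| on the integers m; the factor (1 - r) / (1 +
    r) normalises it. *)
Definition wgt r k : R := (1 - r) / (1 + r) * r ^+ uphalf k.

Lemma wgt_gt0 r k : 0 < r < 1 -> 0 < wgt r k.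
Proof.
by move=> /andP[r0 r1]; rewrite mulr_gt0 ?exprn_gt0// divr_gt0 ?subr_gt0// addr_gt0.
Qed.

Lemma series_wgt r n : 0 < r < 1 ->
  series (wgt r) n = 1 - (r ^+ uphalf n + r ^+ uphalf n.+1) / (1 + r).
Proof.
move=> /andP[r0 r1]; have r1' : 1 + r != 0 by rewrite gt_eqF// addr_gt0.
elim: n => [|n ih]; first by rewrite /series/= big_geq// expr0 expr1 divff// subrr.
rewrite series_S ih /wgt (_ : uphalf n.+2 = (uphalf n).+1)// exprS.
by field.
Qed.

Lemma cvg_expr_uphalf r : 0 < r < 1 -> (fun n => r ^+ uphalf n) @ \oo --> (0 : R).
Proof.
move=> /andP[r0 r1]; have h : `|r| < 1 by rewrite gtr0_norm.
have /cvgrPdist_lt hr := cvg_expr h.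
apply/cvgrPdist_lt => e e0; have [N _ hN] := hr _ e0.
exists N.*2 => // n /= Nn; apply: hN => /=.
by rewrite -(doubleK N) uphalf_half -leq_double; have := odd_double_half n; lia.
Qed.

Lemma wgt_prob r : 0 < r < 1 -> prob_seq (wgt r).
Proof.
move=> r01; split; first by move=> k; exact/ltW/wgt_gt0.
rewrite (_ : series (wgt r) = fun n => 1 - (r ^+ uphalf n + r ^+ uphalf n.+1) / (1 + r)); last first.
  by apply/funext => n; exact: series_wgt.
rewrite -[X in _ --> X]subr0; apply: cvgB; first exact: cvg_cst.
rewrite -(mul0r (1 + r)^-1) -[X in X * _]addr0; apply: cvgMl.
apply: cvgD; first exact: cvg_expr_uphalf.
have h := cvg_expr_uphalf r01.
by move: h; rewrite -(cvg_shiftS (fun n => r ^+ uphalf n)).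
Qed.

Lemma prob_nneseries (c : nat -> R) : prob_seq c -> (\sum_(0 <= k <oo) (c k)%:E = 1)%E.
Proof.
move=> [c0 c1]; apply/cvg_lim => //.
rewrite (_ : (fun n => _) = EFin \o series c); last first.
  by apply/funext => n /=; rewrite /series/= sumEFin.
by apply: cvg_EFin => //; exact: nearW.
Qed.

Lemma wgt_ratio r k : 0 < r < 1 ->
  wgt r (zunshift k) / wgt r k = r \/ wgt r (zunshift k) / wgt r k = r^-1.
Proof.
move=> /andP[r0 r1].
have key a b : wgt r a / wgt r b = r ^+ uphalf a / r ^+ uphalf b.
  have h1 : 1 - r != 0 by rewrite gt_eqF// subr_gt0.
  have h2 : 1 + r != 0 by rewrite gt_eqF// addr_gt0.
  have h3 : r ^+ uphalf b != 0 by rewrite expf_neq0// gt_eqF.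
  by rewrite /wgt; field; rewrite h1 h2 h3.
have rn0 : r != 0 by rewrite gt_eqF.
rewrite key; case: k => [|[|k]]; rewrite /zunshift.
- by left; rewrite expr0 divr1 expr1.
- by left; rewrite /= exprS expr1 mulfK.
case: ifP => ok.
  left; rewrite (_ : uphalf k.+4 = (uphalf k.+2).+1)// exprS mulfK//.
  by rewrite expf_neq0.
right; rewrite (_ : uphalf k.+2 = (uphalf k).+1)// exprS invfM mulrCA divff ?mulr1//.
by rewrite expf_neq0.
Qed.

End weights.

Lemma iter_cancel (A : Type) (f g : A -> A) n : cancel f g -> cancel (iter n f) (iter n g).
Proof. by move=> fK; elim: n => [|n ih] x //; rewrite iterSr iterS fK ih. Qed.

Lemma powR_expr (R : realType) (a q : R) n : 0 <= a -> (a ^+ n) `^ q = (a `^ q) ^+ n.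
Proof.
move=> a0; elim: n => [|n ih]; first by rewrite !expr0 powR1.
by rewrite !exprS powRM ?exprn_ge0// ih.
Qed.

Lemma double_exponent_le (n a b : nat) : (n <= a + b)%N -> (n + a <= 2 * (b + a))%N.
Proof. lia. Qed.

Section tower_concentrates.
Context (R : realType) (p : R) (p1 : 1 <= p).
Hypothesis p_gt1 : 1 < p.
Local Notation mu := (lebesgue01 R).
Local Notation C := (R[i]).
Local Notation E := (CLp mu p1).
Local Notation rl := (rl mu p1).
Local Notation rLp := (rLp mu p).
Local Notation one := (oneLp mu p1).
Variables (N : nat) (al : R).
Hypotheses (N0 : (0 < N)%N) (al01 : 0 < al < 1).
Variable S : bop E.
Hypotheses (S_pos : positive_op S) (S_iso : bop_isometry S).

Let p0 : 0 < p. Proof. exact: lt_le_trans p1. Qed.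
Let mu1 : mu setT = 1%E. Proof. exact: lebesgue01_setT. Qed.
(** With this rate neighbouring masses have ratio al^p or its inverse, so the coefficients of the
    tower are exactly al or 1 / al. *)
Let r := al `^ p.
Let r01 : 0 < r < 1.
Proof.
move: al01 => /andP[a0 a1]; rewrite powR_gt0//=.
have e : (1 : R) `^ p = 1 by rewrite powR1.
by rewrite -[ltRHS]e powR_lt// ltW.
Qed.
Local Notation c := (wgt r).
Let c_gt0 k : 0 < c k. Proof. exact: wgt_gt0. Qed.
Let P := cell_pieces N0 (wgt_prob r01) c_gt0.

Definition cell_tower : bop E := tower P zshiftK zunshiftK S_iso.

Lemma cell_tower_positive : positive_op cell_tower.
Proof. exact: tower_positive. Qed.

Lemma cell_tower_isometry : bop_isometry cell_tower.
Proof. by move=> u; exact: (tower_isometry P zshiftK zunshiftK S_iso u). Qed.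

Lemma piece_oneLp k : piece (cell_piece_map N c) k one = one.
Proof.
apply: CLp_ext; have h := ev_rl p1 (rLp_cst p1 mu1 1).
by apply: aeS (aeI (ev_piece P k one) (aeI (ae_map P k h) h)) => x [-> [-> ->]].
Qed.

(** This is al^(p - 1), which is less than 1 because p > 1. *)
Let be := r / al.
Let al0 : 0 < al. Proof. by case/andP: al01. Qed.
Let r0 : 0 < r. Proof. by case/andP: r01. Qed.
Let be01 : 0 < be < 1.
Proof.
rewrite divr_gt0//= ltr_pdivrMr// mul1r.
move: (al01) => /andP[a0 a1]; rewrite /r.
rewrite -(powR_pred_mul p_gt1 (ltW a0)) gtr_pMl//.
have e : (1 : R) `^ (p - 1) = 1 by rewrite powR1.
by rewrite -[ltRHS]e powR_lt ?subr_gt0// ltW.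
Qed.

Let x := Num.max al be.
Let x01 : 0 < x < 1.
Proof.
move: al01 be01 => /andP[a0 a1] /andP[b0 b1].
by rewrite lt_max a0 gt_max a1 b1.
Qed.
(** The square root shares the decay x^(u + u') between two uses: as 2(u + u') >= n + u, there is
    decay in the number n of steps and also summability over the pieces. *)
Let y := Num.sqrt x.
Let y01 : 0 < y < 1.
Proof.
move: x01 => /andP[x0 x1]; rewrite sqrtr_gt0 x0/=.
by rewrite -[ltRHS]sqrtr1 ltr_sqrt.
Qed.

(** The left side equals (1 - r) / (1 + r) * be^u' * al^u, where u and u' are the absolute values of
    the integers coded by k and its shift. The factor (1 + y) / (1 - y) cancels the normalisation
    inside [wgt y]. *)
Lemma tower_coef_bound n k (a : R) : 0 < a -> a `^ p = c k / c (iter n zshift k) ->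
  c (iter n zshift k) * a <= (1 - r) / (1 + r) * ((1 + y) / (1 - y)) * y ^+ n * wgt y k.
Proof.
move=> a0 ap; set k' := iter n zshift k in ap *.
set u := uphalf k; set u' := uphalf k'.
have Z0 : 0 < (1 - r) / (1 + r).
  by case/andP: r01 => ? ?; rewrite divr_gt0 ?subr_gt0 ?addr_gt0.
have nuu : (n <= u + u')%N by exact: uphalf_iter_zshift.
have aE : a = al ^+ u / al ^+ u'.
  have al_neq0 m : al ^+ m != 0 by rewrite expf_neq0// gt_eqF.
  apply: (mulIf (al_neq0 u')); rewrite divfK//.
  apply: (powR_injective p0); rewrite ?nnegrE ?mulr_ge0 ?exprn_ge0 ?(ltW al0) ?(ltW a0)//.
  rewrite powRM ?exprn_ge0 ?(ltW al0) ?(ltW a0)// ap !powR_expr ?(ltW al0)// -/r.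
  have h1 : 1 - r != 0 by rewrite gt_eqF// subr_gt0; case/andP: r01.
  have h2 : 1 + r != 0 by rewrite gt_eqF// addr_gt0.
  have h3 : r ^+ u' != 0 by rewrite expf_neq0// gt_eqF.
  by rewrite /wgt -/u -/u'; field; rewrite h1 h2 h3.
have -> : c k' * a = (1 - r) / (1 + r) * (be ^+ u' * al ^+ u).
  rewrite aE /wgt -/u' -!mulrA; congr (_ * (_ * _)).
  rewrite /be expr_div_n; field; rewrite expf_neq0// gt_eqF//.
have -> : (1 - r) / (1 + r) * ((1 + y) / (1 - y)) * y ^+ n * wgt y k =
    (1 - r) / (1 + r) * (y ^+ n * y ^+ u).
  case/andP: y01 => y0 y1; rewrite /wgt -/u.
  have h1 : 1 - y != 0 by rewrite gt_eqF// subr_gt0.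
  have h2 : 1 + y != 0 by rewrite gt_eqF// addr_gt0.
  set Z := (1 - r) / (1 + r); field; rewrite h1 h2//.
rewrite ler_pM2l//.
case/andP: x01 => x0 x1; case/andP: y01 => y0 y1.
apply: (@le_trans _ _ (x ^+ u' * x ^+ u)).
  apply: ler_pM; rewrite ?exprn_ge0// ?(ltW al0)//.
  - by case/andP: be01 => /ltW.
  - by apply: lerXn2r; rewrite ?nnegrE ?(ltW x0)//; [case/andP: be01 => /ltW|rewrite le_max lexx orbT].
  - by apply: lerXn2r; rewrite ?nnegrE ?(ltW x0) ?(ltW al0)// le_max lexx.
rewrite -!exprD -(sqr_sqrtr (ltW x0)) -/y -exprM.
apply: ler_wiXn2l; [exact: ltW|exact: ltW|exact: double_exponent_le].
Qed.

(** Every piece of 1 is 1, so each piece of the n-th iterate is a multiple of S^n 1, whose mean is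
    bounded independently of n by [pair_bound]. The masses times the coefficients are then summed by
    [tower_coef_bound]. *)
Lemma cell_tower_mean : exists K : R, forall n,
  `|mean (iter n cell_tower one)| <= (K * y ^+ n)%:C%C.
Proof.
have one0 : CLp_nonneg one by apply: rl_nonneg; [exact: rLp_cst|exact: aeW].
have w1 := @weight1 _ _ _ mu p p_gt1 mu1.
pose K0 := 2 * (1 + fine (\int[mu]_x (`|1 : R| `^ (p / (p - 1)))%:E)%E).
pose C0 := (1 - r) / (1 + r) * ((1 + y) / (1 - y)).
exists (C0 * K0) => n.
have [f [hf f0 fE]] := nonneg_rl (iter_positive n cell_tower_positive one0).
have [g [hg g0 gE]] := nonneg_rl (iter_positive n S_pos one0).
have [mg gy] := mean_rl p1 p_gt1 mu1 hg g0.
have [mf fy] := mean_rl p1 p_gt1 mu1 hf f0.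
have ig0 : (0 <= \int[mu]_x (g x)%:E)%E by apply: integral_ge0 => z _; rewrite lee_fin.
have gK : (\int[mu]_x (g x)%:E <= K0%:E)%E.
  have : `|mean (rl g)| <= K0%:C%C.
    apply: (pair_bound p_gt1 w1); rewrite -gE iter_isometry// norm_one//.
  by rewrite mg lecR -lee_fin fineK// ge0_fin_numE.
rewrite fE mf lecR -lee_fin fineK; last first.
  by rewrite ge0_fin_numE//; apply: integral_ge0 => z _; rewrite lee_fin.
have mEf : measurable_fun setT (fun z : measurableTypeR R => (f z)%:E).
  have mf' := rLp_meas hf; apply/measurable_EFinP; exact: mf'.
have Ef0 z : (0 <= (f z)%:E)%E by rewrite lee_fin.
have Eg0 z : (0 <= (g z)%:E)%E by rewrite lee_fin.
have mEg : measurable_fun setT (fun z : measurableTypeR R => (g z)%:E).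
  by have mg' := rLp_meas hg; apply/measurable_EFinP; exact: mg'.
rewrite (pieces_integral P mEf Ef0).
rewrite -(@nneseries_reindex _ _ _ (fun k => (c k)%:E * \int[mu]_z (f (cell_piece_map N c k z))%:E)%E
  (iter_cancel n zshiftK) (iter_cancel n zunshiftK)); last first.
  by move=> k; rewrite mule_ge0 ?integral_ge0// lee_fin ltW.
have -> : ((C0 * K0 * y ^+ n)%:E = \sum_(0 <= k <oo) (C0 * K0 * y ^+ n)%:E * (wgt y k)%:E)%E.
  rewrite nneseriesZl ?(prob_nneseries (wgt_prob y01)) ?mule1// => k _.
  by rewrite lee_fin ltW// wgt_gt0.
apply: lee_nneseries => [k _ _|k _].
  by rewrite mule_ge0 ?integral_ge0// lee_fin ltW.
set k' := iter n zshift k.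
have [a [a0 ap aE]] := piece_iter_tower P zshiftK zunshiftK S_iso n k one.
have ea : {ae mu, forall z, f (cell_piece_map N c k' z) = a * g z}.
  have h1 := ev_piece P k' (iter n cell_tower one).
  rewrite [piece _ _ _]aE piece_oneLp gE in h1.
  have h2 := ae_map P k' (ev_rl p1 hf).
  have h3 := aeI (evZ a%:C%C (rl g)) (ev_rl p1 hg).
  apply: aeS (aeI h1 (aeI h2 h3)) => z [e1 [e2 [e3 e4]]].
  apply: complexI; rewrite fE in e1.
  have -> : (a * g z)%:C%C = a%:C%C * (g z)%:C%C by rewrite rmorphM.
  by rewrite -e4 -e3 e1 e2.
have -> : (\int[mu]_z (f (cell_piece_map N c k' z))%:E = a%:E * \int[mu]_z (g z)%:E)%E.
  rewrite -(ge0_integralZl_EFin mu measurableT (fun z _ => Eg0 z) mEg (ltW a0)).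
  apply: ae_eq_integral => //.
  - exact: (measurableT_comp mEf (pieces_map P k')).
  - exact: measurable_funeM mEg.
  by apply: aeS ea => z -> _; rewrite EFinM.
rewrite muleA -EFinM -EFinM.
have cb := tower_coef_bound a0 ap.
apply: (@le_trans _ _ ((c k' * a)%:E * K0%:E)%E).
  by apply: lee_wpmul2l => //; rewrite lee_fin mulr_ge0// ltW.
have K00 : 0 <= K0 by move: (le_trans ig0 gK); rewrite lee_fin.
rewrite -EFinM lee_fin.
apply: le_trans (ler_wpM2r K00 cb) _.
by rewrite -/C0 le_eqVlt; apply/orP; left; apply/eqP; ring.
Qed.

Lemma cell_tower_concentrates k : concentrates k cell_tower.
Proof.
have [K hK] := cell_tower_mean.
have y1 : `|y| < 1 by case/andP: y01 => y0 y1; rewrite gtr0_norm.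
have e0 : 0 < 1 / (2 ^ (k + 1))%:R :> R by rewrite divr_gt0// ltr0n expn_gt0.
have /cvgrPdist_lt/(_ _ e0)[n _ /(_ n (leqnn n))/=] := @cvg_geometric R K y y1.
rewrite sub0r normrN => hn; exists n; split.
  by apply: le_lt_trans (hK n) _; rewrite ltcR (le_lt_trans (ler_norm _)).
rewrite iter_isometry ?norm_one//; last exact: cell_tower_isometry.
rewrite -[ltRHS](rmorph1 (real_complex R)) ltcR; lra.
Qed.

End tower_concentrates.

(** * Strong density *)

Section dominated.
Context d (T : measurableType d) (R : realType).
Variables (mu : {measure set T -> \bar R}) (p : R) (p1 : 1 <= p).
Local Notation rl := (rl mu p1).
Local Notation rLp := (rLp mu p).
Let p0 : 0 < p. Proof. exact: lt_le_trans p1. Qed.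

Lemma integrable_normr_powR (g : T -> R) : rLp g ->
  mu.-integrable setT (fun x => (`|g x| `^ p)%:E).
Proof.
move=> hg; apply/integrableP; split; first exact: measurable_normr_powR (rLp_meas hg).
under eq_integral do rewrite gee0_abs ?lee_fin ?powR_ge0//.
exact: rLp_fin hg.
Qed.

Lemma rl_dominated (h g : T -> R) (f : nat -> T -> R) (e : R) : 0 < e -> rLp g ->
  measurable_fun setT h -> (forall n, measurable_fun setT (f n)) ->
  (forall x, `|h x| <= g x) -> (forall n x, `|f n x| <= g x) ->
  {ae mu, forall x, f n x @[n --> \oo] --> h x} ->
  \forall n \near \oo, `|rl h - rl (f n)| < e%:C%C.
Proof.
move=> e0 hg mh mf hh hf fh.
have rh : rLp h by apply: rLp_le hg.
have rf n : rLp (f n) by apply: rLp_le hg.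
have rhf n : rLp (fun x => h x - f n x) by exact: rLpB.
(* The dominating function is (2 g)^p, with 2 g written in the shape provided by [rLp_lin]. *)
have r2g : rLp (fun x => 1 * g x + g x) by exact: (rLp_lin p1 1 hg hg).
have := @dominated_convergence _ _ _ mu setT measurableT
  (fun n x => (`|h x - f n x| `^ p)%:E) (fun=> 0%E) (fun x => (`|1 * g x + g x| `^ p)%:E).
case.
- by move=> n; exact: measurable_normr_powR (rLp_meas (rhf n)).
- exact: measurable_cst.
- apply: aeS fh => x fx _.
  apply/fine_cvgP; split; first exact: nearW.
  apply/cvgrPdist_lt => /= r r0.
  have rp : 0 < r `^ p^-1 by rewrite powR_gt0.
  have rE : (r `^ p^-1) `^ p = r by rewrite powR_invK// ?gt_eqF// ltW.
  move/cvgrPdist_lt : fx => /(_ _ rp); apply: filterS => n hn.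
  rewrite sub0r normrN ger0_norm ?powR_ge0// -rE.
  exact: powR_lt.
- exact: integrable_normr_powR.
- apply: aeW => x n _; rewrite gee0_abs ?lee_fin ?powR_ge0//.
  apply: powR_le; rewrite ?(ltW p0)// mul1r.
  have g0 : 0 <= g x by exact: le_trans (hh x).
  rewrite [leRHS]ger0_norm ?addr_ge0//.
  by apply: le_trans (ler_normB _ _) _; apply: lerD.
move=> _ _; rewrite integral0 => cv.
have ep : 0 < e `^ p by rewrite powR_gt0.
apply: filterS (cvge0_lt ep cv) => n hn.
by rewrite -rlB// CLp_norm_ltE ?(ltW e0)// Npow_rl.
Qed.

End dominated.

Section clamp.
Context (R : realType).
Implicit Types (M a b : R).

Definition clamp M a := Num.max (- M) (Num.min a M).

Lemma clamp_norm M a : 0 <= M -> `|clamp M a| <= M.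
Proof.
move=> M0; rewrite /clamp ler_norml le_max lexx/= ge_max ge_min lexx orbT andbT.
by rewrite (le_trans _ M0)// oppr_le0.
Qed.

Lemma clamp_id M a : `|a| <= M -> clamp M a = a.
Proof.
rewrite ler_norml => /andP[h1 h2].
by rewrite /clamp min_l// max_r.
Qed.

(** Clamping an approximation of a function bounded by M makes it bounded at no cost in the
    distance. *)
Lemma clamp_dist M a b : `|a| <= M -> `|a - clamp M b| <= `|a - b|.
Proof.
rewrite ler_norml => /andP[h1 h2].
have h3 : a - b <= `|a - b| by exact: ler_norm.
have h4 : b - a <= `|a - b| by rewrite -normrN opprB ler_norm.
rewrite ler_norml /clamp; have [bM|bM] := leP b M; last first.
  by rewrite max_r; lra.
by have [Mb|Mb] := leP (- M) b; lra.
Qed.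

Lemma clamp_lipschitz M a b : 0 <= M -> `|clamp M a - clamp M b| <= `|a - b|.
Proof.
move=> M0.
have h3 : a - b <= `|a - b| by exact: ler_norm.
have h4 : b - a <= `|a - b| by rewrite -normrN opprB ler_norm.
have h5 : 0 <= `|a - b| by [].
move: h3 h4 h5; set n := `|a - b|; move: n => n h3 h4 h5; rewrite ler_norml /clamp.
rewrite /Num.max /Num.min.
by case: (ltP a M) => ?; case: (ltP b M) => ?; case: ltP => ?; case: ltP => ?; lra.
Qed.

Lemma clamp_le M a : 0 <= M -> `|clamp M a| <= `|a|.
Proof.
move=> M0; have := @clamp_dist M 0 a; rewrite normr0 => /(_ M0).
by rewrite !sub0r !normrN.
Qed.

End clamp.

(** * Density of dyadic step functions *)

Section step_functions.
Context (R : realType) (p : R) (p1 : 1 <= p).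
Hypothesis p_gt1 : 1 < p.
Local Notation mu := (lebesgue01 R).
Local Notation T := (measurableTypeR R).
Local Notation C := (R[i]).
Local Notation E := (CLp mu p1).
Local Notation rl := (rl mu p1).
Local Notation rLp := (rLp mu p).
Implicit Types (u f : E).

Let mu1 : mu setT = 1%E. Proof. exact: lebesgue01_setT. Qed.
Let mu_lty : (mu setT < +oo)%E. Proof. by rewrite mu1 ltry. Qed.

Definition is_step N f := exists z : nat -> C, {ae mu, forall y, ev f y = z (cell N y)}.

(** Dyadic cells are nested, the coarser index being a quotient of the finer one; a step function
    thus remains one at all finer levels. *)
Lemma cell_expn2 m n (y : R) : 0 <= y < 1 -> cell (2 ^ m) y = (cell (2 ^ (m + n)) y %/ 2 ^ n)%N.
Proof.
move=> y01; have N0 k : (0 < 2 ^ k)%N by rewrite expn_gt0.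
have /andP[h1 h2] := cell_bounds (N0 (m + n)%N) y01.
have kN := cell_lt (N0 (m + n)%N) y01.
move: (cell (2 ^ (m + n)) y) h1 h2 kN => k h1 h2 kN.
have Nn0 : 0 < (2 ^ n)%:R :> R by rewrite ltr0n.
have Nm0 : 0 < (2 ^ m)%:R :> R by rewrite ltr0n.
apply: cellP.
  by rewrite ltn_divLR// -expnD.
move: h1 h2; rewrite expnD natrM ler_pdivrMr ?mulr_gt0// ltr_pdivlMr ?mulr_gt0// => h1 h2.
rewrite ler_pdivrMr// ltr_pdivlMr//; apply/andP; split.
  rewrite -(ler_pM2r Nn0) -mulrA; apply: le_trans h1.
  by rewrite -natrM ler_nat leq_trunc_div.
rewrite -(ltr_pM2r Nn0) -mulrA; apply: lt_le_trans h2 _.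
by rewrite -natrM ler_nat ltn_ceil.
Qed.

Lemma is_step_widen m n f : (m <= n)%N -> is_step (2 ^ m) f -> is_step (2 ^ n) f.
Proof.
move=> mn [z hz]; exists (fun k => z (k %/ 2 ^ (n - m))%N).
apply: aeS (aeI hz (lebesgue01_ae R)) => y [-> y01].
by rewrite (cell_expn2 m (n - m) y01) subnKC.
Qed.

Lemma is_step_lin N (a : C) f g : is_step N f -> is_step N g -> is_step N (a *: f + g).
Proof.
move=> [z hz] [w hw]; exists (fun k => a * z k + w k).
apply: aeS (aeI (aeI hz hw) (aeI (evD (a *: f) g) (evZ a f))) => y [[e1 e2] [-> ->]].
by rewrite e1 e2.
Qed.

Definition step_approx u := forall e : R, 0 < e ->
  exists m, exists2 f, is_step (2 ^ m) f & `|u - f| < e%:C%C.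

Lemma step_approxD (a : C) u v : step_approx u -> step_approx v -> step_approx (a *: u + v).
Proof.
move=> hu hv e e0.
pose b := normc a + 1.
have b0 : 0 < b by rewrite ltr_wpDl// normc_ge0.
have [m [f sf uf]] := hu (e / 2 / b) ltac:(by rewrite !divr_gt0).
have [n [g sg vg]] := hv (e / 2) ltac:(by rewrite divr_gt0).
exists (maxn m n), (a *: f + g).
  by apply: is_step_lin; [apply: is_step_widen sf|apply: is_step_widen sg]; rewrite leq_max leqnn ?orbT.
have -> : a *: u + v - (a *: f + g) = a *: (u - f) + (v - g).
  by rewrite scalerBr opprD addrACA.
apply: le_lt_trans (ler_normD _ _) _; rewrite (splitr e) -real_complexD; apply: ler_ltD => //.
rewrite normrZ normr_normc.
have [r rE] : exists r : R, `|u - f| = r%:C%C by rewrite CLp_normE; eexists.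
move: uf; rewrite rE ltcR => uf; rewrite -rmorphM lecR.
have r0 : 0 <= r by rewrite -lecR -rE normr_ge0.
move: uf; rewrite ltr_pdivlMr// => /ltW uf; apply: le_trans uf.
by rewrite mulrC ler_wpM2l// lerDl.
Qed.

Lemma step_approx_closure u : (forall e : R, 0 < e -> exists2 v, step_approx v & `|u - v| < e%:C%C) ->
  step_approx u.
Proof.
move=> h e e0; have e2 : 0 < e / 2 by rewrite divr_gt0.
have [v hv uv] := h _ e2; have [m [f sf vf]] := hv _ e2.
exists m, f => //; rewrite -(subrKA v) (splitr e) -real_complexD.
exact: le_lt_trans (ler_normD _ _) (ltrD uv vf).
Qed.

Lemma cvg_cell (y : R) : 0 <= y < 1 ->
  (cell (2 ^ m) y)%:R / (2 ^ m)%:R @[m --> \oo] --> y.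
Proof.
move=> y01; apply/cvgrPdist_lt => e e0.
have e2 : 0 < e / 2 by rewrite divr_gt0.
apply: filterS (half_pow_small e2) => m.
have N0 : (0 < 2 ^ m)%N by rewrite expn_gt0.
have Nm0 : 0 < (2 ^ m)%:R :> R by rewrite ltr0n.
have /andP[] := cell_bounds N0 y01; rewrite -natr1 mulrDl => h1 h2.
rewrite addn1 expnSr natrM invfM mulrA ltr_pM2r// => h3.
by rewrite ger0_norm ?subr_ge0// ltrBlDl (lt_trans h2)// ltrD2l.
Qed.

(** Sampling g at the left end of the dyadic cell converges pointwise by continuity, with the
    constant M as dominating function. *)
Lemma step_approx_continuous (g : R -> R) (M : R) : continuous g ->
  (forall x, `|g x| <= M) -> step_approx (rl g).
Proof.
move=> cg gM.
have mg : measurable_fun setT (g : T -> R) by exact: continuous_measurable_fun.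
pose f m (y : T) := g ((cell (2 ^ m) y)%:R / (2 ^ m)%:R).
have mf m : measurable_fun setT (f m).
  apply: (measurable_assemble (f := fun k _ => g (k%:R / (2 ^ m)%:R)) (idx := fun y : T => cell (2 ^ m) y)).
    by move=> k; apply: measurable_cell; rewrite expn_gt0.
  by move=> k; exact: measurable_cst.
have fg : {ae mu, forall y, f m y @[m --> \oo] --> g y}.
  apply: aeS (lebesgue01_ae R) => y y01.
  exact: (continuous_cvg _ (cg y) (cvg_cell y01)).
move=> e e0.
have rM : rLp (fun=> M) by exact: rLp_cst.
have := rl_dominated p1 e0 rM mg mf gM (fun m y => gM _) fg.
move=> [m _ /(_ m (leqnn m))/= hm]; exists m, (rl (f m)) => //.
have rf : rLp (f m) by apply: (rLp_le p1 (mf m) (fun y => gM _) rM).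
exists (fun k => (g (k%:R / (2 ^ m)%:R))%:C%C).
exact: ev_rl.
Qed.

Lemma lebesgue01_integral (h : T -> \bar R) : measurable_fun setT h -> (forall x, 0 <= h x)%E ->
  (\int[mu]_x h x = \int[@lebesgue_measure R]_(x in `[0%R, 1%R]) h x)%E.
Proof.
move=> mh h0; have mI : measurable (`[0%R, 1%R]%classic : set T) by exact: measurable_itv.
rewrite (@ge0_negligible_integral _ _ _ mu setT (~` `[0%R, 1%R]%classic))//; last 2 first.
- exact: measurableC.
- by rewrite /lebesgue01/= /mrestr setICl measure0.
rewrite setTD setCK; apply: eq_measure_integral => A mA AD.
by rewrite /lebesgue01/= /mrestr setIidl.
Qed.

(** Continuous functions approximate h in L^1; after clamping, the difference is bounded by 2 M, and
    L^1 approximation becomes L^p approximation. *)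
Lemma step_approx_bounded (h : T -> R) (M : R) : measurable_fun setT h ->
  (forall x, `|h x| <= M) -> step_approx (rl h).
Proof.
move=> mh hM; have M0 : 0 <= M by exact: le_trans (hM 0).
have mI : measurable (`[0%R, 1%R]%classic : set T) by exact: measurable_itv.
have Iy : (@lebesgue_measure R `[0%R, 1%R]%classic < +oo)%E.
  by rewrite lebesgue_measure_itv/= lte_fin ltr01 -EFinB ltry.
have ih : (@lebesgue_measure R).-integrable `[0%R, 1%R]%classic (EFin \o h).
  apply: measurable_bounded_integrable => //.
    exact: measurable_funS mh.
  by exists M; split; [exact: num_real|move=> x Mx y _; exact: le_trans (hM y) (ltW Mx)].
have [g [cg ig gh]] := approximation_continuous_integrable mI Iy ih.
pose k n x := clamp M (g n x).
have kM n x : `|k n x| <= M by exact: clamp_norm.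
have ck n : continuous (k n).
  move=> x; apply/cvgrPdist_lt => e e0; move/cvgrPdist_lt : (cg n x) => /(_ _ e0).
  by apply: filterS => z; apply: le_lt_trans; exact: clamp_lipschitz.
have mk n : measurable_fun setT (k n : T -> R) by exact: continuous_measurable_fun.
have mg n : measurable_fun setT (g n : T -> R) by exact: continuous_measurable_fun.
have khg n x : `|h x - k n x| <= `|h x - g n x| by exact: clamp_dist.
apply: step_approx_closure => e e0.
(* |h - k|^p <= (2 M)^(p - 1) * |h - k|; the additional 1 keeps L positive when M = 0. *)
pose L := (2 * M + 1) `^ (p - 1).
have L0 : 0 < L by rewrite powR_gt0// ltr_wpDl// mulr_ge0.
have ep : 0 < e `^ p / L by rewrite divr_gt0// powR_gt0.
have [n _ /(_ n (leqnn n))/= hn] := cvge0_lt ep gh.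
have rh : rLp h by exact: (rLp_bounded p1 mu_lty mh hM).
have rk : rLp (k n) by exact: (rLp_bounded p1 mu_lty (mk n) (kM n)).
exists (rl (k n)); first exact: step_approx_continuous (ck n) (kM n).
have mhg : measurable_fun setT (fun x : T => `|h x - g n x|%:E).
  apply/measurable_EFinP; apply: measurableT_comp => //; exact: measurable_funB.
have hg0 (x : T) : (0 <= `|h x - g n x|%:E)%E by rewrite lee_fin.
rewrite -(rlB p1 rh rk) CLp_norm_ltE ?(ltW e0)// (Npow_rl p1 (rLpB p1 rh rk)).
apply: (@le_lt_trans _ _ (\int[mu]_x (L%:E * `|h x - g n x|%:E))%E).
  apply: ge0_le_integral => //.
  - exact: measurable_normr_powR (rLp_meas (rLpB p1 rh rk)).
  - exact: measurable_funeM.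
  move=> x _; rewrite -EFinM lee_fin -(powR_pred_mul p_gt1 (normr_ge0 _)).
  apply: ler_pM; rewrite ?powR_ge0//.
  apply: powR_le; rewrite ?subr_ge0//.
  apply: le_trans (ler_normB _ _) _; rewrite mulr_natl mulr2n -addrA.
  by apply: lerD (hM x) _; rewrite (le_trans (kM n x))// lerDl.
rewrite (ge0_integralZl_EFin mu measurableT (fun x _ => hg0 x) mhg (ltW L0)).
rewrite (lebesgue01_integral mhg hg0).
have -> : ((e `^ p)%:E = L%:E * (e `^ p / L)%:E)%E.
  by rewrite -EFinM mulrC divfK// gt_eqF.
by rewrite lte_pmul2l// lte_fin.
Qed.

Lemma rl_truncation (h : T -> R) (e : R) : rLp h -> 0 < e ->
  exists n : nat, `|rl h - rl (fun x => clamp n%:R (h x))| < e%:C%C.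
Proof.
move=> rh e0; have mh := rLp_meas rh; pose f (n : nat) x := clamp n%:R (h x).
have mf n : measurable_fun setT (f n).
  by apply: measurable_maxr => //; apply: measurable_minr.
have fh n x : `|f n x| <= `|h x| by exact: clamp_le.
have rhn : rLp (fun x => `|h x|).
  apply: (rLp_absle p1 _ _ rh) => [|x]; last by rewrite normr_id.
  exact: measurableT_comp.
have fcv : {ae mu, forall x, f n x @[n --> \oo] --> h x}.
  apply: aeW => x; apply: cvg_near_cst; near=> n; apply: clamp_id.
  by near: n; exact: nbhs_infty_ger.
have := rl_dominated p1 e0 rhn mh mf (fun x => lexx _) fh fcv.
by move=> [n _ /(_ n (leqnn n))/= hn]; exists n.
Unshelve. all: by end_near. Qed.

Lemma measurable_truncation (h : T -> R) (M : R) : measurable_fun setT h ->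
  measurable_fun setT (fun x => clamp M (h x)).
Proof. by move=> mh; apply: measurable_maxr => //; apply: measurable_minr. Qed.

Lemma step_approx_real (h : T -> R) : rLp h -> step_approx (rl h).
Proof.
move=> rh; apply: step_approx_closure => e e0.
have [n hn] := rl_truncation rh e0; exists (rl (fun x => clamp n%:R (h x))) => //.
apply: step_approx_bounded (measurable_truncation n%:R (rLp_meas rh)) _ => x.
exact: clamp_norm.
Qed.

Lemma step_dense u : step_approx u.
Proof.
rewrite (rl_Re_Im u) addrC; apply: step_approxD; apply: step_approx_real.
  exact: rLp_Im.
exact: rLp_Re.
Qed.

End step_functions.

(** * Strong approximation by towers *)

Section sot_density.
Context (R : realType) (p : R) (p1 : 1 <= p).
Hypothesis p_gt1 : 1 < p.
Local Notation mu := (lebesgue01 R).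
Local Notation C := (R[i]).
Local Notation E := (CLp mu p1).

Let p0 : 0 < p. Proof. exact: lt_le_trans p1. Qed.

Section approximation.
Variables (N : nat) (al : R).
Hypotheses (N0 : (0 < N)%N) (al01 : 0 < al < 1).
Variable S : bop E.
Hypothesis (S_iso : bop_isometry S).
Local Notation tw := (cell_tower N0 al01 S_iso).
Local Notation r := (al `^ p).
Local Notation c := (wgt r).
Let al0 : 0 < al. Proof. by case/andP: al01. Qed.
Let r01 : 0 < r < 1.
Proof.
move: al01 => /andP[a0 a1]; rewrite powR_gt0//=.
have e : (1 : R) `^ p = 1 by rewrite powR1.
by rewrite -[ltRHS]e powR_lt// ltW.
Qed.
Let c_gt0 k : 0 < c k. Proof. exact: wgt_gt0. Qed.
Let P := cell_pieces N0 (wgt_prob r01) c_gt0.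
Local Notation piece := (piece (cell_piece_map N c)).

Lemma piece_step k (f : E) : is_step N f -> piece k f = f.
Proof.
move=> [z hz]; apply: CLp_ext.
apply: aeS (aeI (ev_piece P k f) (aeI (ae_map P k hz) (aeI hz (lebesgue01_ae R)))).
move=> x [-> [-> [-> x01]]].
by rewrite cell_piece_map_cell//; exact: wgt_prob.
Qed.

(** The p-th power of the norm of u is the average, with weights c, of those of its pieces. *)
Lemma norm_le_pieces (u : E) (eta : R) : 0 <= eta ->
  (forall k, `|piece k u| <= eta%:C%C) -> `|u| <= eta%:C%C.
Proof.
move=> eta0 hu; rewrite CLp_norm_leE// (Npow_pieces P).
have -> : ((eta `^ p)%:E = \sum_(0 <= k <oo) (eta `^ p)%:E * (c k)%:E)%E.
  rewrite nneseriesZl ?(prob_nneseries (wgt_prob r01)) ?mule1// => k _.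
  by rewrite lee_fin ltW.
apply: lee_nneseries => [k _ _|k _]; first by rewrite mule_ge0 ?Npow_ge0// lee_fin ltW.
rewrite muleC lee_wpmul2r//; first by rewrite lee_fin ltW.
by rewrite -CLp_norm_leE.
Qed.

Lemma tower_coef_near1 k : `|tower_coef p c zunshift k - 1| <= al^-1 - 1.
Proof.
have a1 : al < 1 by case/andP: al01.
have ia : 1 <= al^-1 by rewrite invf_ge1// ltW.
have [e|e] := wgt_ratio k r01; rewrite /tower_coef e.
  rewrite powRK_inv ?gt_eqF ?(ltW al0)// ler0_norm ?subr_le0 ?(ltW a1)//.
  have -> : al^-1 - 1 = al^-1 * (1 - al) by rewrite mulrBr mulr1 mulVf// gt_eqF.
  by rewrite opprB ler_peMl// subr_ge0 ltW.
have -> : r^-1 = (al^-1) `^ p.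
  by rewrite -powR_inv1 ?powR_ge0// -powRrM mulrC powRrM powR_inv1// ltW.
by rewrite powRK_inv ?gt_eqF ?invr_ge0 ?(ltW al0)// ger0_norm// subr_ge0.
Qed.

(** As f and g coincide with all their pieces, each piece of tw f - g is b * S f - g with a
    coefficient b within al^-1 - 1 of 1. *)
Lemma cell_tower_step (f g : E) (M eta : R) : is_step N f -> is_step N g ->
  `|S f| <= M%:C%C -> `|S f - g| <= eta%:C%C ->
  `|tw f - g| <= ((al^-1 - 1) * M + eta)%:C%C.
Proof.
move=> sf sg SfM Sfg.
have eta0 : 0 <= eta by have := le_trans (normr_ge0 _) Sfg; rewrite lecR.
have M0 : 0 <= M by have := le_trans (normr_ge0 _) SfM; rewrite lecR.
have a1 : 0 <= al^-1 - 1 by rewrite subr_ge0 invf_ge1 ?ltW//; case/andP: al01.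
apply: norm_le_pieces; first by rewrite addr_ge0// mulr_ge0.
move=> k; rewrite -[tw f - g]addrC -scaleN1r (piece_lin P) scaleN1r addrC.
rewrite (piece_step k sg).
have -> : piece k (tw f) = (tower_coef p c zunshift k)%:C%C *: S f.
  have := piece_tower P zshiftK zunshiftK S_iso k f.
  by rewrite /tower_pieces (piece_step _ sf).
set b := tower_coef _ _ _ _.
have -> : b%:C%C *: S f - g = (b - 1)%:C%C *: S f + (S f - g).
  by rewrite rmorphB rmorph1 scalerBl scale1r addrA subrK.
apply: le_trans (ler_normD _ _) _.
rewrite -(real_complexD ((al^-1 - 1) * M) eta); apply: lerD => //.
rewrite normrZ normr_normc normc_real rmorphM.
by apply: ler_pM => //; rewrite ?ler0c// lecR tower_coef_near1.
Qed.

End approximation.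

(** Chosen so that the error al^-1 - 1 in the coefficients is exactly 1 / (m + 1). *)
Definition tower_param m : R := m.+1%:R / m.+2%:R.

Lemma tower_param01 m : 0 < tower_param m < 1.
Proof. by rewrite divr_gt0//= ltr_pdivrMr// mul1r ltr_nat. Qed.

Lemma tower_paramV m : (tower_param m)^-1 - 1 = m.+1%:R^-1.
Proof.
by rewrite /tower_param invf_div -[X in X / _]natr1 mulrDl divff// mul1r addrAC subrr add0r.
Qed.

Lemma expn2_gt0 m : (0 < 2 ^ m)%N. Proof. by rewrite expn_gt0. Qed.

Definition tower_seq (S : bop E) (S_iso : bop_isometry S) m : bop E :=
  cell_tower (expn2_gt0 m) (tower_param01 m) S_iso.

(** Both u and S f must be replaced by step functions, since [cell_tower_step] controls the tower
    only there. Of the five parts of e, one each goes to S (u - f), S f - g and tw (f - u), and two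
    go to g - tw f. *)
Lemma tower_seq_cvg (S : bop E) (S_iso : bop_isometry S) :
  tower_seq S_iso @ \oo --> (S : sot E).
Proof.
apply/sot_cvgP => u; apply/cvgrPdist_lt => e' e'0.
have [e eE] : exists e : R, e' = e%:C%C.
  by exists (complex.Re e'); rewrite RRe_real// gtr0_real.
move: e'0; rewrite eE -(rmorph0 (real_complex R)) ltcR => e0.
have e5 : 0 < e / 5 by rewrite divr_gt0.
have [m1 [f sf uf]] := step_dense p_gt1 u e5.
have [m2 [g sg fg]] := step_dense p_gt1 (S f) e5.
have [M ME] : exists M : R, `|S f| = M%:C%C by rewrite CLp_normE; eexists.
have M0 : 0 <= M by have := normr_ge0 (S f); rewrite ME lecR.
have d0 : 0 < e / 5 / (M + 1) by rewrite divr_gt0// ltr_wpDl.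
change (\forall m \near \oo, `|S u - tower_seq S_iso m u| < e%:C%C).
near=> m.
have sf' : is_step (2 ^ m) f by apply: is_step_widen sf; near: m; exact: nbhs_infty_ge.
have sg' : is_step (2 ^ m) g by apply: is_step_widen sg; near: m; exact: nbhs_infty_ge.
have hm : m.+1%:R^-1 < e / 5 / (M + 1) by near: m; exact: near_infty_natSinv_lt (PosNum d0).
have h1 := cell_tower_step (expn2_gt0 m) (tower_param01 m) S_iso sf' sg'
  (eq_ind_r (fun z => z <= _) (lexx _) ME) (ltW fg).
rewrite tower_paramV in h1.
have h2 : (m.+1%:R^-1 * M + e / 5 : R) <= e / 5 + e / 5.
  rewrite lerD2r; apply: le_trans (_ : m.+1%:R^-1 * (M + 1) <= _).
    by rewrite ler_wpM2l// lerDl.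
  by rewrite -ler_pdivlMr ?ltr_wpDl// ltW.
pose tw := tower_seq S_iso m.
have -> : S u - tw u = S (u - f) + ((S f - g) + ((g - tw f) + tw (f - u))).
  by rewrite !linearB/= !addrA !subrK.
have h3 : `|g - tw f| <= (e / 5 + e / 5)%:C%C.
  by rewrite distrC; apply: le_trans h1 _; rewrite lecR.
have h4 : `|tw (f - u)| <= (e / 5)%:C%C.
  have tw_iso : bop_isometry tw by exact: cell_tower_isometry.
  by rewrite tw_iso distrC ltW.
have h5 : `|S (u - f)| < (e / 5)%:C%C by rewrite S_iso.
apply: le_lt_trans (ler_normD _ _) _.
have -> : e%:C%C = (e / 5)%:C%C + (e / 5 + (e / 5 + e / 5 + e / 5))%:C%C.
  by rewrite real_complexD; congr (_%:C%C); field.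
apply: ltr_leD => //.
apply: le_trans (ler_normD _ _) _; rewrite -real_complexD; apply: lerD; first exact: ltW.
by apply: le_trans (ler_normD _ _) _; rewrite -real_complexD; apply: lerD.
Unshelve. all: by end_near. Qed.

Lemma isometries_dense (O : set (sot E)) : open O -> O `&` positive_isometries mu p1 !=set0 ->
  O `&` [set S | positive_isometries mu p1 S /\ forall k, concentrates k S] !=set0.
Proof.
move=> oO [S [OS [S0 S1]]].
have := tower_seq_cvg S1 (open_nbhs_nbhs (conj oO OS)).
move=> [m _ /(_ m (leqnn m))/= hm]; exists (tower_seq S1 m); split => //.
split; first by split; [exact: cell_tower_positive|exact: cell_tower_isometry].
by move=> k; exact: cell_tower_concentrates.
Qed.

Lemma surjective_isometries_dense (O : set (sot E)) : open O ->
  O `&` positive_surjective_isometries mu p1 !=set0 ->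
  O `&` [set S | positive_surjective_isometries mu p1 S /\ forall k, concentrates k S] !=set0.
Proof.
move=> oO [S [OS [[S0 S1] Sr]]].
have := tower_seq_cvg S1 (open_nbhs_nbhs (conj oO OS)).
move=> [m _ /(_ m (leqnn m))/= hm]; exists (tower_seq S1 m); split => //.
split; last by move=> k; exact: cell_tower_concentrates.
split; first by split; [exact: cell_tower_positive|exact: cell_tower_isometry].
exact: tower_surjective.
Qed.

End sot_density.

(** * Weak density *)

Section subextremal.
Context (R : realType) (p : R) (N : nat) (a : 'I_N -> 'I_N -> R) (th : R).
Hypothesis p_gt1 : 1 < p.
Hypothesis a_ge0 : forall i j, 0 <= a i j.
Hypothesis th01 : 0 <= th < 1.
Local Notation A x := (fun i => \sum_j a i j * x j).
Hypothesis a_contraction : forall x : 'I_N -> R, (forall j, 0 <= x j) ->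
  \sum_i (A x i) `^ p <= th * \sum_j (x j) `^ p.

Let p0 : 0 < p. Proof. exact: lt_trans p_gt1. Qed.
Let pm0 : 0 < p - 1. Proof. by rewrite subr_gt0. Qed.
(** Half of the contraction gap: of 1 - th = 2 * del, one half absorbs the perturbation and the
    other bounds the iterates. *)
Let del := (1 - th) / 2.
Let del0 : 0 < del. Proof. by case/andP: th01 => _ h; rewrite divr_gt0// subr_gt0. Qed.

Let B (x : 'I_N -> R) j := del + \sum_i a i j * (A x i) `^ (p - 1).
Let F (x : 'I_N -> R) j := (B x j) `^ (p - 1)^-1.
(* Increasing iterations towards a solution of the equality perturbed by [del]; the
   perturbation makes the limit positive, the contraction bounds the iterates. *)
Let xs n : 'I_N -> R := iter n F (fun=> 0).

Let A_ge0 x i : (forall j, 0 <= x j) -> 0 <= A x i.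
Proof. by move=> x0; apply: sumr_ge0 => j _; rewrite mulr_ge0. Qed.

Let A_le x y i : (forall j, x j <= y j) -> A x i <= A y i.
Proof. by move=> xy; apply: ler_sum => j _; rewrite ler_wpM2l. Qed.

Let B_ge x j : del <= B x j.
Proof. by rewrite lerDl; apply: sumr_ge0 => i _; rewrite mulr_ge0// powR_ge0. Qed.

Let xs_ge0 n j : 0 <= xs n j.
Proof. by case: n => [|n] //=; exact: powR_ge0. Qed.

Let xs_pow n j : xs n.+1 j `^ (p - 1) = B (xs n) j.
Proof. by rewrite /= powR_invK ?gt_eqF// (le_trans (ltW del0)). Qed.

Let xs_le n j : xs n j <= xs n.+1 j.
Proof.
elim: n j => [|n ih] j; first exact: powR_ge0.
change (F (xs n) j <= F (xs n.+1) j); apply: powR_le.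
- by rewrite invr_ge0 ltW.
- by rewrite (le_trans (ltW del0)).
rewrite lerD2l; apply: ler_sum => i _; rewrite ler_wpM2l//; apply: powR_le.
- exact: ltW.
- exact: A_ge0.
- exact: A_le.
Qed.

(** Multiplying the recursion for x^(p - 1) by x and summing gives s as del times the sum of x plus
    a term at most th * s. Since t <= 1 + t^p, the sum of x is at most N + s, and solving for s
    gives s <= N. *)
Let xs_bound n : \sum_j (xs n j) `^ p <= N%:R.
Proof.
case: n => [|n].
  rewrite big1 ?ler0n// => j _; rewrite /xs/= powR0// gt_eqF//.
set x' := xs n.+1; set s := \sum_j _.
have x'0 j : 0 <= x' j by exact: xs_ge0.
have e1 : s = del * \sum_j x' j + \sum_i A x' i * (A (xs n) i) `^ (p - 1).
  rewrite /s (eq_bigr (fun j => del * x' j + \sum_i a i j * x' j * (A (xs n) i) `^ (p - 1))).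
    rewrite big_split/= -mulr_sumr; congr (_ + _).
    by rewrite exchange_big; apply: eq_bigr => i _; rewrite mulr_suml.
  move=> j _; rewrite -(powR_pred_mul p_gt1 (x'0 j)) xs_pow /B mulrDl mulr_suml; congr (_ + _).
  by apply: eq_bigr => i _; rewrite mulrAC.
have h1 : \sum_j x' j <= N%:R + s.
  rewrite -[N in N%:R]card_ord -sumr_const -big_split/=; apply: ler_sum => j _.
  have [xj|xj] := leP (x' j) 1; first by rewrite (le_trans xj)// lerDl powR_ge0.
  rewrite -[leLHS](powRr1 (x'0 j)) (le_trans (ler_powR (ltW xj) (ltW p_gt1)))//.
  by rewrite lerDr.
have h2 : \sum_i A x' i * (A (xs n) i) `^ (p - 1) <= th * s.
  apply: le_trans (a_contraction x'0); apply: ler_sum => i _.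
  rewrite -(powR_pred_mul p_gt1 (A_ge0 i x'0)) mulrC ler_wpM2r//; first exact: A_ge0.
  apply: powR_le; [exact: ltW|exact: A_ge0|]; apply: A_le; exact: xs_le.
have h3 : s <= del * (N%:R + s) + th * s.
  by rewrite {1}e1; apply: lerD => //; rewrite ler_wpM2l// ltW.
have h4 : del * s <= del * N%:R by move: h3; rewrite mulrDr /del; lra.
by rewrite ler_pM2l in h4.
Qed.

(** No limit is taken: the sums of the increasing sequences x^(p - 1) stay bounded, so at some step
    they grow by at most [del]. At that step the perturbation [del] covers the growth in each
    coordinate, leaving the desired inequality. *)
Lemma subextremal : exists x : 'I_N -> R, (forall j, 0 < x j) /\
  forall j, \sum_i a i j * (A x i) `^ (p - 1) <= (x j) `^ (p - 1).
Proof.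
pose z n j := xs n j `^ (p - 1).
have zle n j : z n j <= z n.+1 j.
  by apply: powR_le; [exact: ltW|exact: xs_ge0|exact: xs_le].
pose s n := \sum_j z n j.
have sb n : s n <= 2 * N%:R.
  rewrite mulr_natl mulr2n; apply: le_trans (_ : N%:R + \sum_j (xs n j) `^ p <= _); last first.
    by rewrite lerD2l.
  rewrite -[N in N%:R]card_ord -sumr_const -big_split/=; apply: ler_sum => j _; rewrite /z.
  have [xj|xj] := leP (xs n j) 1.
    have e : (1 : R) `^ (p - 1) = 1 by rewrite powR1.
    by rewrite -[leLHS]addr0 lerD ?powR_ge0// -[leRHS]e powR_le// ltW.
  apply: le_trans (_ : xs n j `^ p <= _); last by rewrite lerDr.
  by rewrite ler_powR ?(ltW xj)// gerBl.
have [n hn] : exists n, s n.+2 - s n.+1 <= del.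
  apply/not_existsP => h.
  have hs n : n%:R * del <= s n.+1.
    elim: n => [|n ih]; first by rewrite mul0r; apply: sumr_ge0 => j _; exact: powR_ge0.
    rewrite -natr1 mulrDl mul1r -(subrK (s n.+1) (s n.+2)) addrC; apply: lerD => //.
    by rewrite ltW// ltNge; apply/negP; exact: h.
  have := hs (Num.truncn (2 * N%:R / del)).+1.
  apply/negP; rewrite -ltNge; apply: le_lt_trans (sb _) _.
  rewrite -ltr_pdivrMr//; exact: truncnS_gt.
exists (xs n.+1); split.
  by move=> j; rewrite /= powR_gt0// (lt_le_trans del0).
move=> j; have zj : z n.+2 j - z n.+1 j <= del.
  apply: le_trans hn; rewrite /s -sumrB (bigD1 j)//= lerDl.
  by apply: sumr_ge0 => k _; rewrite subr_ge0.
have e : z n.+2 j = del + \sum_i a i j * (A (xs n.+1) i) `^ (p - 1) := xs_pow n.+1 j.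
rewrite e lerBlDr lerD2l in zj; exact: zj.
Qed.

End subextremal.

(** Below the threshold s the first term suffices; above it (w / s)^2 >= 1 and w^p <= K^p. For
    bounded functions, smallness in L^2 thus yields smallness in L^p for every p. *)
Lemma powR_le_sqr (R : realType) (p K s w : R) : 0 < p -> 0 < s -> 0 <= w -> w <= K ->
  w `^ p <= s `^ p + K `^ p / s ^+ 2 * w ^+ 2.
Proof.
move=> p0 s0 w0 wK; have [ws|sw] := leP w s.
  rewrite -[leLHS]addr0; apply: lerD; first by rewrite powR_le// ltW.
  by rewrite mulr_ge0 ?sqr_ge0// divr_ge0 ?powR_ge0 ?sqr_ge0.
rewrite -[leLHS]add0r; apply: lerD; first exact: powR_ge0.
apply: (@le_trans _ _ (K `^ p)); first by rewrite powR_le// ltW.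
rewrite mulrAC -mulrA ler_peMr ?powR_ge0// ler_pdivlMr ?exprn_gt0// mul1r.
by rewrite ler_pXn2r ?nnegrE// ltW.
Qed.

Lemma sum_half_le (R : realType) (a b t c k : R) : a <= b -> t < 1 / 2 -> c <= k ->
  a + 2 * t + c <= b + (k + 1).
Proof. by lra. Qed.

(** * Bounded, asymptotically orthogonal sequences are weakly null *)

Section weak_null.
Context d (T : measurableType d) (R : realType).
Variables (mu : {measure set T -> \bar R}) (p : R) (p1 : 1 <= p).
Hypothesis mu1 : mu setT = 1%E.
Local Notation rl := (rl mu p1).
Local Notation E := (CLp mu p1).
Let p0 : 0 < p. Proof. exact: lt_le_trans p1. Qed.
Let mu_lty : (mu setT < +oo)%E. Proof. by rewrite mu1 ltry. Qed.
Local Notation "'I' f" := (\int[mu]_x f x)%R (at level 10, f at level 9).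

Lemma integrable_bounded (f : T -> R) (M : R) : measurable_fun setT f ->
  (forall x, `|f x| <= M) -> mu.-integrable setT (EFin \o f).
Proof.
move=> mf fM; apply: measurable_bounded_integrable => //.
by exists M; split; [exact: num_real|move=> x Mx y _; exact: le_trans (fM y) (ltW Mx)].
Qed.

Lemma mul_bound (f g : T -> R) (M K : R) : (forall x, `|f x| <= M) -> (forall x, `|g x| <= K) ->
  forall x, `|f x * g x| <= M * K.
Proof. by move=> fM gK x; rewrite normrM ler_pM. Qed.

Lemma norm_rl_le_sqr (w : T -> R) (K s c : R) : 0 < s -> measurable_fun setT w ->
  (forall x, `|w x| <= K) -> I (fun x => w x ^+ 2) <= c ->
  `|rl w| <= ((s `^ p + K `^ p / s ^+ 2 * c) `^ p^-1)%:C%C.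
Proof.
move=> s0 mw wK wc; have rw : rLp mu p w by exact: (rLp_bounded p1 mu_lty mw wK).
have A0 : 0 <= K `^ p / s ^+ 2 by rewrite divr_ge0 ?powR_ge0 ?sqr_ge0.
have mw2 : measurable_fun setT (fun x => w x ^+ 2) by exact: measurable_funX.
have I0 : 0 <= I (fun x => w x ^+ 2) by apply: Rintegral_ge0 => x _; exact: sqr_ge0.
have c0 : 0 <= c := le_trans I0 wc.
have B0 : 0 <= s `^ p + K `^ p / s ^+ 2 * c by rewrite addr_ge0 ?powR_ge0// mulr_ge0.
rewrite CLp_norm_leE ?powR_ge0// powR_invK ?gt_eqF// (Npow_rl p1 rw).
have iw : mu.-integrable setT (EFin \o (fun x => w x ^+ 2)).
  apply: (@integrable_bounded _ (K ^+ 2)) => // x.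
  by rewrite normrX ler_pXn2r ?nnegrE// (le_trans _ (wK x)).
have fw : (\int[mu]_x (w x ^+ 2)%:E)%E = (I (fun x => w x ^+ 2))%:E.
  by rewrite fineK//; exact: integrable_fin_num.
apply: (@le_trans _ _ (\int[mu]_x ((s `^ p)%:E + (K `^ p / s ^+ 2)%:E * (w x ^+ 2)%:E))%E).
  apply: ge0_le_integral => //.
  - exact: measurable_normr_powR.
  - apply: emeasurable_funD => //; apply: measurable_funeM; exact/measurable_EFinP.
  move=> x _; rewrite -EFinM -EFinD lee_fin -[w x ^+ 2]real_normK ?num_real//.
  exact: powR_le_sqr.
rewrite ge0_integralD//=; last 3 first.
- by move=> x _; rewrite lee_fin powR_ge0.
- by move=> x _; rewrite -EFinM lee_fin mulr_ge0// sqr_ge0.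
- by apply: measurable_funeM; exact/measurable_EFinP.
rewrite integral_cst// mu1 mule1 ge0_integralZl_EFin//=; last 2 first.
- by move=> x _; rewrite lee_fin sqr_ge0.
- exact/measurable_EFinP.
by rewrite fw -EFinM -EFinD lee_fin lerD2l ler_wpM2l.
Qed.

Lemma rlZ (a : R) (h : T -> R) : rLp mu p h -> rl (fun x => a * h x) = a%:C%C *: rl h.
Proof.
move=> hh; have r0 : rLp mu p (fun=> 0 : R) by exact: (rLp_cst p1 mu1).
have rl0 : rl (fun=> 0) = 0.
  have := rl_lin p1 (-1) r0 r0; rewrite (_ : (fun x => _) = (fun=> 0 : R)); last first.
    by apply/funext => x; rewrite mulr0 addr0.
  by rewrite rmorphN1 scaleN1r addNr.
rewrite -[RHS]addr0 -rl0 -(rl_lin p1 a hh r0); congr rl.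
by apply/funext => x; rewrite addr0.
Qed.

Lemma rl_sum (X : Type) (r : seq X) (u : X -> T -> R) : (forall i, rLp mu p (u i)) ->
  rLp mu p (fun x => \sum_(i <- r) u i x) /\
  rl (fun x => \sum_(i <- r) u i x) = \sum_(i <- r) rl (u i).
Proof.
move=> ru; have r0 : rLp mu p (fun=> 0 : R) by exact: (rLp_cst p1 mu1).
elim: r => [|a l [ih1 ih2]].
  have -> : (fun x => \sum_(i <- [::]) u i x) = (fun=> 0 : R) by apply/funext => x; rewrite big_nil.
  split=> //; rewrite big_nil; have := rlZ 0 r0; rewrite rmorph0 scale0r => <-.
  by congr rl; apply/funext => x; rewrite mul0r.
have e1 : (fun x => \sum_(i <- a :: l) u i x) = (fun x => 1 * u a x + \sum_(i <- l) u i x).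
  by apply/funext => x; rewrite big_cons mul1r.
split; first by rewrite e1; exact: (rLp_lin p1 1 (ru a) ih1).
by rewrite e1 (rl_lin p1 1 (ru a) ih1) ih2 big_cons scale1r.
Qed.

Section asymptotically_orthogonal.
Variables (u : nat -> T -> R) (K : R).
Hypothesis mu_ : forall n, measurable_fun setT (u n).
Hypothesis uK : forall n x, `|u n x| <= K.
Hypothesis u_orth : forall m, I (fun x => u m x * u n x) @[n --> \oo] --> (0 : R).

Let K0 : 0 <= K. Proof. by apply: le_trans (uK 0%N point). Qed.

Let bsum (r : seq nat) x : `|\sum_(n <- r) u n x| <= (size r)%:R * K.
Proof.
elim: r => [|a r ih]; first by rewrite big_nil normr0 mul0r.
rewrite big_cons; apply: le_trans (ler_normD _ _) _.
by rewrite /= -natr1 mulrDl mul1r addrC lerD.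
Qed.

(* Choosing n far out one by one makes the partial sums almost orthogonal. *)
Lemma orthogonal_sums (J : nat) (Q : nat -> Prop) : (forall m, exists2 n, (m <= n)%N & Q n) ->
  exists s : seq nat, [/\ size s = J, forall n, n \in s -> Q n &
    I (fun x => (\sum_(n <- s) u n x) ^+ 2) <= J%:R * (K ^+ 2 + 1)].
Proof.
move=> hQ; elim: J => [|J [s [sJ sQ sI]]].
  exists [::]; split => //; rewrite mul0r.
  under eq_Rintegral do rewrite big_nil expr0n.
  by rewrite Rintegral_cst// mul0r.
have msum (r : seq nat) : measurable_fun setT (fun x => \sum_(n <- r) u n x).
  by apply: measurable_sum.
have corr : I (fun x => (\sum_(m <- s) u m x) * u n x) @[n --> \oo] --> (0 : R).
  elim: (s) => [|a r ih].
    under eq_fun do under eq_Rintegral do rewrite big_nil mul0r.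
    under eq_fun do rewrite Rintegral_cst// mul0r.
    exact: cvg_cst.
  rewrite (_ : (fun n => _) = (fun n => I (fun x => u a x * u n x)) +
     (fun n => I (fun x => (\sum_(m <- r) u m x) * u n x))).
    have h := cvgD (u_orth a) ih; rewrite addr0 in h; exact: h.
  apply/funext => n /=; rewrite [RHS]/GRing.add/= -RintegralD//.
  - by apply: eq_Rintegral => x _; rewrite big_cons mulrDl.
  - apply: integrable_bounded (mul_bound (uK a) (uK n)); exact: measurable_funM.
  - apply: integrable_bounded (mul_bound (bsum r) (uK n)); exact: measurable_funM.
have h2 : 0 < (1 / 2 : R) by rewrite divr_gt0.
move/cvgrPdist_lt : corr => /(_ _ h2) [m0 _ hm0].
have [n m0n Qn] := hQ m0; exists (n :: s); split => //=; first by rewrite sJ.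
  by move=> k; rewrite inE => /orP[/eqP ->//|]; exact: sQ.
have i1 : mu.-integrable setT (EFin \o (fun x => u n x ^+ 2)).
  apply: integrable_bounded (mul_bound (uK n) (uK n)); exact: measurable_funM.
have i2 : mu.-integrable setT (EFin \o (fun x => (\sum_(m <- s) u m x) ^+ 2)).
  apply: integrable_bounded (mul_bound (bsum s) (bsum s)); exact: measurable_funM.
have i3 : mu.-integrable setT (EFin \o (fun x => (\sum_(m <- s) u m x) * u n x)).
  apply: integrable_bounded (mul_bound (bsum s) (uK n)); exact: measurable_funM.
have i4 : mu.-integrable setT (EFin \o (fun x => 2 * ((\sum_(m <- s) u m x) * u n x))).
  exact: (integrableZl measurableT 2 i3).
have i5 : mu.-integrable setT (EFin \o (fun x => (\sum_(m <- s) u m x) ^+ 2 +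
    2 * ((\sum_(m <- s) u m x) * u n x))).
  exact: (integrableD measurableT i2 i4).
rewrite (_ : I (fun x => (\sum_(m <- n :: s) u m x) ^+ 2) = I (fun x => ((\sum_(m <- s) u m x) ^+ 2 +
    2 * ((\sum_(m <- s) u m x) * u n x)) + u n x ^+ 2)); last first.
  by apply: eq_Rintegral => x _; rewrite big_cons; ring.
rewrite (RintegralD measurableT i5 i1) (RintegralD measurableT i2 i4) (RintegralZl 2 measurableT i3).
have h3 : I (fun x => u n x ^+ 2) <= K ^+ 2.
  apply: (@le_trans _ _ (I (fun=> K ^+ 2))).
    apply: le_Rintegral => //.
      exact: (@integrable_bounded _ `|K ^+ 2|).
    move=> x _; rewrite -[u n x ^+ 2]real_normK ?num_real//.
    by rewrite ler_pXn2r ?nnegrE// (le_trans _ (uK n x)).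
  by rewrite Rintegral_cst// mu1 mulr1.
have := hm0 n m0n; rewrite /= sub0r normrN => /(le_lt_trans (ler_norm _)) h4.
have -> : J.+1%:R * (K ^+ 2 + 1) = J%:R * (K ^+ 2 + 1) + (K ^+ 2 + 1).
  by rewrite -natr1 mulrDl mul1r.
exact: (sum_half_le sI h4 h3).
Qed.

(** A Banach-Saks argument: if [psi] were at least e infinitely often, the average of J such terms,
    chosen almost orthogonal, would still have value at least e, while its L^2 norm, hence its L^p
    norm, tends to 0 with J. Only real linearity is assumed, so that real and imaginary parts of
    functionals qualify. *)
Lemma functional_cvg0 (psi : E -> R) (M : R) : 0 < M ->
  (forall v w, psi (v + w) = psi v + psi w) -> (forall (a : R) v, psi (a%:C%C *: v) = a * psi v) ->
  (forall v r, `|v| <= r%:C%C -> psi v <= M * r) ->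
  forall e : R, 0 < e -> \forall n \near \oo, psi (rl (u n)) < e.
Proof.
move=> M0 psiD psiZ psiM e e0; apply: contrapT => hn.
have hQ m : exists2 n, (m <= n)%N & e <= psi (rl (u n)).
  apply: contrapT => h; apply: hn; exists m => // n /= mn.
  by rewrite ltNge; apply/negP => en; apply: h; exists n.
(* In [norm_rl_le_sqr] the term s^p gets one half of (e / M / 2)^p, and J is chosen so that A / J
   gets the other half; then [psi] of the average is at most e / 2. *)
have [s [s0 sE]] : exists s : R, 0 < s /\ s `^ p = (e / M / 2) `^ p / 2.
  exists (((e / M / 2) `^ p / 2) `^ p^-1).
  have h : 0 < (e / M / 2) `^ p / 2 by rewrite divr_gt0// powR_gt0// !divr_gt0.
  by rewrite powR_gt0// powR_invK ?gt_eqF// ltW.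
have [A AE] : exists A, A = K `^ p / s ^+ 2 * (K ^+ 2 + 1) by eexists.
have t0 : 0 < (e / M / 2) `^ p / 2 by rewrite divr_gt0// powR_gt0// !divr_gt0.
pose J := (Num.truncn (A / ((e / M / 2) `^ p / 2))).+1.
have J0 : 0 < J%:R :> R by rewrite ltr0n.
have AJ : A / J%:R <= (e / M / 2) `^ p / 2.
  by rewrite ler_pdivrMr// mulrC -ler_pdivrMr// ltW// truncnS_gt.
have [r [rJ rQ rI]] := @orthogonal_sums J _ hQ.
pose w x := J%:R^-1 * \sum_(n <- r) u n x.
have msum : measurable_fun setT (fun x => \sum_(n <- r) u n x) by exact: measurable_sum.
have ru n : rLp mu p (u n) by exact: (rLp_bounded p1 mu_lty (mu_ n) (uK n)).
have wE : rl w = (J%:R^-1)%:C%C *: \sum_(n <- r) rl (u n).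
  have [h <-] := rl_sum r ru; exact: rlZ.
have psi0 : psi 0 = 0.
  by apply: (@addrI _ (psi 0)); rewrite -psiD !addr0.
have h1 : e <= psi (rl w).
  rewrite wE psiZ -ler_pdivrMl ?invr_gt0// invrK.
  rewrite -rJ; elim: (r) rQ => [|a l ih] lQ; first by rewrite mul0r big_nil psi0.
  rewrite big_cons psiD /= -natr1 mulrDl mul1r addrC; apply: lerD; first exact: lQ (mem_head _ _).
  by apply: ih => n nl; apply: lQ; rewrite inE nl orbT.
have rb x : `|\sum_(n <- r) u n x| <= J%:R * K by rewrite -rJ.
have wK x : `|w x| <= K.
  by rewrite normrM ger0_norm ?invr_ge0// ler_pdivrMl.
have wI : I (fun x => w x ^+ 2) <= (K ^+ 2 + 1) / J%:R.
  rewrite (_ : I (fun x => w x ^+ 2) = I (fun x => J%:R^-1 ^+ 2 * (\sum_(n <- r) u n x) ^+ 2)); last first.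
    by apply: eq_Rintegral => x _; rewrite exprMn.
  rewrite (RintegralZl _ measurableT); last first.
    apply: integrable_bounded (mul_bound rb rb); exact: measurable_funM.
  rewrite expr2 -mulrA [leRHS]mulrC ler_wpM2l ?invr_ge0//.
  by rewrite ler_pdivrMl.
have mw : measurable_fun setT w by exact: measurable_funM.
have := norm_rl_le_sqr s0 mw wK wI.
move=> /psiM; apply/negP; rewrite -ltNge; apply: lt_le_trans h1.
rewrite sE mulrA -AE; have ht : ((e / M / 2) `^ p / 2 + A / J%:R) `^ p^-1 <= e / M / 2.
  rewrite -[leRHS](@powRK_inv _ p) ?gt_eqF//; last by rewrite !divr_ge0// ltW.
  apply: powR_le; first by rewrite invr_ge0 ltW.
    by rewrite addr_ge0 ?(ltW t0)// divr_ge0// AE !mulr_ge0 ?powR_ge0 ?invr_ge0 ?sqr_ge0// addr_ge0 ?sqr_ge0.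
  by rewrite [leRHS](splitr ((e / M / 2) `^ p)) lerD2l.
apply: (@le_lt_trans _ _ (M * (e / M / 2))); first by rewrite ler_wpM2l// ltW.
rewrite (_ : M * (e / M / 2) = e / 2); last by field; rewrite gt_eqF.
by rewrite ltr_pdivrMr// ltr_pMr// ltr1n.
Qed.

Lemma weak_null_orthogonal (f : dual E) : (fun n => f (rl (u n)) : R[i]^o) @ \oo --> (0 : R[i]^o).
Proof.
have [[m b] M0 fM] := continuous_linear_bound (@dual_continuous _ _ f).
move: M0; rewrite ltcE/= => /andP[/eqP bE m0]; rewrite bE in fM.
have fM' v r : `|v| <= r%:C%C -> normc (f v) <= m * r.
  move=> vr; rewrite -lecR -normr_normc rmorphM; apply: le_trans (fM v) _.
  by apply: ler_wpM2l vr; rewrite ler0c ltW.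
have fD v w : f (v + w) = f v + f w by exact: linearD.
have fZ (a : R) v : f (a%:C%C *: v) = a%:C%C * f v by exact: linearZ.
have key (g : R[i] -> R) : (forall x y, g (x + y) = g x + g y) ->
    (forall a x, g (a%:C%C * x) = a * g x) -> (forall x, g x <= normc x) ->
    forall e : R, 0 < e -> \forall n \near \oo, g (f (rl (u n))) < e.
  move=> gD gZ gN; apply: (@functional_cvg0 (fun v => g (f v)) m m0).
  - by move=> v w; rewrite fD gD.
  - by move=> a v; rewrite fZ gZ.
  - by move=> v r vr; exact: le_trans (gN _) (fM' _ _ vr).
apply/cvgrPdist_lt => -[e1 e2]; rewrite ltcE/= => /andP[/eqP -> e0].
have e4 : 0 < e1 / 2 by rewrite divr_gt0.
have k1 := key (@complex.Re R) (fun x y => ltac:(by case: x; case: y))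
  (fun a x => ltac:(by case: x => ? ? /=; rewrite mul0r subr0))
  (fun x => le_trans (ler_norm _) (Re_le_normc x)) _ e4.
have k2 := key (@complex.Im R) (fun x y => ltac:(by case: x; case: y))
  (fun a x => ltac:(by case: x => ? ? /=; rewrite mul0r addr0))
  (fun x => le_trans (ler_norm _) (Im_le_normc x)) _ e4.
have k3 := key (fun x => - complex.Re x) (fun x y => ltac:(by case: x; case: y => ? ? ? ? /=; rewrite opprD))
  (fun a x => ltac:(by case: x => ? ? /=; rewrite mul0r subr0 mulrN))
  (fun x => le_trans (ler_norm _) (eq_ind_r (fun t => t <= _) (Re_le_normc x) (normrN _))) _ e4.
have k4 := key (fun x => - complex.Im x) (fun x y => ltac:(by case: x; case: y => ? ? ? ? /=; rewrite opprD))
  (fun a x => ltac:(by case: x => ? ? /=; rewrite mul0r addr0 mulrN))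
  (fun x => le_trans (ler_norm _) (eq_ind_r (fun t => t <= _) (Im_le_normc x) (normrN _))) _ e4.
apply: filterS2 (filterI k1 k3) (filterI k2 k4) => n [h1 h3] [h2 h4].
rewrite sub0r normrN normr_normc ltcR; move: (f _) h1 h2 h3 h4 => z h1 h2 h3 h4.
rewrite [z in normc z]complexE; apply: le_lt_trans (le_normcD _ _) _.
rewrite normcM !normc_real [normc 'i%C]/= expr0n add0r expr1n sqrtr1 mul1r.
by rewrite (splitr e1); apply: ltrD; rewrite ltr_norml ltrNl; apply/andP.
Qed.

End asymptotically_orthogonal.
End weak_null.

Section signed_splitting.
Context (R : realType).
Local Notation mu := (lebesgue01 R).
Local Notation T := (measurableTypeR R).
Variables (c : nat -> R) (n : nat).
Hypotheses (c_prob : prob_seq c) (cn : forall i, (n <= i)%N -> c i = 0).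
Local Notation int h := (mu.-integrable setT (EFin \o (h : T -> R))).

Lemma integral_piece_map_lty (h : T -> \bar R) k : measurable_fun setT h ->
  (forall x, 0 <= h x)%E -> (\int[mu]_x h x < +oo)%E -> 0 < c k ->
  (\int[mu]_x h (piece_map c k x) < +oo)%E.
Proof.
move=> mh h0 hy ck; have kn : (k < n)%N.
  by rewrite ltnNge; apply/negP => /cn c0; rewrite c0 ltxx in ck.
have I0 j : (0 <= \int[mu]_x h (piece_map c j x))%E by apply: integral_ge0 => x _; exact: h0.
move: hy; rewrite (splitting_integral_finite c_prob cn mh h0) big_mkord (bigD1 (Ordinal kn))//=.
move=> hy; have : ((c k)%:E * \int[mu]_x h (piece_map c k x) < +oo)%E.
  apply: le_lt_trans hy; rewrite leeDl// sume_ge0// => i _.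
  by rewrite mule_ge0// lee_fin c_prob.1.
by case: (integral _ _ _) (I0 k) => [r _ _|_|//]; rewrite ?ltry// gt0_muley ?lte_fin.
Qed.

Lemma integrable_piece_map (h : T -> R) k : int h -> 0 < c k ->
  int (fun x => h (piece_map c k x)).
Proof.
move=> /integrableP[mh hy] ck; apply/integrableP; split.
  exact: (measurableT_comp mh (measurable_piece_map c k)).
apply: (@integral_piece_map_lty (fun x => `|(EFin \o h) x|%E)) => //.
exact: measurableT_comp.
Qed.

Lemma Rintegral_splitting (h : T -> R) : int h ->
  (\int[mu]_x h x = \sum_(0 <= k < n) c k * \int[mu]_x h (piece_map c k x))%R.
Proof.
move=> ih; have /integrableP[mh hy] := ih.
have mp : measurable_fun setT ((EFin \o h)^\+%E) by exact: measurable_funepos.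
have mn : measurable_fun setT ((EFin \o h)^\-%E) by exact: measurable_funeneg.
have py := integral_funepos_lt_pinfty measurableT ih.
have ny := integral_funeneg_lt_pinfty measurableT ih.
have p0 (x : T) : (0 <= (EFin \o h)^\+ x)%E by exact: funepos_ge0.
have n0 (x : T) : (0 <= (EFin \o h)^\- x)%E by exact: funeneg_ge0.
have fin (g : T -> \bar R) : (forall x, (0 <= g x)%E) -> (\int[mu]_x g x < +oo)%E ->
    (\int[mu]_x g x)%E \is a fin_num.
  by move=> g0 gy; rewrite ge0_fin_numE// integral_ge0.
have key (g : T -> \bar R) : measurable_fun setT g -> (forall x, (0 <= g x)%E) ->
    (\int[mu]_x g x < +oo)%E -> fine (\int[mu]_x g x)%E =
    \sum_(0 <= k < n) c k * fine (\int[mu]_x g (piece_map c k x))%E.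
  move=> mg g0 gy; rewrite (splitting_integral_finite c_prob cn mg g0).
  rewrite -sum_fine; last first.
    move=> k _; have [ck|] := ltP 0 (c k).
      by rewrite fin_numM// fin// integral_piece_map_lty.
    by move=> ck; rewrite (@le_anti _ _ (c k) 0) ?ck ?c_prob.1// mul0e.
  apply: eq_bigr => k _; have [ck|] := ltP 0 (c k).
    by rewrite fineM// fin// integral_piece_map_lty.
  by move=> ck; rewrite (@le_anti _ _ (c k) 0) ?ck ?c_prob.1// mul0e mul0r.
rewrite /Rintegral integralE fineB ?fin// (key _ mp p0 py) (key _ mn n0 ny) -sumrB.
apply: eq_bigr => k _; rewrite -mulrBr; have [ck|] := ltP 0 (c k); last first.
  by move=> ck; rewrite (@le_anti _ _ (c k) 0) ?ck ?c_prob.1// !mul0r.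
have f1 := fin _ (fun x => p0 (piece_map c k x)) (integral_piece_map_lty mp p0 py ck).
have f2 := fin _ (fun x => n0 (piece_map c k x)) (integral_piece_map_lty mn n0 ny ck).
congr (_ * _); rewrite -(fineB f1 f2); congr fine.
have e := (integralE mu setT (fun x => (h (piece_map c k x))%:E)).
by rewrite e; congr (_ - _)%E; apply: eq_integral => x _; rewrite ?funeposE ?funenegE.
Qed.

End signed_splitting.

(** * Isometric weighted composition operators *)

Section weighted_composition.
Context d (T : measurableType d) (R : realType).
Variables (mu : {measure set T -> \bar R}) (p : R) (p1 : 1 <= p).
Local Notation C := (R[i]).
Local Notation E := (CLp mu p1).
Variables (h : T -> R) (s : T -> T).

(** The last field says that s carries the measure h^p mu to mu, which makes u |-> h * (u \o s)
    isometric. *)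
Record transport : Prop := Transport {
  transport_meas : measurable_fun setT h;
  transport_ge0 : forall y, 0 <= h y;
  transport_map : measurable_fun setT s;
  transport_integral : forall g : T -> \bar R, measurable_fun setT g ->
    (forall x, 0 <= g x)%E ->
    (\int[mu]_y ((h y `^ p)%:E * g (s y)) = \int[mu]_x g x)%E }.

Hypothesis hs : transport.
Let mh := transport_meas hs.
Let h0 := transport_ge0 hs.
Let ms := transport_map hs.

Let mhp : measurable_fun setT (fun y => (h y `^ p)%:E).
Proof.
apply/measurable_EFinP; apply: (measurableT_comp (f := fun x => x `^ p)) => //.
Qed.

(** The map s may pull a null set back to a set of positive measure, but only where h vanishes. This
    makes the weighted composition independent of the representative. *)
Lemma transport_ae (Q : T -> Prop) : {ae mu, forall x, Q x} ->
  {ae mu, forall y, h y = 0 \/ Q (s y)}.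
Proof.
move=> [N [mN N0 QN]].
have mi := @measurable_indic_EFin _ T R N mN.
have := transport_integral hs mi (fun x => ltac:(by rewrite lee_fin)).
rewrite [RHS]integral_indic// setIT N0 => I0.
have mI : measurable_fun setT (fun y => ((h y `^ p)%:E * (\1_N (s y))%:E)%E).
  by apply: emeasurable_funM => //; exact: (measurableT_comp mi ms).
have : (\int[mu]_y `|(h y `^ p)%:E * (\1_N (s y))%:E| = 0)%E.
  rewrite -I0; apply: eq_integral => y _; rewrite gee0_abs//.
  by rewrite mule_ge0 ?lee_fin ?powR_ge0.
move=> /(ae_eq_integral_abs _ measurableT mI).1; apply: aeS => y /(_ I) e.
have [hy|hy] := eqVneq (h y) 0; [by left|right].
apply: contrapT => /QN/= Ny; move: e; rewrite indicE mem_set// mule1 => -[].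
by move/eqP; rewrite powR_eq0 (negPf hy).
Qed.

Definition wcomp_fun (u : E) : E := mkLp mu p1 (fun y => (h y)%:C%C * ev u (s y)).

Lemma cmeasurable_wcomp (f : T -> C) : cmeasurable (f : T -> R[i]^o) ->
  cmeasurable ((fun y => (h y)%:C%C * f (s y)) : T -> R[i]^o).
Proof.
move=> [mr mi]; split.
  rewrite (_ : _ \o _ = (fun y => h y * complex.Re (f (s y)))).
    by apply: measurable_funM => //; exact: (measurableT_comp mr ms).
  by apply/funext => y /=; case: (f (s y)) => a b /=; rewrite mul0r subr0.
rewrite (_ : _ \o _ = (fun y => h y * complex.Im (f (s y)))).
  by apply: measurable_funM => //; exact: (measurableT_comp mi ms).
by apply/funext => y /=; case: (f (s y)) => a b /=; rewrite mul0r addr0.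
Qed.

Lemma wcomp_integral (f : T -> C) : cmeasurable (f : T -> R[i]^o) ->
  (\int[mu]_y (normc ((h y)%:C%C * f (s y)) `^ p)%:E = \int[mu]_x (normc (f x) `^ p)%:E)%E.
Proof.
move=> mf; rewrite -(transport_integral hs (measurable_normc_powR p mf)); last first.
  by move=> x; rewrite lee_fin powR_ge0.
apply: eq_integral => y _; rewrite normcM normc_real ger0_norm//.
by rewrite powRM ?normc_ge0// EFinM.
Qed.

Lemma inLp_wcomp (f : T -> C) : inLp mu p f -> inLp mu p (fun y => (h y)%:C%C * f (s y)).
Proof.
move=> [mf fy]; split; first exact: cmeasurable_wcomp.
by rewrite wcomp_integral.
Qed.

Lemma wcomp_mkLp (f : T -> C) : inLp mu p f ->
  wcomp_fun (mkLp mu p1 f) = mkLp mu p1 (fun y => (h y)%:C%C * f (s y)).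
Proof.
move=> hf; apply: mkLp_eq; [exact: inLp_wcomp (inLp_fun _)|exact: inLp_wcomp|].
by apply: aeS (transport_ae (ev_mkLp p1 hf)) => y [->|->//]; rewrite !mul0r.
Qed.

Lemma wcomp_linear : linear wcomp_fun.
Proof.
move=> a u v; have iu := inLp_fun u; have iv := inLp_fun v.
rewrite -{1}(mkLpK u) -{1}(mkLpK v) -(mkLp_lin p1 a iu iv) wcomp_mkLp; last exact: inLp_lin.
rewrite -(mkLp_lin p1 a (inLp_wcomp iu) (inLp_wcomp iv)); congr mkLp.
by apply/funext => y; rewrite mulrDr mulrCA.
Qed.

Lemma wcomp_norm u : `|wcomp_fun u| = `|u|.
Proof.
apply: CLp_norm_eq; rewrite Npow_mkLp; last exact: inLp_wcomp (inLp_fun _).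
by rewrite NpowE (wcomp_integral (ev_measurable u)).
Qed.

Definition wcomp : bop E := bop_of_isometry wcomp_linear wcomp_norm.

Lemma wcomp_positive_isometry : positive_isometries mu p1 wcomp.
Proof.
split=> [u /CLp_nonnegE u0|]; last exact: wcomp_norm.
apply/CLp_nonnegE; have := ev_mkLp p1 (inLp_wcomp (inLp_fun u)).
move=> h1; apply: aeS (aeI h1 (transport_ae u0)) => y [-> [->|h2]].
  by rewrite mul0r.
by rewrite mulr_ge0// ler0c.
Qed.

Lemma wcomp_rl (f : T -> R) : rLp mu p f ->
  wcomp (rl mu p1 f) = rl mu p1 (fun y => h y * f (s y)).
Proof.
move=> hf; rewrite /wcomp bop_of_isometryE wcomp_mkLp; last exact: rLp_inLp.
by congr mkLp; apply/funext => y; rewrite rmorphM.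
Qed.

End weighted_composition.

Section linear_norm.
Context (K : numFieldType) (V W : normedModType K).

Lemma linear_norm_le (f : {linear V -> W}) (M : K) :
  (forall x, `|x| <= 1 -> `|f x| <= M) -> forall x, `|f x| <= M * `|x|.
Proof.
move=> fM x; have [->|x0] := eqVneq x 0; first by rewrite linear0 !normr0 mulr0.
have nx : 0 < `|x| by rewrite normr_gt0.
rewrite -ler_pdivrMr// mulrC -[`|x|^-1]ger0_norm ?invr_ge0// -normrZ -linearZ.
by apply: fM; rewrite normrZ ger0_norm ?invr_ge0// mulVf// gt_eqF.
Qed.

End linear_norm.

(** * Matrices acting on dyadic cells *)

Section cell_operators.
Context (R : realType) (p : R) (p1 : 1 <= p).
Hypothesis p_gt1 : 1 < p.
Variable n : nat.
Local Notation mu := (lebesgue01 R).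
Local Notation T := (measurableTypeR R).
Local Notation C := (R[i]).
Local Notation E := (CLp mu p1).
Local Notation rl := (rl mu p1).
Local Notation rLp := (rLp mu p).
Local Notation N := (2 ^ n)%N.
Local Notation U := (@unif R N).
Implicit Types (u f : E) (v : nat -> R) (h : T -> R).

Let p0 : 0 < p. Proof. exact: lt_le_trans p1. Qed.
Let N0 : (0 < N)%N := expn2_gt0 n.
Let mu1 : mu setT = 1%E. Proof. exact: lebesgue01_setT. Qed.
Let mu_lty : (mu setT < +oo)%E. Proof. by rewrite mu1 ltry. Qed.
Let Up : prob_seq U := unif_prob R N0.
Let Nr0 : 0 < N%:R :> R. Proof. by rewrite ltr0n. Qed.

(** The factor N makes the pairing with this weight the average over the cell j. *)
Definition cellw (j : nat) (y : T) : R := if cell N y == j then N%:R else 0.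
Definition cellfun (v : nat -> R) (y : T) : R := v (cell N y).
Definition cellind (j : nat) : E := rl (cellfun (fun k => (k == j)%:R)).

Lemma measurable_cellfun v : measurable_fun setT (cellfun v).
Proof.
apply: (measurable_assemble (f := fun k _ => v k) (idx := fun y : T => cell N y)).
  by move=> k; exact: measurable_cell.
by move=> k; exact: measurable_cst.
Qed.

Lemma cellw_weight j : weight mu p (cellw j).
Proof.
apply: (weight_bounded (M := N%:R) p_gt1 mu_lty (measurable_cellfun (fun k => if k == j then N%:R else 0))).
by move=> y; rewrite /cellw/cellfun; case: eqP => _; rewrite ?normr0 ?ger0_norm.
Qed.

Definition cmean j : dual E := pair_dual p1 p_gt1 (cellw_weight j).

Lemma cellfun_integral (g : nat -> \bar R) : (forall k, 0 <= g k)%E ->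
  (\int[mu]_y g (cell N y) = \sum_(k < N) (N%:R^-1)%:E * g k)%E.
Proof.
move=> g0; have mg : measurable_fun setT (fun y : T => g (cell N y)).
  apply: (measurable_assemble (f := fun k _ => g k) (idx := fun y : T => cell N y)).
    by move=> k; exact: measurable_cell.
  by move=> k; exact: measurable_cst.
rewrite (splitting_integral_finite Up (@unif_out R N) mg (fun y => g0 _)) big_mkord.
apply: eq_bigr => k _; rewrite {1}/unif ltn_ord; congr (_ * _)%E.
rewrite (ae_eq_integral (fun=> g k))//.
- by rewrite integral_cst// mu1 mule1.
- exact: (measurableT_comp mg (measurable_piece_map U k)).
apply: aeS (lebesgue01_ae R) => x x01 _.
by rewrite /cell (piece_map_idx Up (unif_gt0 R (ltn_ord k)) x01).
Qed.

Lemma cellfun_powR v : (\int[mu]_y (`|cellfun v y| `^ p)%:E =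
  (N%:R^-1 * \sum_(k < N) `|v k| `^ p)%:E)%E.
Proof.
rewrite (cellfun_integral (g := fun k => (`|v k| `^ p)%:E)); last first.
  by move=> k; rewrite lee_fin powR_ge0.
by rewrite mulr_sumr -sumEFin.
Qed.

Lemma rLp_cellfun v : rLp (cellfun v).
Proof. by split; [exact: measurable_cellfun|rewrite cellfun_powR ltry]. Qed.

Lemma Npow_cellfun v : Npow (rl (cellfun v)) = (N%:R^-1 * \sum_(k < N) `|v k| `^ p)%:E.
Proof. by rewrite (Npow_rl p1 (rLp_cellfun v)) cellfun_powR. Qed.

Lemma cellind_sum v : \sum_(i < N) (v i)%:C%C *: cellind i = rl (cellfun v).
Proof.
pose u (i : 'I_N) y : R := v i * cellfun (fun k => (k == i)%:R) y.
have ru i : rLp (u i).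
  by have := rLp_cellfun (fun k => v i * (k == i)%:R).
have [h1 h2] := rl_sum p1 mu1 (index_enum 'I_N) ru.
transitivity (rl (fun y => \sum_(i < N) u i y)).
  by rewrite h2; apply: eq_bigr => i _; rewrite -(rlZ p1 mu1 _ (rLp_cellfun _)).
apply: (rl_ext p1 h1 (rLp_cellfun v)); apply: aeS (lebesgue01_ae R) => y y01.
have yN := cell_lt N0 y01; rewrite (bigD1 (Ordinal yN))//= big1 ?addr0.
  by rewrite /u /cellfun eqxx mulr1.
move=> i iy; rewrite /u /cellfun; case: eqP => [e|]; last by rewrite mulr0.
by case/eqP: iy; apply: val_inj.
Qed.

Lemma integrable_rLp h : rLp h -> mu.-integrable setT (EFin \o (h : T -> R)).
Proof.
move=> hh; have := integrable_weight p1 p_gt1 hh (weight1 p_gt1 mu1).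
by congr (_.-integrable _ _); apply/funext => x /=; rewrite mulr1.
Qed.

Lemma rLp_piece_map h k : (k < N)%N -> rLp h -> rLp (fun x => h (piece_map U k x)).
Proof.
move=> kN [mh hy]; split; first exact: (measurableT_comp mh (measurable_piece_map U k)).
apply: (@integral_piece_map_lty _ U N Up (@unif_out R N) (fun x => (`|h x| `^ p)%:E)) => //.
- exact: measurable_normr_powR.
- exact: unif_gt0.
Qed.

Definition pmean k (h : T -> R) : R := (\int[mu]_x h (piece_map U k x))%R.

Lemma cmean_rl j h : (j < N)%N -> rLp h -> cmean j (rl h) = (pmean j h)%:C%C.
Proof.
move=> jN hh; rewrite pair_dualE (pair_rl p1 p_gt1 (cellw_weight j) hh); congr (_%:C)%C.
have ih := integrable_weight p1 p_gt1 hh (cellw_weight j).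
rewrite /rpair (Rintegral_splitting Up (@unif_out R N) ih) big_mkord.
have e (k : 'I_N) : U k * (\int[mu]_x (h (piece_map U k x) * cellw j (piece_map U k x)))%R =
    if k == j :> nat then pmean j h else 0.
  transitivity (U k * (\int[mu]_x ((if k == j :> nat then N%:R else 0) * h (piece_map U k x)))%R).
    congr (_ * _); congr fine; apply: ae_eq_integral => //.
    - exact: (measurable_int _ (integrable_piece_map Up (@unif_out R N) ih (unif_gt0 R (ltn_ord k)))).
    - apply/measurable_EFinP; apply: measurable_funM => //.
      exact: (rLp_meas (rLp_piece_map (ltn_ord k) hh)).
    apply: aeS (lebesgue01_ae R) => x x01 _.
    by rewrite /cellw /cell (piece_map_idx Up (unif_gt0 R (ltn_ord k)) x01) mulrC.
  rewrite RintegralZl//; last exact: (integrable_rLp (rLp_piece_map (ltn_ord k) hh)).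
  rewrite /unif ltn_ord; case: eqP => [->|_]; last by rewrite mul0r mulr0.
  by rewrite mulrA mulVf ?mul1r// gt_eqF.
rewrite (eq_bigr _ (fun k _ => e k)) (bigD1 (Ordinal jN))//= eqxx big1 ?addr0// => i ij.
by case: eqP => // ij'; case/eqP: ij; exact: val_inj.
Qed.

Lemma pmean_cellfun j v : (j < N)%N -> pmean j (cellfun v) = v j.
Proof.
move=> jN; rewrite /pmean -[RHS]mulr1 -[X in _ * X](_ : fine (mu setT) = 1); last by rewrite mu1.
rewrite -Rintegral_cst//; congr fine; apply: ae_eq_integral => //.
- apply/measurable_EFinP; exact: (measurableT_comp (measurable_cellfun v) (measurable_piece_map U j)).
apply: aeS (lebesgue01_ae R) => x x01 _.
by rewrite /cellfun /cell (piece_map_idx Up (unif_gt0 R jN) x01).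
Qed.

Definition cell_op_fun (b : nat -> nat -> R) (u : E) : E :=
  \sum_(i < N) (\sum_(j < N) (b i j)%:C%C * cmean j u) *: cellind i.

Lemma cell_op_linear b : linear (cell_op_fun b).
Proof.
move=> a u v; rewrite /cell_op_fun scaler_sumr -big_split/=; apply: eq_bigr => i _.
rewrite scalerA -scalerDl; congr (_ *: _); rewrite mulr_sumr -big_split/=.
apply: eq_bigr => j _.
have -> : pair (cellw j) (a *: u + v) = a * pair (cellw j) u + pair (cellw j) v.
  exact: (pair_linear p_gt1 (cellw_weight j) a u v).
by rewrite mulrDr mulrCA.
Qed.

Lemma cell_op_bound b : exists M : C, forall u, `|u| <= 1 -> `|cell_op_fun b u| <= M.
Proof.
have /choice[m hm] : forall j, exists m : C, 0 < m /\ forall u, `|cmean j u| <= m * `|u|.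
  move=> j; have [m m0 hm] := continuous_linear_bound (@dual_continuous _ _ (cmean j)).
  by exists m.
exists (\sum_(i < N) (\sum_(j < N) `|(b i j)%:C%C| * m j) * `|cellind i|) => u u1.
apply: le_trans (ler_norm_sum _ _ _) _; apply: ler_sum => i _.
rewrite normrZ ler_wpM2r//; apply: le_trans (ler_norm_sum _ _ _) _; apply: ler_sum => j _.
rewrite normrM ler_wpM2l//; have [m0 hj] := hm j; apply: le_trans (hj u) _.
by rewrite ler_piMr// ltW.
Qed.

Lemma cell_op_continuous b : continuous (cell_op_fun b).
Proof.
have [M hM] := cell_op_bound b.
pose f : {linear E -> E} := HB.pack (cell_op_fun b) (GRing.isLinear.Build _ _ _ _ _ (cell_op_linear b)).
exact: (linear_lipschitz_continuous (f := f) (M := M) hM).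
Qed.

Definition cell_op b : bop E :=
  let f : {linear E -> E} := HB.pack (cell_op_fun b) (GRing.isLinear.Build _ _ _ _ _ (cell_op_linear b)) in
  @Bop _ _ f (@cell_op_continuous b).

Lemma cell_opE b u : cell_op b u =
  \sum_(i < N) (\sum_(j < N) (b i j)%:C%C * cmean j u) *: cellind i.
Proof. by []. Qed.

Lemma cell_op_rl b h : rLp h ->
  cell_op b (rl h) = rl (cellfun (fun i => \sum_(j < N) b i j * pmean j h)).
Proof.
move=> hh; rewrite cell_opE -cellind_sum; apply: eq_bigr => i _; congr (_ *: _).
rewrite rmorph_sum; apply: eq_bigr => j _.
by rewrite (cmean_rl (ltn_ord j) hh) rmorphM.
Qed.

(** The tangent inequality of t^p at m, the modulus of the integral, is integrated over t = |h|. *)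
Lemma jensen_powR h : rLp h -> ((`|(\int[mu]_x h x)%R| `^ p)%:E <= \int[mu]_x (`|h x| `^ p)%:E)%E.
Proof.
move=> hh; set m := `|_|; have m0 : 0 <= m by exact: normr_ge0.
have ih := integrable_rLp hh.
have ia : mu.-integrable setT (EFin \o (fun x => `|h x|)) by exact: integrable_norm ih.
have ip : mu.-integrable setT (EFin \o (fun x => `|h x| `^ p)) := integrable_normr_powR hh.
have mh : m <= (\int[mu]_x `|h x|)%R by exact: le_normr_Rintegral.
have cm : p * m `^ (p - 1) * m = p * m `^ p by rewrite -mulrA powR_pred_mul.
have c0 : 0 <= p * m `^ (p - 1) by rewrite mulr_ge0 ?powR_ge0// ltW.
have ic : mu.-integrable setT (EFin \o (fun x => p * m `^ (p - 1) * `|h x|)).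
  exact: (integrableZl measurableT (p * m `^ (p - 1)) ia).
have ik (k : R) : mu.-integrable setT (EFin \o (fun=> k)).
  by apply: (integrable_bounded mu1 (M := `|k|)) => //; exact: measurable_cst.
have il : mu.-integrable setT (EFin \o (fun x => (m `^ p - p * m `^ p) + p * m `^ (p - 1) * `|h x|)).
  exact: (integrableD measurableT (ik _) ic).
have le1 : (\int[mu]_x ((m `^ p - p * m `^ p) + p * m `^ (p - 1) * `|h x|) <=
    \int[mu]_x (`|h x| `^ p))%R.
  apply: le_Rintegral => // x _; have := bregman_ge0 p_gt1 (normr_ge0 (h x)) m0.
  rewrite /bregman mulrBr cm => b0; rewrite -subr_ge0; apply: le_trans b0 _.
  by rewrite le_eqVlt; apply/orP; left; apply/eqP; ring.
have fp : (\int[mu]_x (`|h x| `^ p)%:E)%E \is a fin_num by exact: integrable_fin_num ip.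
rewrite -[leRHS](fineK fp) lee_fin; apply: le_trans le1.
rewrite (RintegralD measurableT (ik _) ic) (RintegralZl _ measurableT ia).
rewrite Rintegral_cst// [fine _](_ : _ = 1) ?mulr1; last by rewrite mu1.
have : p * m `^ p <= p * m `^ (p - 1) * (\int[mu]_x `|h x|)%R by rewrite -cm ler_wpM2l.
by move=> le2; rewrite -{1}[m `^ p](subrK (p * m `^ p)) lerD2l.
Qed.

Definition cond_exp : bop E := cell_op (fun i j => (i == j)%:R).

Lemma cond_expE u : cond_exp u = \sum_(i < N) cmean i u *: cellind i.
Proof.
rewrite cell_opE; apply: eq_bigr => i _; congr (_ *: _).
rewrite (bigD1 i)//= eqxx mul1r big1 ?addr0// => j ji.
by rewrite eq_sym (_ : (j == i :> nat) = false) ?mul0r//; apply/negbTE.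
Qed.

Lemma cond_exp_rl h : rLp h -> cond_exp (rl h) = rl (cellfun (fun i => pmean i h)).
Proof.
move=> hh; rewrite cond_expE -cellind_sum; apply: eq_bigr => i _.
by rewrite (cmean_rl (ltn_ord i) hh).
Qed.

Lemma cond_exp_rl_le h : rLp h -> `|cond_exp (rl h)| <= `|rl h|.
Proof.
move=> hh; rewrite (cond_exp_rl hh) CLp_norm_le Npow_cellfun (Npow_rl p1 hh).
have mhp := measurable_normr_powR p (rLp_meas hh).
rewrite (splitting_integral_finite Up (@unif_out R N) mhp (fun x => ltac:(by rewrite lee_fin powR_ge0))).
rewrite big_mkord mulr_sumr -sumEFin; apply: lee_sum => k _.
rewrite EFinM /unif ltn_ord; apply: lee_wpmul2l; first by rewrite lee_fin invr_ge0.
exact: jensen_powR (rLp_piece_map (ltn_ord k) hh).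
Qed.

Lemma rl_Re_le u : `|rl (fun x => complex.Re (ev u x))| <= `|u|.
Proof.
apply: Npow_le_ae; apply: aeS (ev_rl p1 (rLp_Re u)) => x ->.
by rewrite normc_real Re_le_normc.
Qed.

Lemma rl_Im_le u : `|rl (fun x => complex.Im (ev u x))| <= `|u|.
Proof.
apply: Npow_le_ae; apply: aeS (ev_rl p1 (rLp_Im u)) => x ->.
by rewrite normc_real Im_le_normc.
Qed.

(** Jensen's inequality is applied to the real and imaginary parts separately, whence the factor 2;
    density arguments tolerate it. The sharp bound on real functions is [cond_exp_rl_le]. *)
Lemma cond_exp_le u : `|cond_exp u| <= 2 * `|u|.
Proof.
rewrite {1}(rl_Re_Im u) linearD linearZ/= mulr_natl mulr2n.
apply: le_trans (ler_normD _ _) _; apply: lerD.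
  exact: le_trans (cond_exp_rl_le (rLp_Re u)) (rl_Re_le u).
rewrite normrZ (_ : `|'i%C| = 1 :> C) ?mul1r; last first.
  by rewrite normr_normc [normc _]/= expr0n add0r expr1n sqrtr1.
exact: le_trans (cond_exp_rl_le (rLp_Im u)) (rl_Im_le u).
Qed.

Lemma cond_exp_cellind j : (j < N)%N -> cond_exp (cellind j) = cellind j.
Proof.
move=> jN; rewrite (cond_exp_rl (rLp_cellfun _)) -cellind_sum -[RHS]cellind_sum.
by apply: eq_bigr => i _; rewrite pmean_cellfun.
Qed.

Lemma is_step_sum f : is_step N f -> exists z : nat -> C, f = \sum_(i < N) z i *: cellind i.
Proof.
move=> [z hz]; exists z; rewrite {1}(rl_Re_Im f).
have e1 : rl (fun x => complex.Re (ev f x)) = rl (cellfun (fun k => complex.Re (z k))).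
  by apply: (rl_ext p1 (rLp_Re f) (rLp_cellfun _)); apply: aeS hz => x ->.
have e2 : rl (fun x => complex.Im (ev f x)) = rl (cellfun (fun k => complex.Im (z k))).
  by apply: (rl_ext p1 (rLp_Im f) (rLp_cellfun _)); apply: aeS hz => x ->.
rewrite e1 e2 -!cellind_sum scaler_sumr -big_split/=; apply: eq_bigr => i _.
by rewrite scalerA -scalerDl -complexE.
Qed.

Lemma cond_exp_step f : is_step N f -> cond_exp f = f.
Proof.
move=> /is_step_sum[z ->]; rewrite linear_sum; apply: eq_bigr => i _.
by rewrite linearZ; congr (_ *: _); exact: cond_exp_cellind.
Qed.

Section matrix.
Variable S : bop E.
Hypotheses (S0 : positive_op S) (S1 : bop_contraction S).

(** Taking the real part loses nothing for a positive S, whose entries are real and nonnegative by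
    [op_entryE]. *)
Definition op_entry i j : R := complex.Re (cmean i (S (cellind j))).

Lemma nonneg_cellfun v : (forall k, 0 <= v k) -> CLp_nonneg (rl (cellfun v)).
Proof. by move=> v0; apply: rl_nonneg; [exact: rLp_cellfun|apply: aeW => x; exact: v0]. Qed.

Lemma cmean_nonneg i u : (i < N)%N -> CLp_nonneg u -> 0 <= (cmean i u : C).
Proof.
move=> iN /nonneg_rl[h [hh h0 ->]]; rewrite (cmean_rl iN hh) ler0c.
by apply: Rintegral_ge0 => x _.
Qed.

Lemma op_entryE i j : (i < N)%N -> cmean i (S (cellind j)) = (op_entry i j)%:C%C.
Proof.
move=> iN; have : 0 <= (cmean i (S (cellind j)) : C).
  by apply: (cmean_nonneg iN); apply: S0; apply: nonneg_cellfun => k; rewrite ler0n.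
have key (z : C) : 0 <= z -> z = (complex.Re z)%:C%C.
  by case: z => a b; rewrite lecE/= => /andP[/eqP -> _].
exact: key.
Qed.

Lemma op_entry_ge0 i j : (i < N)%N -> 0 <= op_entry i j.
Proof.
move=> iN; rewrite -ler0c -op_entryE//.
by apply: (cmean_nonneg iN); apply: S0; apply: nonneg_cellfun => k; rewrite ler0n.
Qed.

Lemma cell_op_entry u : cell_op op_entry u = cond_exp (S (cond_exp u)).
Proof.
rewrite [RHS]cond_expE cell_opE; apply: eq_bigr => i _; congr (_ *: _).
rewrite cond_expE [S _]linear_sum [RHS]linear_sum; apply: eq_bigr => j _.
by rewrite [S _]linearZ [RHS]linearZ op_entryE//; exact: mulrC.
Qed.

(** The vector x is read as a nonnegative step function, to which S and then the conditional
    expectation are applied; neither increases the norm, and the common factor 1 / N cancels. *)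
Lemma op_entry_contraction (x : 'I_N -> R) : (forall j, 0 <= x j) ->
  \sum_(i < N) (\sum_(j < N) op_entry i j * x j) `^ p <= \sum_(j < N) (x j) `^ p.
Proof.
move=> x0; pose v k := if insub k is Some j then x j else 0.
have vE (j : 'I_N) : v j = x j by rewrite /v valK.
have v0 k : 0 <= v k by rewrite /v; case: insubP.
have [h [hh h0 Sh]] := nonneg_rl (S0 (nonneg_cellfun v0)).
have : `|cond_exp (rl h)| <= `|rl (cellfun v)|.
  by apply: le_trans (cond_exp_rl_le hh) _; rewrite -Sh; exact: S1.
rewrite (cond_exp_rl hh) CLp_norm_le !Npow_cellfun lee_fin ler_pM2l ?invr_gt0//.
rewrite [leRHS](eq_bigr (fun j => x j `^ p)); last first.
  by move=> j _; rewrite vE ger0_norm.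
congr (_ <= _); apply: eq_bigr => i _; congr (_ `^ _).
have m0 : 0 <= pmean i h by apply: Rintegral_ge0 => z _.
rewrite ger0_norm//; apply: complexI.
rewrite -(cmean_rl (ltn_ord i) hh) -Sh -cellind_sum [S _]linear_sum [LHS]linear_sum rmorph_sum.
apply: eq_bigr => j _; rewrite [S _]linearZ [LHS]linearZ op_entryE// vE.
by rewrite rmorphM; exact: mulrC.
Qed.

End matrix.
End cell_operators.

Lemma sum_divn (V : nmodType) (F : nat -> V) (a d : nat) : (0 < d)%N ->
  \sum_(k < a * d) F (k %/ d)%N = (\sum_(i < a) F i) *+ d.
Proof.
move=> d0; rewrite -(big_mkord xpredT (fun k => F (k %/ d)%N)) -(big_mkord xpredT F).
elim: a => [|a ih]; first by rewrite mul0n !big_geq// mul0rn.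
rewrite mulSn addnC (@big_cat_nat _ _ _ (a * d)%N) ?leq_addr//=.
rewrite ih big_nat_recr//= mulrnDl; congr (_ + _).
rewrite -{1}[(a * d)%N]add0n big_addn addKn (eq_big_nat _ _ (F2 := fun=> F a)).
  by rewrite sumr_const_nat subn0.
move=> k /andP[_ kd]; rewrite divnDMl ?divn_small//.
Qed.

(** * Random choice of the cell from which a value is copied *)

Section cell_table.
Context (R : realType) (p : R) (p1 : 1 <= p).
Hypothesis p_gt1 : 1 < p.
Local Notation mu := (lebesgue01 R).
Local Notation T := (measurableTypeR R).
Local Notation C := (R[i]).
Local Notation E := (CLp mu p1).
Local Notation rl := (rl mu p1).
Local Notation rLp := (rLp mu p).
Variables (n L : nat) (pr H : nat -> nat -> R) (tgt : nat -> 'I_(2 ^ n)) (B : R).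
Local Notation N := (2 ^ n)%N.
Local Notation U m := (@unif R (2 ^ (n + m))).

(* In the cell [i], label [l] has probability [pr i l]; points of that label are
   sent to the cell [tgt l] and values are multiplied by [H i l]. The condition
   [table_iso] makes the resulting operator isometric. *)
Record table : Prop := Table {
  table_ge0 : forall i l, 0 <= pr i l;
  table_out : forall i l, (L <= l)%N -> pr i l = 0;
  table_sum : forall i, \sum_(l < L) pr i l = 1;
  table_coef_ge0 : forall i l, 0 <= H i l;
  table_coef_le : forall i l, H i l <= B;
  table_iso : forall j : 'I_N, \sum_(i < N) \sum_(l < L | tgt l == j) pr i l * H i l `^ p = 1 }.

Hypothesis tab : table.
Let p0 : 0 < p. Proof. exact: lt_le_trans p1. Qed.
Let mu1 : mu setT = 1%E. Proof. exact: lebesgue01_setT. Qed.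
Let mu_lty : (mu setT < +oo)%E. Proof. by rewrite mu1 ltry. Qed.
Let N0 m : (0 < 2 ^ m)%N := expn2_gt0 m.
Let Up m : prob_seq (U m) := unif_prob R (N0 (n + m)).

Let pr_prob i : prob_seq (pr i).
Proof.
apply: (@prob_seq_finite _ _ L); [exact: table_ge0 tab i|exact: table_out tab i|].
by rewrite /series/= big_mkord (table_sum tab).
Qed.

Section scale.
Variable m : nat.
Local Notation M := (2 ^ (n + m))%N.

(* The position of [y] in its dyadic cell of level [n + m] is the random source from
   which its label is drawn. *)
Definition label (y : T) : nat := piece_idx (pr (cell N y)) (piece_pos (U m) y).
Definition table_coef (y : T) : R := H (cell N y) (label y).
(** The position of a point within its label interval is again uniform on [0, 1[, and it becomes the
    position within the target cell. *)
Definition table_map (y : T) : T :=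
  piece_map (@unif R N) (tgt (label y)) (piece_pos (pr (cell N y)) (piece_pos (U m) y)).
Definition table_piece k l (x : T) : T :=
  piece_map (U m) k (piece_map (pr (k %/ 2 ^ m)%N) l x).

Lemma measurable_by_label d' (T' : measurableType d') (f : nat -> nat -> T -> T') :
  (forall i l, measurable_fun setT (f i l)) ->
  measurable_fun setT (fun y => f (cell N y) (label y) y).
Proof.
move=> mf.
apply: (measurable_assemble (idx := fun y : T => cell N y)
  (f := fun i y => f i (piece_idx (pr i) (piece_pos (U m) y)) y)).
  by move=> k; exact: measurable_cell.
move=> i; apply: (measurable_assemble (idx := fun y : T => piece_idx (pr i) (piece_pos (U m) y))
  (f := f i)) => // l.
rewrite -[X in measurable X]setTI.
exact: (measurable_piece_pos (Up m) measurableT (measurable_piece_idx (pr_prob i) l)).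
Qed.

Lemma measurable_table_coef : measurable_fun setT table_coef.
Proof. by apply: (measurable_by_label (f := fun i l _ => H i l)). Qed.

Lemma measurable_table_map : measurable_fun setT table_map.
Proof.
apply: (measurable_by_label (f := fun i l y =>
  piece_map (@unif R N) (tgt l) (piece_pos (pr i) (piece_pos (U m) y)))) => i l.
apply: (measurableT_comp (measurable_piece_map _ _)).
apply: (measurableT_comp (measurable_piece_pos (pr_prob i))).
exact: measurable_piece_pos (Up m).
Qed.

Lemma measurable_table_piece k l : measurable_fun setT (table_piece k l).
Proof. exact: (measurableT_comp (measurable_piece_map _ _) (measurable_piece_map _ _)). Qed.

Lemma table_pieceE k l x : (k < M)%N -> 0 < pr (k %/ 2 ^ m)%N l -> 0 <= x < 1 ->
  let y := table_piece k l x in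
  [/\ cell M y = k, cell N y = (k %/ 2 ^ m)%N, table_coef y = H (k %/ 2 ^ m)%N l &
    table_map y = piece_map (@unif R N) (tgt l) x].
Proof.
move=> kM pl x01 y; have Uk := unif_gt0 R kM.
have x1 := piece_map01 (pr_prob (k %/ 2 ^ m)%N) pl x01.
have y01 : 0 <= y < 1 by exact: (piece_map01 (Up m)).
have e1 : cell M y = k by exact: (piece_map_idx (Up m) Uk x1).
have e2 : cell N y = (k %/ 2 ^ m)%N by rewrite (cell_expn2 n m y01) e1.
have e3 : piece_pos (U m) y = piece_map (pr (k %/ 2 ^ m)%N) l x.
  exact: (piece_map_pos (Up m) Uk x1).
have e4 : label y = l.
  by rewrite /label e2 e3 (piece_map_idx (pr_prob _) pl x01).
split => //; first by rewrite /table_coef e2 e4.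
by rewrite /table_map e4 e2 e3 (piece_map_pos (pr_prob _) pl x01).
Qed.

Lemma table_integral (G : T -> \bar R) : measurable_fun setT G -> (forall y, 0 <= G y)%E ->
  (\int[mu]_y G y = \sum_(k < M) \sum_(l < L) (M%:R^-1 * pr (k %/ 2 ^ m)%N l)%:E *
     \int[mu]_x G (table_piece k l x))%E.
Proof.
move=> mG G0; rewrite (splitting_integral_finite (Up m) (@unif_out R M) mG G0) big_mkord.
apply: eq_bigr => k _; rewrite {1}/unif ltn_ord.
have mk : measurable_fun setT (fun x : T => G (piece_map (U m) k x)).
  exact: (measurableT_comp mG (measurable_piece_map _ _)).
rewrite (splitting_integral_finite (pr_prob _) (table_out tab (k %/ 2 ^ m)%N) mk (fun x => G0 _)).
rewrite big_mkord ge0_sume_distrr; last first.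
  by move=> l _; rewrite mule_ge0 ?lee_fin ?(table_ge0 tab)// integral_ge0.
by apply: eq_bigr => l _; rewrite muleA -EFinM.
Qed.

Lemma table_Rintegral (G : T -> R) : mu.-integrable setT (EFin \o G) ->
  (\int[mu]_y G y = \sum_(k < M) \sum_(l < L) (M%:R^-1 * pr (k %/ 2 ^ m)%N l) *
     \int[mu]_x G (table_piece k l x))%R.
Proof.
move=> iG; rewrite (Rintegral_splitting (Up m) (@unif_out R M) iG) big_mkord.
apply: eq_bigr => k _; rewrite {1}/unif ltn_ord.
have ik := integrable_piece_map (Up m) (@unif_out R M) iG (unif_gt0 R (ltn_ord k)).
rewrite (Rintegral_splitting (pr_prob _) (table_out tab (k %/ 2 ^ m)%N) ik).
rewrite big_mkord mulr_sumr.
by apply: eq_bigr => l _; rewrite mulrA.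
Qed.

(** On a piece of given cell and label the coefficient is constant and the map is the
    parametrisation of the target cell. Grouping the pieces by target, with 2^m fine cells in each
    cell i, leaves the sums that [table_iso] sets to 1. *)
Lemma table_transport : transport mu p table_coef table_map.
Proof.
split.
- exact: measurable_table_coef.
- by move=> y; exact: table_coef_ge0 tab _ _.
- exact: measurable_table_map.
move=> g mg g0.
have mhp : measurable_fun setT (fun y => (table_coef y `^ p)%:E).
  apply/measurable_EFinP; apply: (measurableT_comp (f := fun x => x `^ p)).
    exact: measurable_powR.
  exact: measurable_table_coef.
have mG : measurable_fun setT (fun y => ((table_coef y `^ p)%:E * g (table_map y))%E).
  by apply: emeasurable_funM => //; exact: (measurableT_comp mg measurable_table_map).
rewrite (table_integral mG); last by move=> y; rewrite mule_ge0// lee_fin powR_ge0.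
pose A (j : 'I_N) := (\int[mu]_x g (piece_map (@unif R N) j x))%E.
have A0 j : (0 <= A j)%E by apply: integral_ge0 => x _; exact: g0.
pose c (k l : nat) := M%:R^-1 * (pr (k %/ 2 ^ m)%N l * H (k %/ 2 ^ m)%N l `^ p).
have c0 k l : 0 <= c k l by rewrite !mulr_ge0 ?invr_ge0 ?(table_ge0 tab) ?powR_ge0.
transitivity (\sum_(k < M) \sum_(l < L) (c k l)%:E * A (tgt l))%E.
  apply: eq_bigr => k _; apply: eq_bigr => l _.
  (* A label of probability 0 has an empty piece, on which [table_pieceE] says nothing; both sides
     carry the factor 0. *)
  have [pl|] := ltP 0 (pr (k %/ 2 ^ m)%N l); last first.
    move=> pl; have -> : pr (k %/ 2 ^ m)%N l = 0 by apply: le_anti; rewrite pl (table_ge0 tab).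
    by rewrite /c (le_anti _ : pr (k %/ 2 ^ m)%N l = 0) ?mul0r ?mulr0 ?mul0e// pl (table_ge0 tab).
  have -> : (\int[mu]_x ((table_coef (table_piece k l x) `^ p)%:E * g (table_map (table_piece k l x))) =
      (H (k %/ 2 ^ m)%N l `^ p)%:E * A (tgt l))%E.
    have mgt : measurable_fun setT (fun x : T => g (piece_map (@unif R N) (tgt l) x)).
      exact: (measurableT_comp mg (measurable_piece_map _ _)).
    have e := ge0_integralZl_EFin mu measurableT (fun x _ => g0 (piece_map (@unif R N) (tgt l) x))
      mgt (powR_ge0 (H (k %/ 2 ^ m)%N l) p).
    rewrite /A -e; apply: ae_eq_integral.
    - exact: measurableT.
    - exact: (measurableT_comp mG (measurable_table_piece k l)).
    - exact: measurable_funeM.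
    apply: aeS (lebesgue01_ae R) => x x01 _.
    by have [_ _ -> ->] := table_pieceE (ltn_ord k) pl x01.
  by rewrite muleA -EFinM /c mulrA.
transitivity (\sum_(j < N) (N%:R^-1)%:E * A j)%E; last first.
  rewrite (splitting_integral_finite (unif_prob R (N0 n)) (@unif_out R N) mg g0) big_mkord.
  by apply: eq_bigr => j _; rewrite /unif ltn_ord.
transitivity (\sum_(j < N) (\sum_(k < M) \sum_(l < L | tgt l == j) c k l)%:E * A j)%E; last first.
  apply: eq_bigr => j _; congr (_%:E * _)%E; rewrite /c.
  under eq_bigr do rewrite -mulr_sumr.
  rewrite -mulr_sumr expnD.
  rewrite (sum_divn (fun i => \sum_(l < L | tgt l == j) pr i l * H i l `^ p) N (N0 m)).
  rewrite (table_iso tab) natrM invfM -mulrA.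
  by rewrite mulVf ?mulr1// pnatr_eq0 -lt0n.
transitivity (\sum_(j < N) \sum_(k < M) \sum_(l < L | tgt l == j) (c k l)%:E * A j)%E; last first.
  apply: eq_bigr => j _; rewrite -sumEFin ge0_sume_distrl; last first.
    by move=> k _; rewrite lee_fin sumr_ge0.
  apply: eq_bigr => k _; rewrite -sumEFin ge0_sume_distrl//.
  by move=> l _; rewrite lee_fin.
rewrite [RHS]exchange_big/=; apply: eq_bigr => k _.
rewrite (partition_big (fun l : 'I_L => tgt l) xpredT)//=.
by apply: eq_bigr => j _; apply: eq_bigr => l /eqP ->.
Qed.

Definition table_op : bop E := wcomp p1 table_transport.

End scale.

Definition table_mean (i j : nat) : R := \sum_(l < L | tgt l == j :> nat) pr i l * H i l.

Section bounded_function.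
Variables (f : T -> R) (K : R).
Hypotheses (mf : measurable_fun setT f) (fK : forall x, `|f x| <= K).

Let v i := \sum_(l < L) pr i l * H i l * pmean n (tgt l) f.
Definition table_error m y := table_coef m y * f (table_map m y) - cellfun n v y.
Local Notation u := table_error.

Let K0 : 0 <= K. Proof. exact: le_trans (fK 0). Qed.
Let B0 : 0 <= B. Proof. exact: le_trans (table_coef_ge0 tab 0 0) (table_coef_le tab 0 0). Qed.

Let rf : rLp f. Proof. exact: (rLp_bounded p1 mu_lty mf fK). Qed.

Let pmean_le k : `|pmean n k f| <= K.
Proof.
have mg : measurable_fun setT (fun x : T => f (piece_map (@unif R N) k x)).
  exact: (measurableT_comp mf (measurable_piece_map _ _)).
have ig := integrable_bounded mu1 mg (fun x => fK _).
apply: le_trans (le_normr_Rintegral measurableT ig) _.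
have -> : K = (\int[mu]_x K)%R by rewrite Rintegral_cst// [fine _](_ : _ = 1) ?mulr1// mu1.
apply: le_Rintegral => //; first exact: integrable_norm ig.
by apply: (integrable_bounded mu1 (M := `|K|)) => //; exact: measurable_cst.
Qed.

Let v_le i : `|v i| <= B * K.
Proof.
apply: le_trans (ler_norm_sum _ _ _) _.
rewrite -[B * K]mul1r -(table_sum tab i) mulr_suml; apply: ler_sum => l _.
rewrite -mulrA normrM ger0_norm ?(table_ge0 tab)// ler_wpM2l ?(table_ge0 tab)//.
by rewrite normrM ger0_norm ?(table_coef_ge0 tab)// ler_pM ?(table_coef_ge0 tab)// (table_coef_le tab).
Qed.

Lemma measurable_table_error m : measurable_fun setT (u m).
Proof.
apply: measurable_funB; last exact: measurable_cellfun.
apply: measurable_funM; first exact: measurable_table_coef.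
exact: (measurableT_comp mf (measurable_table_map m)).
Qed.

Lemma table_error_le m y : `|u m y| <= B * K + B * K.
Proof.
apply: le_trans (ler_normB _ _) _; apply: lerD; last exact: v_le.
by rewrite normrM ger0_norm ?(table_coef_ge0 tab)// ler_pM ?(table_coef_ge0 tab)// (table_coef_le tab).
Qed.

Lemma table_error_weight m : weight mu p (u m).
Proof. exact: (weight_bounded p_gt1 mu_lty (measurable_table_error m) (table_error_le m)). Qed.

(** Within each cell of level n + m all labels occur with their prescribed probabilities, and [v] is
    the resulting mean; the error therefore has mean 0 on each of these cells. *)
Lemma table_error_cell m w : (\int[mu]_y (cellfun (n + m) w y * u m y))%R = 0.
Proof.
have ig := integrable_weight p1 p_gt1 (rLp_cellfun p (n + m) w) (table_error_weight m).
rewrite (table_Rintegral m ig).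
have e (k : 'I_(2 ^ (n + m))) (l : 'I_L) : (2 ^ (n + m))%:R^-1 * pr (k %/ 2 ^ m)%N l *
    (\int[mu]_x (cellfun (n + m) w (table_piece m k l x) * u m (table_piece m k l x)))%R =
    (2 ^ (n + m))%:R^-1 * w k * (pr (k %/ 2 ^ m)%N l * H (k %/ 2 ^ m)%N l * pmean n (tgt l) f
       - pr (k %/ 2 ^ m)%N l * v (k %/ 2 ^ m)%N).
  have [pl|] := ltP 0 (pr (k %/ 2 ^ m)%N l); last first.
    move=> pl; have -> : pr (k %/ 2 ^ m)%N l = 0 by apply: le_anti; rewrite pl (table_ge0 tab).
    by rewrite mulr0 !mul0r subrr mulr0.
  set i := (k %/ 2 ^ m)%N.
  have mg : measurable_fun setT (fun x : T => f (piece_map (@unif R N) (tgt l) x)).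
    exact: (measurableT_comp mf (measurable_piece_map _ _)).
  have ifp := integrable_bounded mu1 mg (fun x => fK _).
  have ic (c : R) : mu.-integrable setT (EFin \o (fun=> c)).
    by apply: (integrable_bounded mu1 (M := `|c|)) => //; exact: measurable_cst.
  have i1 : mu.-integrable setT (EFin \o (fun x : T => w k * H i l * f (piece_map (@unif R N) (tgt l) x))).
    exact: (integrableZl measurableT (w k * H i l) ifp).
  have i2 : mu.-integrable setT (EFin \o (fun x : T =>
      w k * H i l * f (piece_map (@unif R N) (tgt l) x) + - (w k * v i))).
    exact: (integrableD measurableT i1 (ic _)).
  have -> : (\int[mu]_x (cellfun (n + m) w (table_piece m k l x) * u m (table_piece m k l x)))%R =
      (\int[mu]_x (w k * H i l * f (piece_map (@unif R N) (tgt l) x) + - (w k * v i)))%R.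
    congr fine; apply: ae_eq_integral.
    - exact: measurableT.
    - exact: (measurableT_comp (measurable_int _ ig) (measurable_table_piece m k l)).
    - exact: measurable_int i2.
    apply: aeS (lebesgue01_ae R) => x x01 _.
    have [e1 e2 e3 e4] := table_pieceE (ltn_ord k) pl x01.
    congr EFin; rewrite /table_error /cellfun e1 e2 e3 e4 -/i; ring.
  rewrite (RintegralD measurableT i1 (ic _)) (RintegralZl _ measurableT ifp) Rintegral_cst//.
  rewrite [fine _](_ : _ = 1); last by rewrite mu1.
  rewrite -/(pmean n (tgt l) f); ring.
under eq_bigr do under eq_bigr do rewrite e.
rewrite big1// => k _; rewrite -mulr_sumr sumrB -mulr_suml (table_sum tab) mul1r.
by rewrite subrr mulr0.
Qed.

Lemma table_error_step m (F : E) : is_step (2 ^ (n + m)) F -> pair (u m) F = 0.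
Proof.
move=> /is_step_sum[z ->]; rewrite -(pair_dualE p_gt1 (table_error_weight m)).
rewrite linear_sum big1// => i _; rewrite linearZ /= (pair_rl p1 p_gt1 (table_error_weight m) (rLp_cellfun p _ _)).
by rewrite /rpair table_error_cell; exact: scaler0.
Qed.

Lemma table_error_pair : exists2 D : R, 0 <= D & forall m (F : E), `|pair (u m) F| <= D%:C%C * `|F|.
Proof.
pose q := p / (p - 1); pose K' := B * K + B * K.
have K'0 : 0 <= K' by rewrite addr_ge0// mulr_ge0.
have q0 : 0 <= q by rewrite divr_ge0 ?subr_ge0 ?(ltW p0) ?ltW.
exists (2 * (1 + K' `^ q)); first by rewrite mulr_ge0// addr_ge0// powR_ge0.
move=> m F; rewrite -(pair_dualE p_gt1 (table_error_weight m)).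
apply: linear_norm_le => G G1; apply: le_trans (pair_bound p_gt1 (table_error_weight m) G1) _.
rewrite lecR ler_pM2l// lerD2l -[leRHS]/(fine (K' `^ q)%:E); apply: le_fine.
- by apply: integral_ge0 => x _; rewrite lee_fin powR_ge0.
- apply: (@le_trans _ _ (\int[mu]_x (K' `^ q)%:E)%E); last by rewrite integral_cst// mu1 mule1.
  apply: ge0_le_integral => //.
  + exact: measurable_weight_powR (measurable_table_error m).
  + by move=> x _; rewrite lee_fin powR_le// table_error_le.
- exact: ltry.
Qed.

(** As f is arbitrary, the earlier error is not constant on fine cells; it is approximated by a step
    function, orthogonal to all errors of finer scale. [table_error_pair] bounds the remainder
    uniformly in m. *)
Lemma table_error_orthogonal m0 :
  (\int[mu]_x (u m0 x * u m x))%R @[m --> \oo] --> (0 : R).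
Proof.
have [D D0 hD] := table_error_pair; apply/cvgrPdist_lt => e e0.
have e1 : 0 < e / (D + 1) by rewrite divr_gt0// ltr_wpDl.
have ru : rLp (u m0) := rLp_bounded p1 mu_lty (measurable_table_error m0) (table_error_le m0).
have [l [F stF Fu]] := step_dense p_gt1 (rl (u m0)) e1.
exists l => // m /= lm; rewrite sub0r normrN.
have stF' : is_step (2 ^ (n + m)) F by apply: is_step_widen stF; rewrite (leq_trans lm)// leq_addl.
have pE : (\int[mu]_x (u m0 x * u m x))%:C%C = pair (u m) (rl (u m0) - F).
  rewrite -(pair_dualE p_gt1 (table_error_weight m)) linearB.
  by rewrite /= (table_error_step stF') subr0 (pair_rl p1 p_gt1 (table_error_weight m) ru).
rewrite -ltcR -normc_real -normr_normc pE; apply: le_lt_trans (hD m _) _.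
apply: (@le_lt_trans _ _ (D * (e / (D + 1)))%:C%C).
  by rewrite rmorphM; apply: ler_wpM2l (ltW Fu); rewrite ler0c.
by rewrite ltcR mulrCA gtr_pMr// ltr_pdivrMr ?ltr_wpDl// mul1r ltrDl.
Qed.

Lemma table_op_bounded_cvg (phi : dual E) :
  (fun m => phi (table_op m (rl f) - cell_op p1 p_gt1 n table_mean (rl f)) : R[i]^o) @ \oo --> (0 : R[i]^o).
Proof.
rewrite (_ : (fun m => _) = (fun m => phi (rl (u m)) : R[i]^o)).
  exact: (weak_null_orthogonal mu1 measurable_table_error table_error_le table_error_orthogonal phi).
apply/funext => m; congr (phi _).
rewrite (wcomp_rl p1 (table_transport m) rf) (cell_op_rl p1 p_gt1 n table_mean rf).
have rw : rLp (fun y => table_coef m y * f (table_map m y)).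
  apply: (rLp_bounded (M := B * K) p1 mu_lty).
    apply: measurable_funM; first exact: measurable_table_coef.
    exact: (measurableT_comp mf (measurable_table_map m)).
  move=> y; rewrite normrM ger0_norm ?(table_coef_ge0 tab)//.
  by rewrite ler_pM ?(table_coef_ge0 tab)// (table_coef_le tab).
rewrite -(rlB p1 rw (rLp_cellfun p n _)); congr rl; apply/funext => y.
rewrite /table_error; congr (_ - _); rewrite /cellfun /v.
rewrite (partition_big (fun l : 'I_L => tgt l) xpredT)//=.
apply: eq_bigr => j _; rewrite /table_mean mulr_suml.
by apply: eq_big => [l|l /eqP ->].
Qed.

End bounded_function.
End cell_table.

Section cyclic_label.
Variables (N : nat) (N0 : (0 < N)%N).

(** A total target map that sends both the label j and the label N + j to the cell j. *)
Definition cyc (l : nat) : 'I_N := Ordinal (ltn_pmod l N0).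

Lemma cyc_id (j : 'I_N) : cyc j = j.
Proof. by apply: val_inj; rewrite /= modn_small. Qed.

Lemma cyc_addn (j : 'I_N) : cyc (N + j) = j.
Proof. by apply: val_inj; rewrite /= modnDl modn_small. Qed.

Lemma sum_double (V : nmodType) (G : nat -> V) :
  \sum_(l < N + N) G l = \sum_(j < N) G j + \sum_(j < N) G (N + j)%N.
Proof. by rewrite big_split_ord. Qed.

Lemma sum_double_cyc (V : nmodType) (G : nat -> V) (j : 'I_N) :
  \sum_(l < N + N | cyc l == j) G l = G j + G (N + j)%N.
Proof.
rewrite big_split_ord/=; congr (_ + _).
  by rewrite (eq_bigl (pred1 j)) ?big_pred1_eq// => l; rewrite /= cyc_id.
by rewrite (eq_bigl (pred1 j)) ?big_pred1_eq// => l; rewrite /= cyc_addn.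
Qed.

End cyclic_label.

Lemma powRV (R : realType) (x r : R) : 0 < x -> (x^-1) `^ r = (x `^ r)^-1.
Proof.
move=> x0; have xr : 0 < x `^ r by exact: powR_gt0.
apply: (@mulfI _ (x `^ r)); first by rewrite gt_eqF.
rewrite -powRM ?invr_ge0 ?(ltW x0)// mulfV ?gt_eqF// mulfV ?gt_eqF//.
by rewrite powR1.
Qed.

(** * From a contracting matrix to a table *)

Section table_of_matrix.
Context (R : realType) (p : R).
Hypothesis p_gt1 : 1 < p.
Variables (n : nat) (a : nat -> nat -> R) (tau : R).
Local Notation N := (2 ^ n)%N.
Hypothesis a_ge0 : forall i j : 'I_N, 0 <= a i j.
Hypothesis a_contraction : forall x : 'I_N -> R, (forall j, 0 <= x j) ->
  \sum_(i < N) (\sum_(j < N) a i j * x j) `^ p <= \sum_(j < N) (x j) `^ p.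
Hypothesis tau01 : 0 < tau < 1.

Let p0 : 0 < p. Proof. exact: lt_trans p_gt1. Qed.
Let t0 : 0 < tau. Proof. by case/andP: tau01. Qed.
Let t1 : 0 < 1 - tau. Proof. by case/andP: tau01 => _ h; rewrite subr_gt0. Qed.
Let N0 : (0 < N)%N := expn2_gt0 n.
Let Nr0 : 0 < N%:R :> R. Proof. by rewrite ltr0n. Qed.
Local Notation c := (cyc N0).

Let avg (k : R) : \sum_(j < N) (k / N%:R) = k.
Proof. by rewrite -mulr_suml sumr_const card_ord -(mulr_natr k) mulfK ?gt_eqF. Qed.

(* The labels [l < N] carry the matrix, with [th i j = a' i j * x j / y i]; the label
   [N + j], of probability [tau / N], carries the missing mass of column [j]. *)
Lemma table_exists : exists pr H B, table p (N + N) pr H c B /\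
  forall i j : 'I_N, `|table_mean (N + N) pr H c i j - a i j| <= 2 * tau * a i j + tau `^ (1 - p^-1).
Proof.
(* Shrinking by 1 - tau makes the contraction strict, as [subextremal] requires. *)
pose a' (i j : 'I_N) := (1 - tau) * a i j.
have a'0 i j : 0 <= a' i j by rewrite mulr_ge0// ltW.
have th01 : 0 <= (1 - tau) `^ p < 1.
  rewrite powR_ge0/=; have e : (1 : R) `^ p = 1 by rewrite powR1.
  by rewrite -[ltRHS]e powR_lt ?(ltW t1)// gtrBl.
have a'c (x : 'I_N -> R) : (forall j, 0 <= x j) ->
    \sum_i (\sum_j a' i j * x j) `^ p <= (1 - tau) `^ p * \sum_j (x j) `^ p.
  move=> x0; rewrite (eq_bigr (fun i : 'I_N => (1 - tau) `^ p * (\sum_(j < N) a i j * x j) `^ p)).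
    by rewrite -mulr_sumr ler_wpM2l ?powR_ge0// a_contraction.
  move=> i _; rewrite -powRM ?(ltW t1)//; last by rewrite sumr_ge0// => j _; rewrite mulr_ge0.
  by rewrite mulr_sumr; congr (_ `^ _); apply: eq_bigr => j _; rewrite mulrA.
have [x [x0 xs]] := subextremal p_gt1 a'0 th01 a'c.
pose y i := \sum_k a' i k * x k.
have y0 i : 0 <= y i by rewrite sumr_ge0// => k _; rewrite mulr_ge0// ltW.
(* If y i = 0, the row i of a' vanishes as x is positive; the multipliers are 0 and any distribution
   will do. *)
pose th (i j : 'I_N) := if y i == 0 then (j == c 0)%:R else a' i j * x j / y i.
have th0 i j : 0 <= th i j.
  by rewrite /th; case: ifP => _ //; rewrite divr_ge0// mulr_ge0// ltW.
have thS i : \sum_j th i j = 1.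
  have [yi|yi] := eqVneq (y i) 0; last first.
    rewrite (eq_bigr (fun j => a' i j * x j / y i)); last by move=> j _; rewrite /th (negbTE yi).
    by rewrite -mulr_suml -/(y i) divff.
  rewrite (eq_bigr (fun j => (j == c 0)%:R)); last by move=> j _; rewrite /th yi eqxx.
  by rewrite (bigD1 (c 0%N))//= eqxx big1 ?addr0// => j /negbTE ->.
have thM i j : th i j * (y i / x j) = a' i j.
  rewrite /th; have [yi|yi] := eqVneq (y i) 0; last by field; rewrite yi gt_eqF.
  rewrite yi mul0r mulr0; apply/esym/eqP.
  have : a' i j * x j <= 0.
    rewrite -yi /y (bigD1 j)//= lerDl sumr_ge0// => k _; rewrite mulr_ge0//; exact: ltW.
  by rewrite pmulr_lle0// => h; apply/eqP/le_anti; rewrite h a'0.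
pose s j := \sum_i th i j * (y i / x j) `^ p.
have s01 j : 0 <= s j <= 1.
  rewrite sumr_ge0 /=; last by move=> i _; rewrite mulr_ge0// powR_ge0.
  have xj := powR_gt0 (p - 1) (x0 j).
  rewrite /s (eq_bigr (fun i => a' i j * y i `^ (p - 1) / x j `^ (p - 1))).
    by rewrite -mulr_suml ler_pdivrMr// mul1r; exact: xs.
  move=> i _; have yx : 0 <= y i / x j by rewrite divr_ge0// ltW.
  rewrite -(powR_pred_mul p_gt1 yx) mulrCA thM powRM ?invr_ge0 ?(ltW (x0 j))// powRV//.
  by rewrite mulrC mulrA.
(* The mass missing in column j once the matrix labels are used with total probability 1 - tau. It
   lies between 0 and 1 because s j <= 1, and [H'] is chosen so that tau * H'^p restores it. *)
pose be j := 1 - (1 - tau) * s j.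
have be01 j : 0 <= be j <= 1.
  have /andP[h1 h2] := s01 j; rewrite /be subr_ge0 gerBl mulr_ge0 ?(ltW t1)// andbT.
  by rewrite -[leRHS]mulr1 ler_pM ?(ltW t1)// gerBl ltW.
pose H' j := (be j / tau) `^ p^-1.
have H'0 j : 0 <= H' j by exact: powR_ge0.
have H'p j : H' j `^ p = be j / tau.
  by rewrite powR_invK ?gt_eqF// divr_ge0 ?(ltW t0)//; case/andP: (be01 j).
pose pr (i l : nat) := if (l < N)%N then (1 - tau) * th (c i) (c l)
  else if (l < N + N)%N then tau / N%:R else 0.
pose H (i l : nat) := if (l < N)%N then y (c i) / x (c l) else H' (c l).
have prl i (j : 'I_N) : pr i j = (1 - tau) * th (c i) j by rewrite /pr ltn_ord cyc_id.
have prr i (j : 'I_N) : pr i (N + j)%N = tau / N%:R.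
  by rewrite /pr ltnNge leq_addr/= ltn_add2l ltn_ord.
have Hl i (j : 'I_N) : H i j = y (c i) / x j by rewrite /H ltn_ord cyc_id.
have Hr i (j : 'I_N) : H i (N + j)%N = H' j by rewrite /H ltnNge leq_addr/= cyc_addn.
have yx0 i j : 0 <= y i / x j by rewrite divr_ge0// ltW.
exists pr, H, (\sum_(i < N) \sum_(j < N) (y i / x j) + \sum_(j < N) H' j); split; first split.
- move=> i l; rewrite /pr; case: ifP => _; first by rewrite mulr_ge0// ltW.
  by case: ifP => // _; rewrite divr_ge0// ltW.
- by move=> i l h; rewrite /pr ltnNge (leq_trans (leq_addr _ _) h)/= ltnNge h.
- move=> i; rewrite sum_double (eq_bigr _ (fun j _ => prl i j)) -mulr_sumr thS mulr1.
  by rewrite (eq_bigr _ (fun j _ => prr i j)) avg subrK.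
- by move=> i l; rewrite /H; case: ifP => // _; rewrite divr_ge0// ltW.
- have A0 : 0 <= \sum_(i < N) \sum_(j < N) (y i / x j) by do 2 apply: sumr_ge0 => ? _.
  have B0 : 0 <= \sum_(j < N) H' j by apply: sumr_ge0.
  move=> i l; rewrite /H; case: ifP => _.
    rewrite -[leLHS]addr0 lerD// (bigD1 (c i))//= (bigD1 (c l))//= -addrA lerDl addr_ge0//.
      exact: sumr_ge0.
    by do 2 apply: sumr_ge0 => ? _.
  by rewrite -[leLHS]add0r lerD// (bigD1 (c l))//= lerDl sumr_ge0.
- move=> j; have e (i : 'I_N) : \sum_(l < N + N | c l == j) pr i l * H i l `^ p =
      (1 - tau) * (th i j * (y i / x j) `^ p) + be j / N%:R.
    rewrite (sum_double_cyc N0 (fun l => pr i l * H i l `^ p)) prl prr Hl Hr H'p cyc_id mulrA.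
    by congr (_ + _); [rewrite ?mulrA|field; rewrite ?gt_eqF].
  rewrite (eq_bigr _ (fun i _ => e i)) big_split/= -mulr_sumr -/(s j).
  by rewrite avg /be addrC subrK.
move=> i j; have -> : table_mean (N + N) pr H c i j = (1 - tau) * a' i j + tau / N%:R * H' j.
  transitivity (\sum_(l < N + N | c l == j) pr i l * H i l); first by [].
  by rewrite (sum_double_cyc N0 (fun l => pr i l * H i l)) prl prr Hl Hr cyc_id -mulrA thM.
have -> : (1 - tau) * a' i j + tau / N%:R * H' j - a i j =
    tau / N%:R * H' j - (2 * tau - tau ^+ 2) * a i j by rewrite /a'; ring.
have h1 : `|(2 * tau - tau ^+ 2) * a i j| <= 2 * tau * a i j.
  have t2 : 0 <= 2 * tau - tau ^+ 2.
    by rewrite subr_ge0 expr2 ler_pM2r// (le_trans (ltW (_ : tau < 1)))// ?ler1n//; case/andP: tau01.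
  by rewrite ger0_norm ?mulr_ge0// ler_wpM2r// gerBl sqr_ge0.
have h2 : `|tau / N%:R * H' j| <= tau `^ (1 - p^-1).
  rewrite ger0_norm ?mulr_ge0 ?divr_ge0 ?(ltW t0)//.
  apply: (@le_trans _ _ (tau * (tau^-1) `^ p^-1)).
    apply: ler_pM; rewrite ?divr_ge0 ?(ltW t0)//.
      by rewrite ler_pdivrMr// ler_peMr ?(ltW t0)// ler1n.
    apply: powR_le; rewrite ?invr_ge0 ?(ltW p0)//.
      by rewrite divr_ge0 ?(ltW t0)//; case/andP: (be01 j).
    by rewrite -[leRHS]mul1r ler_wpM2r ?invr_ge0 ?(ltW t0)//; case/andP: (be01 j).
  rewrite powRV// ler_pdivrMr ?powR_gt0// -powRD ?subrK ?powRr1 ?(ltW t0)//.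
  by rewrite gt_eqF// implybT.
by apply: le_trans (ler_normB _ _) _; rewrite addrC lerD.
Qed.

End table_of_matrix.

Lemma cvg_sumr (K : numFieldType) (V : normedModType K) (J : Type) (r : seq J)
    (f : J -> nat -> V) (l : J -> V) : (forall j, f j @ \oo --> l j) ->
  (fun k => \sum_(j <- r) f j k) @ \oo --> \sum_(j <- r) l j.
Proof.
move=> fl; elim: r => [|j r ih].
  rewrite big_nil (_ : (fun k => _) = (fun=> 0)); first exact: cvg_cst.
  by apply/funext => k; rewrite big_nil.
rewrite big_cons (_ : (fun k => _) = (fun k => f j k + \sum_(i <- r) f i k)).
  exact: (cvgD (fl j) ih).
by apply/funext => k; rewrite big_cons.
Qed.

Section scalar_limits.
Context (R : realType).
Local Notation C := (R[i]).

Lemma complex_gt0 (z : C) : 0 < z -> exists2 e : R, 0 < e & z = e%:C%C.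
Proof. by case: z => a b; rewrite ltcE/= => /andP[/eqP -> a0]; exists a. Qed.

Lemma cvg_real_complex (u : nat -> R) (l : R) : u @ \oo --> l ->
  (fun k => (u k)%:C%C : C^o) @ \oo --> (l%:C%C : C^o).
Proof.
move=> ul; apply/cvgrPdist_lt => _ /complex_gt0[e1 e0 ->].
move/cvgrPdist_lt : ul => /(_ _ e0); apply: filterS => k hk.
by rewrite -rmorphB normr_normc normc_real ltcR.
Qed.

Lemma cvg_le_near (u : nat -> R) (l : R) (v : nat -> R) : v @ \oo --> 0 ->
  (forall k, `|u k - l| <= v k) -> u @ \oo --> l.
Proof.
move=> v0 uv; apply/cvgrPdist_lt => e e0; move/cvgrPdist_lt : v0 => /(_ _ e0).
apply: filterS => k; rewrite sub0r normrN => /(le_lt_trans (ler_norm _)).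
by rewrite distrC; exact: le_lt_trans.
Qed.

Lemma cvg_powR0 (u : nat -> R) (r : R) : 0 < r -> (forall k, 0 <= u k) -> u @ \oo --> 0 ->
  (fun k => u k `^ r) @ \oo --> 0.
Proof.
move=> r0 u0 ul; apply/cvgrPdist_lt => e e0.
have e1 : 0 < e `^ r^-1 by exact: powR_gt0.
move/cvgrPdist_lt : ul => /(_ _ e1); apply: filterS => k.
rewrite !sub0r !normrN !ger0_norm ?powR_ge0// => h.
by rewrite -(@powR_invK _ r e) ?gt_eqF ?(ltW e0)// powR_lt.
Qed.

End scalar_limits.

(** * Weak approximation of contractions by isometries *)

Section isometries_weakly_dense.
Context (R : realType) (p : R) (p1 : 1 <= p).
Hypothesis p_gt1 : 1 < p.
Local Notation mu := (lebesgue01 R).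
Local Notation T := (measurableTypeR R).
Local Notation C := (R[i]).
Local Notation E := (CLp mu p1).
Local Notation rl := (rl mu p1).
Local Notation rLp := (rLp mu p).
Implicit Types (u v : E) (S W Q : bop E) (phi : dual E).

Let p0 : 0 < p. Proof. exact: lt_le_trans p1. Qed.
Let mu1 : mu setT = 1%E. Proof. exact: lebesgue01_setT. Qed.

Lemma cond_exp_cvg u (e : R) : 0 < e ->
  \forall n \near \oo, `|u - cond_exp p1 p_gt1 n u| < e%:C%C.
Proof.
move=> e0; have e3 : 0 < e / 3 by rewrite divr_gt0.
have [l [f stf fu]] := step_dense p_gt1 u e3.
exists l => // n /= ln; have stf' : is_step (2 ^ n) f by exact: is_step_widen stf.
have -> : u - cond_exp p1 p_gt1 n u = (u - f) - cond_exp p1 p_gt1 n (u - f).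
  by rewrite linearB (cond_exp_step p_gt1 stf') opprB addrA subrK.
apply: le_lt_trans (ler_normB _ _) _.
apply: le_lt_trans (lerD (lexx _) (cond_exp_le p_gt1 n _)) _.
rewrite (_ : `|u - f| + 2 * `|u - f| = 3 * `|u - f|); last by ring.
by rewrite (_ : e%:C%C = 3 * (e / 3)%:C%C) ?ltr_pM2l// -[3](rmorph_nat (real_complex R)) -rmorphM mulrC divfK.
Qed.

(** The uniform bound on the g m extends the convergence from bounded real functions to all real
    ones by truncation, then to complex ones by linearity. *)
Lemma bounded_dense_cvg0 (g : nat -> E -> C^o) (D : R) : 0 < D ->
  (forall m (a : C) u v, g m (a *: u + v) = a * g m u + g m v) ->
  (forall m u, `|g m u| <= D%:C%C * `|u|) ->
  (forall (f : T -> R) K, measurable_fun setT f -> (forall y, `|f y| <= K) ->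
     (fun m => g m (rl f)) @ \oo --> (0 : C^o)) ->
  forall u, (fun m => g m u) @ \oo --> (0 : C^o).
Proof.
move=> D0 glin gD gbd.
have closure u : (forall e : R, 0 < e -> exists2 v, (fun m => g m v) @ \oo --> (0 : C^o) &
    `|u - v| < e%:C%C) -> (fun m => g m u) @ \oo --> (0 : C^o).
  move=> h; apply/cvgrPdist_lt => _ /complex_gt0[e1 e0 ->].
  have e3 : 0 < e1 / 2 by rewrite divr_gt0.
  have [v gv uv] := h (e1 / 2 / D) ltac:(by rewrite divr_gt0).
  have e4 : (0 : C) < (e1 / 2)%:C%C by rewrite ltcR.
  move/cvgrPdist_lt : gv => /(_ _ e4); apply: filterS => m; rewrite !sub0r !normrN => hv.
  have -> : g m u = g m (u - v) + g m v.
    have := glin m 1 (u - v) v; rewrite scale1r mul1r subrK; exact.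
  apply: le_lt_trans (ler_normD _ _) _.
  rewrite (splitr e1) -real_complexD; apply: ler_ltD => //.
  apply: le_trans (gD m _) _; have -> : (e1 / 2)%:C%C = D%:C%C * (e1 / 2 / D)%:C%C.
    by rewrite -rmorphM; congr (_%:C)%C; field; rewrite gt_eqF.
  by apply: ler_wpM2l (ltW uv); rewrite ler0c ltW.
have real h : rLp h -> (fun m => g m (rl h)) @ \oo --> (0 : C^o).
  move=> rh; apply: closure => e e0; have [n hn] := rl_truncation p1 rh e0.
  exists (rl (fun x => clamp n%:R (h x))) => //.
  apply: (gbd _ n%:R (measurable_truncation n%:R (rLp_meas rh))) => x; exact: clamp_norm.
move=> u; rewrite (rl_Re_Im u) addrC.
rewrite (_ : (fun m => _) = (fun m => 'i%C *: (g m (rl (fun x => complex.Im (ev u x)))) +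
  g m (rl (fun x => complex.Re (ev u x))))); last by apply/funext => m; rewrite glin.
have := cvgD (cvgZr (k := 'i%C : C) (real _ (rLp_Im u))) (real _ (rLp_Re u)).
by rewrite scaler0 addr0; exact.
Qed.

Definition approximable S := forall O : set (wot E), open O -> O S ->
  exists2 W, O W & positive_isometries mu p1 W.

(** Approximability is membership in a weak closure, so limits may be nested: tables at finer
    scales, then tau tending to 0, then finer conditional expectations. *)
Lemma approximable_lim (Sk : nat -> bop E) S : (forall k, approximable (Sk k)) ->
  (forall x phi, (fun k => phi (Sk k x) : C^o) @ \oo --> (phi (S x) : C^o)) -> approximable S.
Proof.
move=> hS cv O oO OS.
have cv' : Sk @ \oo --> (S : wot E) by apply/wot_cvgP => x phi; exact: cv.
have [k _ /(_ k (leqnn k))/= hk] := cv' _ (open_nbhs_nbhs (conj oO OS)).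
exact: hS hk.
Qed.

Lemma approximable_table n L pr H (tgt : nat -> 'I_(2 ^ n)) B (tab : table p L pr H tgt B) :
  approximable (cell_op p1 p_gt1 n (table_mean L pr H tgt)).
Proof.
apply: (@approximable_lim (fun m => table_op p1 tab m)).
  by move=> m O oO Om; exists (table_op p1 tab m) => //; exact: wcomp_positive_isometry.
move=> x phi; set b := cell_op _ _ _ _.
have [_ /complex_gt0[M1 M10 ->] phiM] := continuous_linear_bound (@dual_continuous _ _ phi).
have [_ /complex_gt0[M2 M20 ->] bM] := continuous_linear_bound (@bop_continuous _ _ b).
have h := @bounded_dense_cvg0 (fun m u => phi (table_op p1 tab m u - b u)) (M1 * (1 + M2)).
have {}h u : (fun m => phi (table_op p1 tab m u - b u) : C^o) @ \oo --> (0 : C^o).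
  apply: h.
  - by rewrite mulr_gt0// addr_gt0.
  - move=> m a v w; rewrite 2!linearP opprD addrACA -scalerBr; exact: linearP.
  - move=> m v; apply: le_trans (phiM _) _; rewrite rmorphM -mulrA.
    apply: ler_wpM2l; first by rewrite ler0c ltW.
    apply: le_trans (ler_normB _ _) _; rewrite rmorphD rmorph1 mulrDl mul1r.
    apply: lerD; last exact: bM.
    by rewrite /table_op /wcomp bop_of_isometryE wcomp_norm//; exact: table_transport tab m.
  - move=> f K mf fK; exact: (table_op_bounded_cvg p_gt1 tab mf fK phi).
rewrite (_ : (fun k => _) = (fun k => phi (table_op p1 tab k x - b x) + phi (b x) : C^o)); last first.
  by apply/funext => k; rewrite linearB; exact: esym (subrK _ _).
have := cvgD (h x) (cvg_cst (phi (b x) : C^o) (F := \oo)).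
by rewrite add0r; exact.
Qed.

Lemma cell_op_cvg n (b : nat -> nat -> nat -> R) (a : nat -> nat -> R) :
  (forall i j : 'I_(2 ^ n), (fun k => b k i j) @ \oo --> a i j) ->
  forall x phi, (fun k => phi (cell_op p1 p_gt1 n (b k) x) : C^o) @ \oo -->
    (phi (cell_op p1 p_gt1 n a x) : C^o).
Proof.
move=> ba x phi.
have phiE c : phi (cell_op p1 p_gt1 n c x) = \sum_(i < 2 ^ n) \sum_(j < 2 ^ n)
    (phi (cellind p1 n i) * cmean p1 p_gt1 n j x) *: ((c i j)%:C%C : C^o).
  rewrite cell_opE linear_sum; apply: eq_bigr => i _.
  rewrite linearZ [LHS]mulrC mulr_sumr; apply: eq_bigr => j _.
  by rewrite mulrCA mulrC.
rewrite phiE (_ : (fun k => _) = (fun k => \sum_(i < 2 ^ n) \sum_(j < 2 ^ n)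
    (phi (cellind p1 n i) * cmean p1 p_gt1 n j x) *: ((b k i j)%:C%C : C^o))); last first.
  by apply/funext => k; rewrite phiE.
apply: cvg_sumr => i; apply: cvg_sumr => j.
by apply: cvgZr; apply: cvg_real_complex; exact: ba.
Qed.

Lemma approximable_cell_op n (a : nat -> nat -> R) :
  (forall i j : 'I_(2 ^ n), 0 <= a i j) ->
  (forall x : 'I_(2 ^ n) -> R, (forall j, 0 <= x j) ->
    \sum_(i < 2 ^ n) (\sum_(j < 2 ^ n) a i j * x j) `^ p <= \sum_(j < 2 ^ n) (x j) `^ p) ->
  approximable (cell_op p1 p_gt1 n a).
Proof.
move=> a0 ac; pose tau (k : nat) : R := k.+2%:R^-1.
have tau01 k : 0 < tau k < 1 by rewrite invr_gt0 ltr0n/= invf_lt1 ?ltr0n// ltr1n.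
have tau0 : tau @ \oo --> 0.
  have := @cvg_harmonic R; move=> /(cvg_comp _ _ (cvg_addnr 1)) => h.
  by rewrite (_ : tau = harmonic \o (addn^~ 1)); [exact: h|apply/funext => k; rewrite /= addn1].
have /choice[pr /choice[H /choice[B hB]]] k :=
  table_exists p_gt1 a0 ac (tau01 k).
apply: (@approximable_lim (fun k => cell_op p1 p_gt1 n (table_mean (2 ^ n + 2 ^ n) (pr k) (H k) (cyc (expn2_gt0 n))))).
  by move=> k; exact: approximable_table (hB k).1.
apply: cell_op_cvg => i j.
apply: (@cvg_le_near _ _ _ (fun k => 2 * tau k * a i j + tau k `^ (1 - p^-1))); last first.
  by move=> k; exact: (hB k).2.
rewrite -[0](addr0 0); apply: cvgD.
  have := cvgM (cvgM (cvg_cst (2 : R)) tau0) (cvg_cst (a i j)).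
  by rewrite mulr0 mul0r; exact.
apply: cvg_powR0 tau0; first by rewrite subr_gt0 invf_lt1.
by move=> k; case/andP: (tau01 k) => /ltW.
Qed.

(** The compression of S by the conditional expectation of level n is given by a contracting
    nonnegative matrix, and converges strongly to S as n grows. *)
Lemma approximable_contraction S : positive_contractions mu p1 S -> approximable S.
Proof.
move=> [S0 S1]; pose Sn n : bop E := cell_op p1 p_gt1 n (op_entry p_gt1 n S).
apply: (@approximable_lim Sn).
  move=> n; apply: approximable_cell_op.
    by move=> i j; exact: op_entry_ge0.
  by move=> x x0; exact: op_entry_contraction.
move=> x phi; apply: (cvg_comp (fun n => Sn n x) phi _ (@dual_continuous _ _ phi (S x))).
apply/cvgrPdist_lt => _ /complex_gt0[e1 e0 ->].
have e4 : 0 < e1 / 2 / 2 by rewrite !divr_gt0.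
have e3 : 0 < e1 / 2 by rewrite divr_gt0.
apply: filterS2 (cond_exp_cvg x e4) (cond_exp_cvg (S x) e3) => n h1 h2.
rewrite (cell_op_entry p_gt1 n S0 x).
have -> : S x - cond_exp p1 p_gt1 n (S (cond_exp p1 p_gt1 n x)) =
    (S x - cond_exp p1 p_gt1 n (S x)) + cond_exp p1 p_gt1 n (S (x - cond_exp p1 p_gt1 n x)).
  by rewrite [S (_ - _)]linearB [cond_exp _ _ _ (_ - _)]linearB addrA subrK.
apply: le_lt_trans (ler_normD _ _) _; rewrite (splitr e1) -real_complexD.
apply: ltrD => //; apply: le_lt_trans (cond_exp_le p_gt1 n _) _.
have -> : (e1 / 2)%:C%C = 2 * (e1 / 2 / 2)%:C%C.
  by rewrite -(rmorph_nat (real_complex R) 2) -rmorphM; congr (_%:C)%C; field.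
by rewrite ltr_pM2l//; exact: le_lt_trans (S1 _) h1.
Qed.

(** A weak neighbourhood of a contraction contains a positive isometry W; the towers over W converge
    to it strongly, hence weakly, and thus enter the same open set. *)
Lemma contractions_dense (O : set (wot E)) : open O -> O `&` positive_contractions mu p1 !=set0 ->
  O `&` [set S | positive_isometries mu p1 S /\ forall k, concentrates k S] !=set0.
Proof.
move=> oO [S [OS Sc]]; have [W OW [W0 W1]] := approximable_contraction Sc oO OS.
have cvs := tower_seq_cvg p_gt1 W1.
have cvw : tower_seq W1 @ \oo --> (W : wot E).
  apply/wot_cvgP => x phi.
  have h1 : (fun Q : bop E => Q x) @ (tower_seq W1 @ \oo) --> W x.
    by apply: (sot_cvgP W _).1; exact: cvs.
  exact: (cvg_comp _ _ h1 (@dual_continuous _ _ phi (W x))).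
have [m _ /(_ m (leqnn m))/= hm] := cvw _ (open_nbhs_nbhs (conj oO OW)).
exists (tower_seq W1 m); split => //.
split; first by split; [exact: cell_tower_positive|exact: cell_tower_isometry].
by move=> k; exact: cell_tower_concentrates.
Qed.

End isometries_weakly_dense.

Theorem proposition8p16 (R : realType) (p : R) (p1 : 1 < p) :
  let mu := lebesgue01 R in
  let Lp := CLp mu (ltW p1) in
  [/\ typical_in (X := sot Lp) (positive_isometries mu (ltW p1))
        (no_rank_one_limit mu (ltW p1)),
      typical_in (X := sot Lp) (positive_surjective_isometries mu (ltW p1))
        (no_rank_one_limit mu (ltW p1)) &
      typical_in (X := wot Lp) (positive_contractions mu (ltW p1))
        (no_rank_one_limit mu (ltW p1))].
Proof.
move=> mu Lp; have mu1 := lebesgue01_setT R; split.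
- exact: (typical_sot p1 mu1 (@subset_refl _ _) (isometries_dense p1)).
- apply: (typical_sot p1 mu1 _ (surjective_isometries_dense p1)).
  by move=> S [].
- exact: (typical_wot p1 mu1 (contractions_dense p1)).
Qed.
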